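(* There is a universal constant $C$ such that the following holds. Fix $n\ge 4$, $d\ge 1$, and $k\ge 1$. Suppose $X_1,\dots,X_n$ are i.i.d. $\mathbb{R}^d$-valued random vectors with the property that $\|X_1-X_2\|$ is a continuous random variable. Let $f:(\mathbb{R}^d)^n\to\mathbb{R}$ be a function of the form $$f(x_1,\dots,x_n)=\frac{1}{\sqrt n}\sum_{\ell=1}^n f_\ell(x_1,\dots,x_n),$$ where, for each $\ell$, $f_\ell(x_1,\dots,x_n)$ is a function of only $x_\ell$ and its $k$ nearest neighbors. Suppose, for some $p\ge 8$, that $\gamma_p:=\max_\ell\mathbb{E}|f_\ell(X_1,\dots,X_n)|^p$ is finite. Let $W=f(X_1,\dots,X_n)$ and $\sigma^2=\mathrm{Var}(W)$. Then $$\delta_W\le C\,\frac{\alpha(d)^3k^4\gamma_p^{2/p}}{\sigma^2\, n^{(p-8)/(2p)}}+C\,\frac{\alpha(d)^3k^3\gamma_p^{3/p}}{\sigma^3\, n^{(p-6)/(2p)}},$$ where $\delta_W$ is the Wasserstein distance to normality of $W$ and $\alpha(d)$ is the minimum number of $60^\circ$ cones at the origin required to cover $\mathbb{R}^d$.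
   Context: Distance to normality: for a real-valued random variable $W$ with finite second moment, $\delta_W:=\mathcal{W}(\mu,\nu)$, where $\mu$ is the law of $(W-\mathbb{E}(W))/\sqrt{\mathrm{Var}(W)}$, $\nu$ is the standard Gaussian law, and $\mathcal{W}(\mu,\nu)=\sup\{|\int h\,d\mu-\int h\,d\nu| : h:\mathbb{R}\to\mathbb{R}\text{ Lipschitz with constant}\le 1\}$ is the Kantorovich–Wasserstein distance. $\|\cdot\|$ is the Euclidean norm. That $\|X_1-X_2\|$ is a continuous random variable means that its distribution has no point masses. The $k$ nearest neighbors of $x_\ell$ in the collection $(x_1,\dots,x_n)$ are the $k$ points $x_m$, $m\neq\ell$, closest to $x_\ell$ in Euclidean distance. The functions $f_\ell$ may be arbitrary functions of $x_\ell$ and these nearest neighbors (not only of the nearest-neighbor distances); no boundedness or continuity is assumed. *)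

(* Defs.v *)
From HB Require Import structures.
From mathcomp Require Import all_boot all_order all_algebra.
From mathcomp Require Import all_classical all_reals all_analysis.
From mathcomp Require Import measurable_realfun.

Set Implicit Arguments.
Unset Strict Implicit.
Unset Printing Implicit Defensive.

Import Order.TTheory GRing.Theory Num.Theory.
Import numFieldNormedType.Exports.

Local Open Scope classical_set_scope.
Local Open Scope ring_scope.

(* [R^d] is represented by [d.-tuple R], whose sigma-algebra (generated by the
   coordinates) is the Borel one; [(R^d)^n] is [n.-tuple (d.-tuple R)]. *)

Section euclidean.
Context {R : realType} {d : nat}.
Implicit Types x y u : d.-tuple R.

Definition dotv x y : R := \sum_(i < d) tnth x i * tnth y i.

Definition euclid_norm x : R := Num.sqrt (dotv x x).

Definition euclid_dist x y : R := euclid_norm [tuple tnth x i - tnth y i | i < d].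

(* A 60 degree cone has opening angle [pi / 3]: the angle between any of its
   points and its axis [u] is at most [pi / 6]. *)
Definition cone60 u : set (d.-tuple R) :=
  [set x | cos (pi / 6) * (euclid_norm u * euclid_norm x) <= dotv u x].

End euclidean.

Definition cone60_cover (R : realType) (d m : nat) : Prop :=
  exists u : 'I_m -> d.-tuple R,
    (forall i, euclid_norm (u i) = 1) /\ \bigcup_i cone60 (u i) = setT.

(* The set below has exactly one element when [0 < d]; the default value [0]
   is only reached for [d = 0], where there is no unit vector. *)
Definition cone60_number (R : realType) (d : nat) : nat :=
  xget 0%N [set m | cone60_cover R d m /\
                    forall m', cone60_cover R d m' -> (m <= m')%N].

Section nearest_neighbors.
Context {R : realType} {d n : nat}.

(* Indices of the [k] nearest neighbors of [x_l], by increasing distance. As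
   [sort] is stable, ties are broken in favor of the smallest index. All [n.-1]
   other indices are returned when [n.-1 <= k]. *)
Definition knn (k : nat) (x : n.-tuple (d.-tuple R)) (l : 'I_n) : seq 'I_n :=
  take k
    (sort
       (fun i j => euclid_dist (tnth x l) (tnth x i) <= euclid_dist (tnth x l) (tnth x j))
       (enum [pred m : 'I_n | m != l])).

Definition knn_function (k : nat) (l : 'I_n)
    (g : n.-tuple (d.-tuple R) -> R) : Prop :=
  exists h : d.-tuple R -> seq (d.-tuple R) -> R,
    forall x, g x = h (tnth x l) [seq tnth x m | m <- knn k x l].

End nearest_neighbors.

Section random_variables.
Context {dT : measure_display} {T : measurableType dT} {R : realType}.
Variable P : probability T R.

Definition independent_rvs {n : nat} {dE : measure_display}
    {E : measurableType dE} (X : 'I_n -> {RV P >-> E}) : Prop :=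
  forall A : 'I_n -> set E, (forall i, measurable (A i)) ->
    P (\bigcap_i (X i @^-1` A i)) = (\prod_(i < n) P (X i @^-1` A i))%E.

Definition identically_distributed {n : nat} {dE : measure_display}
    {E : measurableType dE} (X : 'I_n -> {RV P >-> E}) : Prop :=
  forall i j (A : set E), measurable A ->
    distribution P (X i) A = distribution P (X j) A.

Definition no_point_mass (Y : T -> R) : Prop :=
  forall t : R, P (Y @^-1` [set t]) = 0%E.

Definition sample {n d : nat} (X : 'I_n -> {RV P >-> d.-tuple R}) (w : T) :
  n.-tuple (d.-tuple R) := [tuple X i w | i < n].

Definition max_moment {n d : nat} (X : 'I_n -> {RV P >-> d.-tuple R})
    (f : 'I_n -> n.-tuple (d.-tuple R) -> R) (p : R) : \bar R :=
  \big[maxe/0%E]_(l < n) ('E_P[fun w => (`|f l (sample X w)| `^ p)%R])%E.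

Definition standardize (W : {RV P >-> R}) : T -> R :=
  fun w => (W w - fine 'E_P[W]%E) / Num.sqrt (fine 'V_P[W]%E).

Lemma measurable_standardize (W : {RV P >-> R}) :
  measurable_fun setT (standardize W).
Proof. by apply: measurable_funM => //; apply: measurable_funB. Qed.

HB.instance Definition _ (W : {RV P >-> R}) :=
  isMeasurableFun.Build _ _ _ _ (standardize W) (measurable_standardize W).

End random_variables.

Definition wasserstein {R : realType} (mu nu : set R -> \bar R) : \bar R :=
  ereal_sup [set `|(\int[mu]_x (h x)%:E) - (\int[nu]_x (h x)%:E)|%E
            | h in [set h : R -> R | 1.-lipschitz h]].

Definition dist_to_normality {dT : measure_display} {T : measurableType dT}
    {R : realType} (P : probability T R) (W : {RV P >-> R}) : \bar R :=
  wasserstein (distribution P (standardize W)) (normal_prob 0 1).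

(* Main.v *)
(* Let [X'] be an independent copy of [X], and [X^A] be [X] with the coordinates in
   [A] replaced by those of [X']. Interpolating from [X] to [X'] along subsets gives
     Cov (g X, f X) =
       1/2 sum_A w_A sum_(j notin A) E (g X - g X^j) (f X^A - f X^(A + j)).
   Applied to [g f] with [g] solving the Stein equation, this bounds the distance to
   normality by the average over [A] of the standard deviation of
     T_A = sum_(j notin A) (f X - f X^j) (f X^A - f X^(A + j))
   and by the third moments of the differences [f X - f X^j].

   Moving [x_j] only affects the [f_l] such that [x_j] is among the nearest neighbors
   of [x_l]; in general position, which holds almost surely because distances have no
   atoms, a covering by cones shows that there are O(alpha k) such [l]. The variance
   of [T_A] is bounded by the Efron-Stein inequality: resampling the pair
   [(X_i, X'_i)] changes the [j]-th product only if [i] and [j] are near neighbors of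
   a common [l] in one of finitely many configurations. The moments of the number of
   such [j] are bounded by transporting each configuration to one that has the law of
   [X], enlarging [k] by the number of resampled points, where the count is
   deterministic; the size of the products is controlled by [p]-th moments. *)
Require Import Defs.
From HB Require Import structures.
From mathcomp Require Import all_boot all_order all_algebra.
From mathcomp Require Import all_classical all_reals all_analysis.
From mathcomp Require Import measurable_realfun ring lra zify.

Set Implicit Arguments.
Unset Strict Implicit.
Unset Printing Implicit Defensive.

Import Order.TTheory GRing.Theory Num.Theory.
Import numFieldNormedType.Exports.

Local Open Scope classical_set_scope.
Local Open Scope ring_scope.

(** * Equality in law and moments *)

Section law.
Context {dT} {T : measurableType dT} {R : realType} (P : probability T R).
Context {dS} {S : measurableType dS}.

(** The rates come from a union bound. The products in [T_A], before and after one pair is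
    resampled, involve the values of [f_l] at a bounded number of configurations for each pair
    [(j, l)]; the largest of these [O(n^2)] values is of order [(n^2 gamma)^(1/p)]. A single
    difference involves only [O(n)] values. Hence [T_A] has a standard deviation of order
    [sqrt(n - #|A|) / n * n^(4/p)], which averages to [n^(4/p - 1/2)] after multiplication by the
    weights, and the third moments sum to [n^(3/p - 1/2)].

    The obstacle is that the largest value and the number of altered products are dependent, and
    that this number involves configurations varying with [j], so that no single cone argument
    bounds it. The two are separated pointwise by a Young inequality, at the cost of eighth moments
    of the values and fourth moments of the count.

    A point is a near neighbor of [D = O(alpha k)] others and about [kappa = O(alpha k^2)] products
    are altered: [D^2 kappa] and [D^3] give the factors [alpha^3 k^4] and [alpha^3 k^3]. *)

Definition law_eq (phi psi : T -> S) :=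
  [/\ measurable_fun setT phi, measurable_fun setT psi &
      forall B, measurable B -> P (phi @^-1` B) = P (psi @^-1` B)].

Lemma law_eq_ge0_integral phi psi (f : S -> \bar R) : law_eq phi psi ->
  measurable_fun setT f -> (forall y, 0 <= f y)%E ->
  (\int[P]_w f (phi w) = \int[P]_w f (psi w))%E.
Proof.
move=> [mphi mpsi e] mf f0.
pose ap := isMeasurableFun.Build _ _ _ _ _ mphi.
pose aq := isMeasurableFun.Build _ _ _ _ _ mpsi.
pose p : {mfun _ >-> _} := HB.pack phi ap.
pose q : {mfun _ >-> _} := HB.pack psi aq.
have <- := @ge0_integral_distribution _ _ _ _ _ P p f mf f0.
have <- := @ge0_integral_distribution _ _ _ _ _ P q f mf f0.
by apply: eq_measure_integral => A mA _; exact: e.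
Qed.

Lemma law_eq_integral phi psi (f : S -> \bar R) : law_eq phi psi ->
  measurable_fun setT f ->
  (\int[P]_w f (phi w) = \int[P]_w f (psi w))%E.
Proof.
move=> h mf; rewrite [LHS]integralE [RHS]integralE.
have := @law_eq_ge0_integral phi psi _ h (measurable_funepos mf) (funepos_ge0 f).
have := @law_eq_ge0_integral phi psi _ h (measurable_funeneg mf) (funeneg_ge0 f).
by rewrite !unlock => -> ->.
Qed.

Lemma law_eq_Rintegral phi psi (f : S -> R) : law_eq phi psi ->
  measurable_fun setT f ->
  \int[P]_w f (phi w) = \int[P]_w f (psi w).
Proof.
move=> h mf; congr fine; apply: (law_eq_integral (f := EFin \o f) h).
exact/measurable_EFinP.
Qed.

End law.

Lemma law_eq_comp {dT} {T : measurableType dT} {R : realType}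
  (P : probability T R) {dS} {S : measurableType dS}
  {dU} {U : measurableType dU} (phi psi : T -> S) (g : S -> U) :
  law_eq P phi psi -> measurable_fun setT g ->
  law_eq P (g \o phi) (g \o psi).
Proof.
move=> [a b c] mg; split; [exact: measurableT_comp..|].
move=> B mB; apply: (c (g @^-1` B)).
by rewrite -[X in measurable X]setTI; exact: mg.
Qed.

Section moments.
Context {dT} {T : measurableType dT} {R : realType} (P : probability T R).
Implicit Types f g : T -> R.

(** Measurability is bundled with the finite moment, so that the closure properties below settle
    every integrability condition met later. *)
Definition mom (q : nat) f :=
  measurable_fun setT f /\ (\int[P]_x (`|f x| ^+ q)%:E < +oo)%E.

Lemma mom_measurable q f : mom q f -> measurable_fun setT f.
Proof. by case. Qed.

Lemma ltoo_le_bound (f : T -> R) (g : T -> R) :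
  measurable_fun setT f -> measurable_fun setT g ->
  (forall x, 0 <= f x <= g x) -> (\int[P]_x (g x)%:E < +oo)%E ->
  (\int[P]_x (f x)%:E < +oo)%E.
Proof.
move=> mf mg fg; apply: le_lt_trans; apply: ge0_le_integral => //=.
- by move=> x _; rewrite lee_fin; case/andP: (fg x).
- exact/measurable_EFinP.
- exact/measurable_EFinP.
- by move=> x _; rewrite lee_fin; case/andP: (fg x).
Qed.

Lemma measurable_normX q f : measurable_fun setT f ->
  measurable_fun setT (fun x => `|f x| ^+ q).
Proof.
by move=> mf; apply: measurable_funX; exact: measurableT_comp.
Qed.

Lemma mom_integrable f : mom 1 f -> P.-integrable setT (EFin \o f).
Proof.
move=> [mf h]; apply/integrableP; split; first exact/measurable_EFinP.
by apply: le_lt_trans h; rewrite le_eqVlt; apply/orP; left; apply/eqP;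
  apply: eq_integral => x _; rewrite /= expr1.
Qed.

Lemma integrable_mom f : P.-integrable setT (EFin \o f) -> mom 1 f.
Proof.
move=> /integrableP[mf h]; split; first exact/measurable_EFinP.
by apply: le_lt_trans h; rewrite le_eqVlt; apply/orP; left; apply/eqP;
  apply: eq_integral => x _; rewrite /= expr1.
Qed.

Lemma mom_cst q c : mom q (fun=> c).
Proof.
split=> //.
by rewrite integral_cst//= probability_setT mule1 ltry.
Qed.

Lemma mom_dom q f g : measurable_fun setT f -> (forall x, `|f x| <= `|g x|) ->
  mom q g -> mom q f.
Proof.
move=> mf fg [mg h]; split=> //.
apply: (ltoo_le_bound (g := fun x => `|g x| ^+ q)) => //.
- exact: measurable_normX.
- exact: measurable_normX.
- by move=> x; rewrite exprn_ge0//=; case: (q) => [|q']; rewrite ?expr0// lerXn2r// nnegrE.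
Qed.

Lemma measurable_sumr (I : Type) (r : seq I) (p : pred I) (f : I -> T -> R) :
  (forall i, p i -> measurable_fun setT (f i)) ->
  measurable_fun setT (fun x => \sum_(i <- r | p i) f i x).
Proof.
move=> mf; elim: r => [|i r IH].
  under eq_fun do rewrite big_nil.
  exact: measurable_cst.
case pi: (p i).
  under eq_fun do rewrite big_cons pi.
  by apply: measurable_funD => //; exact: mf.
by under eq_fun do rewrite big_cons pi; exact: IH.
Qed.

Lemma normD_exp_le (q : nat) (a b : R) :
  `|a + b| ^+ q <= 2 ^+ q * (`|a| ^+ q + `|b| ^+ q).
Proof.
wlog ab : a b / `|a| <= `|b|.
  move=> h; case: (leP `|a| `|b|) => [/h//|/ltW /h].
  by rewrite addrC [X in _ * X]addrC.
have h : `|a + b| <= 2 * `|b| by rewrite (le_trans (ler_normD _ _))//; lra.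
rewrite (le_trans (y := (2 * `|b|) ^+ q))//.
  by case: q => // q; rewrite lerXn2r// nnegrE mulr_ge0.
by rewrite exprMn ler_wpM2l ?exprn_ge0// lerDr exprn_ge0.
Qed.

Lemma momD q f g : mom q f -> mom q g -> mom q (fun x => f x + g x).
Proof.
move=> [mf hf] [mg hg]; split; first exact: measurable_funD.
apply: (ltoo_le_bound (g := fun x => 2 ^+ q * (`|f x| ^+ q + `|g x| ^+ q))).
- by apply: measurable_normX; exact: measurable_funD.
- apply: measurable_funM => //; apply: measurable_funD; exact: measurable_normX.
- by move=> x; rewrite exprn_ge0//= normD_exp_le.
under eq_integral do rewrite EFinM.
have m1 := @measurable_normX q _ mf; have m2 := @measurable_normX q _ mg.
rewrite ge0_integralZl//=.
- rewrite lte_mul_pinfty ?lee_fin ?exprn_ge0//.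
  under eq_integral do rewrite EFinD.
  by rewrite ge0_integralD//=; [exact: lte_add_pinfty|exact/measurable_EFinP..].
- by apply/measurable_EFinP; exact: measurable_funD.
Qed.

Lemma momZ q c f : mom q f -> mom q (fun x => c * f x).
Proof.
move=> [mf hf]; split; first exact: measurable_funM.
under eq_integral do rewrite normrM exprMn EFinM.
rewrite ge0_integralZl//=.
- by rewrite lte_mul_pinfty ?lee_fin ?exprn_ge0.
- exact/measurable_EFinP/measurable_normX.
Qed.

Lemma momN q f : mom q f -> mom q (fun x => - f x).
Proof. by move=> /(momZ (-1)); under eq_fun do rewrite mulN1r. Qed.

Lemma momB q f g : mom q f -> mom q g -> mom q (fun x => f x - g x).
Proof. by move=> mf mg; apply: momD => //; exact: momN. Qed.

Lemma mom_sum q (I : Type) (r : seq I) (p : pred I) (f : I -> T -> R) :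
  (forall i, p i -> mom q (f i)) -> mom q (fun x => \sum_(i <- r | p i) f i x).
Proof.
move=> mf; elim: r => [|i r IH].
  by under eq_fun do rewrite big_nil; exact: mom_cst.
case pi: (p i).
  by under eq_fun do rewrite big_cons pi; apply: momD => //; exact: mf.
by under eq_fun do rewrite big_cons pi; exact: IH.
Qed.

(** The constant 1 takes care of the points where the functions are small, so that different
    exponents can be compared on a probability space. *)
Lemma mom_dominated q q' f g : measurable_fun setT f -> mom q' g ->
  (forall x, `|f x| ^+ q <= 1 + `|g x| ^+ q') -> mom q f.
Proof.
move=> mf [mg hg] fg; split=> //.
have m1 := @measurable_normX q _ mf; have m2 := @measurable_normX q' _ mg.
apply: (ltoo_le_bound (g := fun x => 1 + `|g x| ^+ q')) => //.
- exact: measurable_funD.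
- by move=> x; rewrite exprn_ge0//=.
under eq_integral do rewrite EFinD.
rewrite ge0_integralD//=.
- by apply: lte_add_pinfty => //; rewrite integral_cst//= probability_setT mule1 ltry.
- exact/measurable_EFinP.
Qed.

Lemma mom_le q r f : (r <= q)%N -> mom q f -> mom r f.
Proof.
move=> rq mf; apply: (mom_dominated (mom_measurable mf) mf) => x.
case: (leP `|f x| 1) => h.
  by rewrite (@le_trans _ _ 1) ?exprn_ile1// lerDl exprn_ge0.
by rewrite (@le_trans _ _ (`|f x| ^+ q)) ?lerDr// ler_weXn2l// ltW.
Qed.

(** Only finiteness is at stake, so [a b <= a^2 + b^2] replaces the Cauchy-Schwarz inequality. *)
Lemma momM q f g : mom q.*2 f -> mom q.*2 g -> mom q (fun x => f x * g x).
Proof.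
move=> [mf hf] [mg hg]; have mfg := measurable_funM mf mg; split => //.
have m1 := @measurable_normX q.*2 _ mf; have m2 := @measurable_normX q.*2 _ mg.
apply: (ltoo_le_bound (g := fun x => `|f x| ^+ q.*2 + `|g x| ^+ q.*2)).
- exact: measurable_normX.
- exact: measurable_funD.
- move=> x; rewrite exprn_ge0//= normrM exprMn -!mul2n mulnC !exprM.
  set a := _ ^+ q; set b := _ ^+ q.
  have := sqr_ge0 (a - b); have := sqr_ge0 a; have := sqr_ge0 b; rewrite sqrrB; lra.
under eq_integral do rewrite EFinD.
by rewrite ge0_integralD//=; [exact: lte_add_pinfty|exact/measurable_EFinP..].
Qed.

End moments.

Lemma law_eq_mom {dT} {T : measurableType dT} {R : realType} (P : probability T R)
    {dS} {S : measurableType dS} (phi psi : T -> S) q (f : S -> R) :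
  law_eq P phi psi -> measurable_fun setT f ->
  mom P q (f \o psi) -> mom P q (f \o phi).
Proof.
move=> h mf [_ m]; have [mphi _ _] := h; split; first exact: measurableT_comp.
rewrite (@law_eq_ge0_integral _ _ _ _ _ _ _ _ (fun y => (`|f y| ^+ q)%:E) h)//.
by apply/measurable_EFinP; exact: measurable_normX.
Qed.

(** * Resampled coordinates *)

Section mix.
Context {E : Type} {n : nat}.

Definition mixt (A : {set 'I_n}) (x y : n.-tuple E) : n.-tuple E :=
  [tuple if i \in A then tnth y i else tnth x i | i < n].

(** The pair [(mixt B x y, mixt (~: B) x y)] is [(x, y)] with the coordinates of [B] exchanged;
    exchanges compose like subsets under symmetric difference. *)
Lemma mixt_comp (A B : {set 'I_n}) x y :
  mixt A (mixt B x y) (mixt (~: B) x y) =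
  mixt ((A :\: B) :|: (B :\: A)) x y.
Proof.
apply: eq_from_tnth => i; rewrite !tnth_mktuple !inE.
by case: (i \in A); case: (i \in B).
Qed.

Lemma mixt0 x y : mixt finset.set0 x y = x.
Proof. by apply: eq_from_tnth => i; rewrite !tnth_mktuple !inE. Qed.

Lemma mixtT x y : mixt (finset.setT) x y = y.
Proof. by apply: eq_from_tnth => i; rewrite !tnth_mktuple !inE. Qed.

End mix.

Lemma measurable_mixt {dE} {E : measurableType dE} {n : nat} {dU}
  {U : measurableType dU} (A : {set 'I_n}) (f g : U -> n.-tuple E) :
  measurable_fun setT f -> measurable_fun setT g ->
  measurable_fun setT (fun u => mixt A (f u) (g u)).
Proof.
move=> mf mg; apply/measurable_fun_tnthP => i.
have [iA|iA] := boolP (i \in A).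
  have -> : (@tnth n E)^~ i \o (fun u => mixt A (f u) (g u)) = (@tnth n E)^~ i \o g.
    by apply/funext => u /=; rewrite tnth_mktuple iA.
  exact/(measurable_fun_tnthP _).1.
have -> : (@tnth n E)^~ i \o (fun u => mixt A (f u) (g u)) = (@tnth n E)^~ i \o f.
  by apply/funext => u /=; rewrite tnth_mktuple (negbTE iA).
exact/(measurable_fun_tnthP _).1.
Qed.

Section swap.
Context {dT} {T : measurableType dT} {R : realType} (P : probability T R).
Context {dE} {E : measurableType dE} {n : nat} (Y : 'I_n -> {RV P >-> E}).

Definition tup (w : T) : n.-tuple E := [tuple Y i w | i < n].

Lemma measurable_tup : measurable_fun setT tup.
Proof.
apply/measurable_fun_tnthP => i.
have -> : (@tnth n E)^~ i \o tup = Y i by apply/funext => w /=; rewrite tnth_mktuple.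
by [].
Qed.

Definition mixs A (w : T * T) := mixt A (tup w.1) (tup w.2).

Lemma measurable_mixs A : measurable_fun setT (mixs A).
Proof.
apply: measurable_mixt.
  by apply: (measurableT_comp measurable_tup).
by apply: (measurableT_comp measurable_tup).
Qed.

(** Invariance of the joint law of two independent copies under exchange of the coordinates in [A].
    The interpolation uses the independence of the coordinates only through this property. *)
Definition swappable := forall A : {set 'I_n},
  law_eq (P \x P)%E (fun w => (mixs A w, mixs (~: A) w))
                  (fun w => (tup w.1, tup w.2)).

(** On rectangles with sides in [G], an exchange merely permutes the factors of a product; such
    rectangles are stable under intersection and generate the sigma-algebra. The family [G] is a
    parameter because the independence of pairs of variables is checked on products of two sets
    only. *)
Lemma swap_of_indep (G : set (set E)) :
  setI_closed G -> G setT -> @measurable _ E = <<s G >> ->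
  (forall A : 'I_n -> set E, (forall i, G (A i)) ->
    P (\bigcap_i (Y i @^-1` A i)) = (\prod_(i < n) P (Y i @^-1` A i))%E) ->
  swappable.
Proof.
move=> GI GT mE ind A.
have Gm B : G B -> measurable B.
  by move=> GB; rewrite mE; exact: sub_sigma_algebra.
have m1 : measurable_fun setT (fun w => (mixs A w, mixs (~: A) w)).
  by apply: measurable_fun_pair; exact: measurable_mixs.
have m2 : measurable_fun setT (fun w : T * T => (tup w.1, tup w.2)).
  apply: measurable_fun_pair.
    exact: (measurableT_comp measurable_tup).
  exact: (measurableT_comp measurable_tup).
split=> // B mB.
pose rect := [set B : set (n.-tuple E * n.-tuple E) | exists A1 A2 : 'I_n -> set E,
  [/\ forall i, G (A1 i), forall i, G (A2 i) &
  B = [set z | forall i, A1 i (tnth z.1 i) /\ A2 i (tnth z.2 i)]]].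
(* The coordinates are measurable for the sigma-algebra generated by [rect], hence so is the
   identity: this puts every measurable set into it. *)
have idm : @measurable_fun _ _ (g_sigma_algebraType rect) (n.-tuple E * n.-tuple E)%type setT id.
  apply/measurable_fun_pairP; split; apply/measurable_fun_tnthP => i;
    apply: (measurability G) => // _ [C GC <-]; rewrite setTI; apply: sub_sigma_algebra.
    exists (fun j => if j == i then C else setT), (fun=> setT); split => // [j|].
      by case: ifP.
    apply/seteqP; split => [z/= Cz j|z/= /(_ i)[]]; last by rewrite eqxx.
    by split => //; case: eqP => // ->.
  exists (fun=> setT), (fun j => if j == i then C else setT); split => // [j|].
    by case: ifP.
  apply/seteqP; split => [z/= Cz j|z/= /(_ i)[]]; last by rewrite eqxx.
  by split => //; case: eqP => // ->.
have sB : <<s rect >> B.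
  by have := idm measurableT B mB; rewrite setTI.
have cyl (C : 'I_n -> set E) : (forall i, G (C i)) ->
    measurable (\bigcap_i (Y i @^-1` C i)).
  move=> GC; apply: fin_bigcap_measurable => [//|i _].
  by rewrite -[X in measurable X]setTI; apply: (measurable_funPT (Y i)) => //; exact: Gm.
pose ap := isMeasurableFun.Build _ _ _ _ _ m1.
pose aq := isMeasurableFun.Build _ _ _ _ _ m2.
pose p : {mfun _ >-> _} := HB.pack (fun w => (mixs A w, mixs (~: A) w)) ap.
pose q : {mfun _ >-> _} := HB.pack (fun w : T * T => (tup w.1, tup w.2)) aq.
have rectm : rect `<=` measurable.
  move=> _ [A1 [A2 [G1 G2 ->]]].
  have -> : [set z : n.-tuple E * n.-tuple E | forall i, A1 i (tnth z.1 i) /\ A2 i (tnth z.2 i)] =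
    (\bigcap_i ((@tnth n E)^~ i @^-1` A1 i)) `*` (\bigcap_i ((@tnth n E)^~ i @^-1` A2 i)).
    apply/seteqP; split => [z /= h|z/= [h1 h2] i]; first by split=> i _; case: (h i).
    by split; [exact: h1|exact: h2].
  apply: measurableX; apply: fin_bigcap_measurable => //.
    by move=> i _; rewrite -[X in measurable X]setTI; apply: measurable_tnth => //; exact: Gm.
  by move=> i _; rewrite -[X in measurable X]setTI; apply: measurable_tnth => //; exact: Gm.
have eP A1 A2 : (forall i, G (A1 i)) -> (forall i, G (A2 i)) ->
    (P \x P)%E ((\bigcap_i (Y i @^-1` A1 i)) `*` (\bigcap_i (Y i @^-1` A2 i))) =
    (\prod_(i < n) (P (Y i @^-1` A1 i) * P (Y i @^-1` A2 i)))%E.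
  move=> G1 G2; transitivity (P (\bigcap_i (Y i @^-1` A1 i)) * P (\bigcap_i (Y i @^-1` A2 i)))%E.
    by apply: product_measure1E; exact: cyl.
  by rewrite (ind _ G1) (ind _ G2) big_split.
have setE (f1 f2 : T * T -> n.-tuple E) A1 A2 :
  (fun w => (f1 w, f2 w)) @^-1` [set z | forall i, A1 i (tnth z.1 i) /\ A2 i (tnth z.2 i)] =
  [set w | forall i, A1 i (tnth (f1 w) i) /\ A2 i (tnth (f2 w) i)] by [].
apply: (@g_sigma_algebra_measure_unique _ R _ rect rectm (fun=> setT) _ _
  (distribution (P \x P)%E p) (distribution (P \x P)%E q) _ _ _ B sB).
- by move=> _; exists (fun=> setT), (fun=> setT); split => //; apply/seteqP; split.
- by rewrite bigcup_const//; exists 0%N.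
- move=> _ _ [A1 [A2 [G1 G2 ->]]] [A3 [A4 [G3 G4 ->]]].
  exists (fun i => A1 i `&` A3 i), (fun i => A2 i `&` A4 i); split => [i|i|].
  + exact: GI.
  + exact: GI.
  + apply/seteqP; split => [z/= [h1 h2] i|z/= h].
      by have [] := h1 i; have [] := h2 i.
    by split=> i; have [[? ?] [? ?]] := h i.
- move=> _ [A1 [A2 [G1 G2 ->]]]; rewrite /distribution /pushforward /= !setE.
  transitivity ((P \x P)%E ((\bigcap_i (Y i @^-1` (if i \in A then A2 i else A1 i))) `*`
     (\bigcap_i (Y i @^-1` (if i \in A then A1 i else A2 i))))).
    congr (_ _); apply/seteqP; split => [z/= h|z/= [h1 h2] i].
      split=> i _ /=; have /= := h i; rewrite !tnth_mktuple !inE; case: ifP => //= _ [] //.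
    by move: (h1 i I) (h2 i I) => /=; rewrite !tnth_mktuple !inE; case: ifP.
  rewrite eP; [|by move=> i; case: ifP..].
  transitivity ((P \x P)%E ((\bigcap_i (Y i @^-1` A1 i)) `*` (\bigcap_i (Y i @^-1` A2 i)))).
    rewrite eP//; apply: eq_bigr => i _; case: ifP => // _; exact: muleC.
  congr (_ _); apply/seteqP; split => [z/= [h1 h2] i|z/= h].
    by rewrite !tnth_mktuple; split; [exact: h1|exact: h2].
  by split=> i _ /=; have := h i; rewrite !tnth_mktuple => -[].
- by move=> _; apply: le_lt_trans (probability_le1 _ _) (ltry _).
Qed.
End swap.

(** * Covariance by interpolation over subsets *)

Section subset_weight.
Context {R : realType} {n : nat}.

(* The probability, for a uniformly random ordering of the indices, that [A] comes
   first and is followed by a given [j] outside [A]; it telescopes [F set0 - F setT]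
   over all chains of subsets at once. The junk value at [A = setT] is [0]. *)
Definition subset_weight (A : {set 'I_n}) : R :=
  ('C(n, #|A|)%:R * (n - #|A|)%:R)^-1.

Lemma subset_weight_ge0 A : 0 <= subset_weight A.
Proof. by rewrite invr_ge0 mulr_ge0. Qed.

(** The map [(A, j) |-> (j |: A, j)] is a bijection from the pairs with [j] outside the set onto
    those with [j] inside. *)
Lemma sum_notin_setU1 (G : {set 'I_n} -> 'I_n -> R) :
  \sum_(A : {set 'I_n}) \sum_(j | j \notin A) G (j |: A)%SET j =
  \sum_(B : {set 'I_n}) \sum_(j | j \in B) G B j.
Proof.
rewrite (exchange_big_dep predT)//= [RHS](exchange_big_dep predT)//=.
apply: eq_bigr => j _.
rewrite (reindex_onto (fun B : {set 'I_n} => (B :\ j)%SET)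
  (fun A : {set 'I_n} => (j |: A)%SET)) /=; last first.
  by move=> A jA; rewrite finset.setU1K.
apply: eq_big => [B|B].
  rewrite !inE eqxx /=; have [jB|jB] := boolP (j \in B).
    by rewrite finset.setD1K// eqxx.
  apply/negbTE/eqP => h; move: jB; rewrite -h => /negP; apply.
  by rewrite !inE eqxx.
by rewrite !inE eqxx /= => /eqP ->.
Qed.

(** After regrouping, [F A] has coefficient [(n - a) v(a) - a v(a - 1)] with [a = #|A|]. It vanishes
    for [0 < a < n] because [(a + 1) C(n, a + 1) = (n - a) C(n, a)], and equals 1 and -1 at the two
    ends. *)
Lemma subset_telescope (F : {set 'I_n} -> R) :
  \sum_(A : {set 'I_n}) \sum_(j | j \notin A)
    subset_weight A * (F A - F (j |: A)%SET) = F finset.set0 - F finset.setT.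
Proof.
pose v a : R := ('C(n, a)%:R * (n - a)%:R)^-1.
have wE A : subset_weight A = v #|A| by [].
have -> : \sum_(A : {set 'I_n}) \sum_(j | j \notin A)
    subset_weight A * (F A - F (j |: A)%SET) =
  \sum_(A : {set 'I_n}) \sum_(j | j \notin A) subset_weight A * F A -
  \sum_(A : {set 'I_n}) \sum_(j | j \notin A)
     v (#|(j |: A)%SET|.-1) * F (j |: A)%SET.
  rewrite -sumrB; apply: eq_bigr => A _; rewrite -sumrB; apply: eq_bigr => j jA.
  by rewrite cardsU1 jA /= mulrBr.
rewrite (sum_notin_setU1 (fun B _ => v #|B|.-1 * F B)).
have -> : \sum_(A : {set 'I_n}) \sum_(j | j \notin A) subset_weight A * F A -
    \sum_(B : {set 'I_n}) \sum_(j | j \in B) v #|B|.-1 * F B =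
  \sum_(A : {set 'I_n}) ((n - #|A|)%:R * v #|A| - #|A|%:R * v #|A|.-1) * F A.
  rewrite -sumrB; apply: eq_bigr => A _; rewrite !sumr_const mulrBl.
  congr (_ - _); last by rewrite -mulrA mulr_natl.
  rewrite -mulrA mulr_natl; congr (_ *+ _).
  have -> : #|[pred j | j \notin A]| = #|(~: A)%SET|.
    by apply: eq_card => i; rewrite !inE.
  by rewrite cardsCs finset.setCK card_ord.
have coef a : (0 < a < n)%N -> (n - a)%:R * v a - a%:R * v a.-1 = 0.
  case: a => // a /andP[_ an]; rewrite /v /=.
  have na0 : (n - a.+1)%:R != 0 :> R by rewrite pnatr_eq0 subn_eq0 -ltnNge.
  have na1 : (n - a)%:R != 0 :> R by rewrite pnatr_eq0 subn_eq0 -ltnNge ltnW.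
  have c0 : 'C(n, a.+1)%:R != 0 :> R by rewrite pnatr_eq0 -lt0n bin_gt0 ltnW.
  have c1 : 'C(n, a)%:R != 0 :> R by rewrite pnatr_eq0 -lt0n bin_gt0 ltnW// ltnW.
  have := mul_bin_left n a; move=> /(congr1 (fun m => m%:R : R)); rewrite !natrM => e.
  rewrite !invfM mulrCA mulfV// mulr1.
  have -> : 'C(n, a.+1)%:R = (n - a)%:R * 'C(n, a)%:R / a.+1%:R :> R.
    by rewrite -e mulrAC mulfV ?mul1r// pnatr_eq0.
  have b0 : a.+1%:R != 0 :> R by rewrite pnatr_eq0.
  set x := a.+1%:R in b0 *; set y := (n - a)%:R in na1 *; set z := 'C(n, a)%:R in c1 *.
  by clearbody x y z; field; rewrite ?b0 ?na1 ?c1.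
have [n0|n0] := posnP n.
  have e (A : {set 'I_n}) : A = finset.set0.
    by apply/setP => -[i Hi]; exfalso; move: Hi; rewrite n0.
  rewrite (e finset.setT) subrr big1// => A _.
  have cA : #|A| = 0%N by rewrite (e A) cards0.
  by rewrite cA n0 !mul0r subrr mul0r.
rewrite (bigD1 finset.set0)//= (bigD1 finset.setT)/=; last first.
  by apply/eqP => /setP/(_ (Ordinal n0)); rewrite !inE.
rewrite big1 ?addr0 => [|A /andP[A0 AT]].
  rewrite cards0 cardsT card_ord subnn subn0 !mul0r subr0 sub0r.
  rewrite /v bin0 subn0 mul1r mulfV ?pnatr_eq0 -?lt0n// mul1r.
  by rewrite -subn1 bin_sub// bin1 subKn// mulr1 mulfV ?pnatr_eq0 -?lt0n// mulN1r.
rewrite coef ?mul0r// card_gt0 A0 /= ltnNge.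
apply: contra AT => AT; rewrite eqEcard finset.subsetT /= cardsT card_ord//.
Qed.

(** Telescoping the indicator of [j \notin A]: only the step that adds [j] contributes. *)
Lemma sum_subset_weight_notin (j : 'I_n) :
  \sum_(A : {set 'I_n} | j \notin A) subset_weight A = 1.
Proof.
transitivity ((j \notin (finset.set0 : {set 'I_n}))%:R -
    (j \notin (finset.setT : {set 'I_n}))%:R : R); last by rewrite !inE subr0.
rewrite -(subset_telescope (fun A => (j \notin A)%:R)).
rewrite big_mkcond; apply: eq_bigr => A _; case: ifPn => jA.
  rewrite (bigD1 j)//= !inE eqxx /= subr0 mulr1 big1 ?addr0// => i /andP[iA ij].
  have -> : (j \notin (i |: A)%SET) = true.
    by rewrite finset.in_setU1 negb_or eq_sym ij.
  by rewrite subrr mulr0.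
rewrite big1 // => i iA.
have -> : (j \notin (i |: A)%SET) = false.
  by move: jA; rewrite finset.in_setU1 negb_or => /negbTE ->; rewrite andbF.
by rewrite subrr mulr0.
Qed.

(** With [t] and [s] the roots of [m + 1] and [m], [1 / t = (t - s) (t + s) / t <= 2 (t - s)], which
    telescopes. *)
Lemma sum_inv_sqrt_le m : \sum_(0 <= b < m) (Num.sqrt b.+1%:R : R)^-1 <= 2 * Num.sqrt m%:R.
Proof.
elim: m => [|m IH]; first by rewrite big_geq// sqrtr0 mulr0.
rewrite big_nat_recr//= (le_trans (lerD IH (lexx _)))//.
set s := Num.sqrt m%:R; set t := Num.sqrt m.+1%:R.
have t0 : 0 < t by rewrite sqrtr_gt0.
have s0 : 0 <= s by rewrite sqrtr_ge0.
have e : t ^+ 2 - s ^+ 2 = 1 by rewrite !sqr_sqrtr// -addn1 natrD; ring.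
rewrite -(ler_pM2r t0) mulrDl mulVf ?gt_eqF//.
have := sqr_ge0 (t - s); rewrite sqrrB; move: e; rewrite !expr2; nra.
Qed.

(** The sets of size [a < n] have total weight [1 / (n - a)], which leaves a sum of inverse square
    roots. The standard deviation of [T_A] grows like [sqrt(n - #|A|)], so averaging over [A] costs
    a factor [sqrt n] only. *)
Lemma sum_subset_weight_sqrt :
  \sum_(A : {set 'I_n}) subset_weight A * Num.sqrt (n - #|A|)%:R
  <= 2 * Num.sqrt n%:R.
Proof.
rewrite (partition_big (fun A : {set 'I_n} => inord #|A| : 'I_n.+1) predT)//=.
rewrite (eq_bigr (fun a : 'I_n.+1 => if (a < n)%N then (Num.sqrt (n - a)%:R)^-1 else 0)); last first.
  move=> a _; have an : (a <= n)%N by rewrite -ltnS.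
  rewrite (eq_bigr (fun=> ('C(n, a)%:R * (n - a)%:R)^-1 * Num.sqrt (n - a)%:R)); last first.
    move=> A /eqP <-; rewrite /subset_weight inordK//.
    by rewrite ltnS -[X in (_ <= X)%N]card_ord max_card.
  rewrite sumr_const.
  have -> : #|[pred A : {set 'I_n} | inord #|A| == a]| = 'C(n, a).
    rewrite -[X in 'C(X, _)](card_ord n) -card_draws; apply: eq_card => A.
    rewrite !inE -val_eqE /= inordK//.
    by rewrite ltnS -[X in (_ <= X)%N]card_ord max_card.
  rewrite -[LHS]mulr_natl; case: ltnP => [an'|na]; last first.
    have -> : nat_of_ord a = n by apply/eqP; rewrite eqn_leq an na.
    by rewrite subnn mulr0n sqrtr0 !mulr0.
  have c0 : 'C(n, a)%:R != 0 :> R by rewrite pnatr_eq0 -lt0n bin_gt0.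
  have s0 : Num.sqrt (n - a)%:R != 0 :> R by rewrite gt_eqF// sqrtr_gt0 ltr0n subn_gt0.
  have := @sqr_sqrtr R (n - a)%:R (ler0n _ _).
  move: s0 c0; set s := Num.sqrt _; set c := 'C(n, a)%:R; clearbody s c => s0 c0 <-.
  by field; rewrite c0 s0.
rewrite big_ord_recr /= ltnn addr0.
rewrite (eq_bigr (fun a : 'I_n => (Num.sqrt (n - a)%:R)^-1)); last first.
  by move=> a _; rewrite ltn_ord.
apply: le_trans (sum_inv_sqrt_le n).
rewrite big_mkord (reindex_inj rev_ord_inj)/= le_eqVlt; apply/orP; left; apply/eqP.
by apply: eq_bigr => a _; rewrite subKn// ltn_ord.
Qed.

End subset_weight.

Lemma ge0_integral_prod_fst {dT} {T : measurableType dT} {dU} {U : measurableType dU}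
  {R : realType} (P : probability T R) (P' : probability U R) (g : T -> \bar R) :
  measurable_fun setT g -> (forall x, 0 <= g x)%E ->
  (\int[P \x P']_w g w.1 = \int[P]_x g x)%E.
Proof.
move=> mg g0; rewrite (@fubini_tonelli1 _ _ _ _ _ P P' (fun w => g w.1))//; last first.
  exact: (measurableT_comp mg).
apply: eq_integral => x _; rewrite /fubini_F /=.
by rewrite integral_cst//= [X in (_ * X)%E]probability_setT mule1.
Qed.

Lemma Rintegral_prod_fst {dT} {T : measurableType dT} {dU} {U : measurableType dU}
  {R : realType} (P : probability T R) (P' : probability U R) (g : T -> R) :
  measurable_fun setT g ->
  \int[(P \x P')%E]_w g w.1 = \int[P]_x g x.
Proof.
move=> mg; congr fine; rewrite [LHS]integralE [RHS]integralE.
have mg' := (measurable_EFinP _ _).2 mg.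
have := @ge0_integral_prod_fst _ T _ U R P P' _ (measurable_funepos mg') (funepos_ge0 _).
have := @ge0_integral_prod_fst _ T _ U R P P' _ (measurable_funeneg mg') (funeneg_ge0 _).
by rewrite !unlock => -> ->.
Qed.

Lemma Rintegral_prodM {dT} {T : measurableType dT} {R : realType}
  (P : probability T R) (f g : T -> R) :
  mom P 2 f -> mom P 2 g ->
  \int[(P \x P)%E]_w (f w.1 * g w.2) = (\int[P]_x f x) * (\int[P]_x g x).
Proof.
move=> mf mg.
have If : P.-integrable setT (EFin \o f) by apply/mom_integrable/(mom_le _ mf).
have Ig : P.-integrable setT (EFin \o g) by apply/mom_integrable/(mom_le _ mg).
have If' := integrable_fin_num measurableT If.
have Ig' := integrable_fin_num measurableT Ig.
have Qf : mom (P \x P)%E 2 (fun w => f w.1).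
  case: mf => mf mf'; split; first exact: (measurableT_comp mf).
  rewrite (@ge0_integral_prod_fst _ _ _ _ _ _ _ (fun x => (`|f x| ^+ 2)%:E))//.
  exact/measurable_EFinP/measurable_normX.
have Qg : mom (P \x P)%E 2 (fun w => g w.2).
  case: mg => mg mg'; split; first exact: (measurableT_comp mg).
  rewrite (@fubini_tonelli2 _ _ _ _ _ P P (fun w => (`|g w.2| ^+ 2)%:E))//; last first.
    by apply/measurable_EFinP/measurable_normX; exact: (measurableT_comp mg).
  apply: le_lt_trans mg'; rewrite le_eqVlt; apply/orP; left; apply/eqP.
  apply: eq_integral => x _; rewrite /fubini_G /=.
  by rewrite integral_cst//= [X in (_ * X)%E]probability_setT mule1.
have Qfg : (P \x P)%E.-integrable setT (EFin \o (fun w => f w.1 * g w.2)).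
  by apply: mom_integrable; apply: momM.
rewrite /Rintegral -(integral12_prod_meas1 Qfg) /= /fubini_F /=.
have -> : (\int[P]_x \int[P]_y (f x * g y)%:E = \int[P]_x (f x * \int[P]_y g y)%:E)%E.
  apply: eq_integral => x _.
  under eq_integral do rewrite EFinM.
  by rewrite integralZl// EFinM /Rintegral fineK.
under eq_integral do rewrite EFinM.
by rewrite integralZr// fineM.
Qed.

Section covariance_swap.
Context {dT} {T : measurableType dT} {R : realType} (P : probability T R).
Context {dE} {E : measurableType dE} {n : nat} (Y : 'I_n -> {RV P >-> E}).
Hypothesis sw : swappable Y.
Local Notation Q := (P \x P)%E.
Local Notation X := (mixs Y).
Local Notation tup := (tup Y).

Lemma mixs0 w : X finset.set0 w = tup w.1.
Proof. exact: mixt0. Qed.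

Lemma mixsT w : X finset.setT w = tup w.2.
Proof. exact: mixtT. Qed.

Lemma law_mixs A : law_eq Q (X A) (fun w => tup w.1).
Proof. exact: (law_eq_comp (sw A) measurable_fst). Qed.

Lemma law_mixs_mixt A : law_eq Q
  (fun w => (X A w, X (~: A)%SET w)) (fun w => (X finset.set0 w, X finset.setT w)).
Proof.
have := sw A; congr (law_eq _ _ _); apply/funext => w.
by rewrite mixs0 mixsT.
Qed.

(** Both pairs are images under [(x, x') |-> (x, mixt [set j] x x')], after and before an exchange
    along [A]; as [j] is outside [A], the two modifications do not interfere. *)
Lemma law_mixs_pair (A : {set 'I_n}) j : j \notin A ->
  law_eq Q (fun w => (X A w, X (j |: A)%SET w))
           (fun w => (X finset.set0 w, X [set j]%SET w)).
Proof.
move=> jA.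
have h := @law_eq_comp _ _ _ Q _ _ _ _ _ _
  (fun z : n.-tuple E * n.-tuple E => (z.1, mixt [set j]%SET z.1 z.2)) (law_mixs_mixt A).
have : law_eq Q
   ((fun z : n.-tuple E * n.-tuple E => (z.1, mixt [set j]%SET z.1 z.2)) \o
     (fun w => (X A w, X (~: A)%SET w)))
   ((fun z : n.-tuple E * n.-tuple E => (z.1, mixt [set j]%SET z.1 z.2)) \o
     (fun w => (X finset.set0 w, X finset.setT w))).
  apply: h; apply: measurable_fun_pair => //.
  by apply: measurable_mixt.
congr (law_eq _ _ _); apply/funext => w /=; congr (_, _).
  rewrite /mixs mixt_comp; congr mixt; apply/setP => i; rewrite !inE.
  by have [->|ij] := eqVneq i j; rewrite ?(negbTE jA) ?andbT ?andbF.
by rewrite /mixs mixt0 mixtT.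
Qed.

Lemma mom_mixs q A f : measurable_fun setT f -> mom P q (f \o tup) ->
  mom Q q (f \o X A).
Proof.
move=> mf mft; apply: (law_eq_mom (law_mixs A) mf).
case: mft => m1 m2; split; first exact: (measurableT_comp m1).
rewrite (@ge0_integral_prod_fst _ _ _ _ _ _ _ (fun x => (`|f (tup x)| ^+ q)%:E))//.
exact/measurable_EFinP/measurable_normX.
Qed.

Lemma Rintegral_mixs A f : measurable_fun setT f ->
  \int[Q]_w f (X A w) = \int[P]_w f (tup w).
Proof.
move=> mf; rewrite (law_eq_Rintegral (law_mixs A) mf).
rewrite (@Rintegral_prod_fst _ _ _ _ _ _ _ (fun x => f (tup x)))//.
exact: (measurableT_comp mf (measurable_tup Y)).
Qed.

Section fg.
Variables g f : n.-tuple E -> R.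
Hypotheses (mg : measurable_fun setT g) (mf : measurable_fun setT f).
Hypotheses (g2 : mom P 2 (g \o tup)) (f2 : mom P 2 (f \o tup)).

Let momg A : mom Q 2 (fun w => g (X A w)). Proof. exact: mom_mixs. Qed.
Let momf A : mom Q 2 (fun w => f (X A w)). Proof. exact: mom_mixs. Qed.

Let Q1 h k : mom Q 2 h -> mom Q 2 k ->
  Q.-integrable setT (EFin \o (fun w => h w * k w)).
Proof. by move=> mh mk; apply: mom_integrable; apply: momM. Qed.

(* Exchanging [X_j] and [X'_j] fixes the law and changes the sign of the second
   factor. *)
Lemma swap_difference (A : {set 'I_n}) j : j \notin A ->
  \int[Q]_w (g (X finset.set0 w) * (f (X A w) - f (X (j |: A)%SET w))) =
  2^-1 * \int[Q]_w ((g (X finset.set0 w) - g (X [set j]%SET w)) *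
                    (f (X A w) - f (X (j |: A)%SET w))).
Proof.
move=> jA.
pose G (z : n.-tuple E * n.-tuple E) :=
  g z.1 * (f (mixt A z.1 z.2) - f (mixt (j |: A)%SET z.1 z.2)).
have mG : measurable_fun setT G.
  apply: measurable_funM; first exact: (measurableT_comp mg).
  by apply: measurable_funB; apply: (measurableT_comp mf); exact: measurable_mixt.
have e := law_eq_Rintegral (law_mixs_mixt [set j]%SET) mG.
have eA : (A :\: [set j] :|: [set j] :\: A)%SET = (j |: A)%SET.
  apply/setP => i; rewrite !inE.
  by have [->|ij] := eqVneq i j; rewrite ?(negbTE jA) ?andbT ?andbF ?orbF.
have ejA : ((j |: A) :\: [set j] :|: [set j] :\: (j |: A))%SET = A.
  apply/setP => i; rewrite !inE.
  by have [->|ij] := eqVneq i j; rewrite ?(negbTE jA) ?andbT ?andbF ?orbF.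
have e1 : \int[Q]_w G (X finset.set0 w, X finset.setT w) =
  \int[Q]_w (g (X finset.set0 w) * (f (X A w) - f (X (j |: A)%SET w))).
  by apply: eq_Rintegral => w _; rewrite /G /= mixs0 mixsT.
have e2 : \int[Q]_w G (X [set j]%SET w, X (~: [set j])%SET w) =
  - \int[Q]_w (g (X [set j]%SET w) * (f (X A w) - f (X (j |: A)%SET w))).
  rewrite -[RHS]mulN1r -RintegralZl//; last by apply: Q1 => //; exact: momB.
  apply: eq_Rintegral => w _; rewrite /G /= /mixs !mixt_comp eA ejA; ring.
set I0 := \int[Q]_w (g (X finset.set0 w) * _) in e1 *.
set Ij := \int[Q]_w (g (X [set j]%SET w) * _) in e2 *.
have -> : \int[Q]_w ((g (X finset.set0 w) - g (X [set j]%SET w)) *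
    (f (X A w) - f (X (j |: A)%SET w))) = I0 - Ij.
  rewrite /I0 /Ij -RintegralB//; [|by apply: Q1 => //; exact: momB..].
  by apply: eq_Rintegral => w _; rewrite mulrBl.
by have : I0 = - Ij; [rewrite -e1 -e2 e|move=> ->; field].
Qed.

Lemma covariance_swap :
  \int[P]_w (g (tup w) * f (tup w)) -
  (\int[P]_w g (tup w)) * (\int[P]_w f (tup w)) =
  2^-1 * \sum_(A : {set 'I_n}) \sum_(j | j \notin A) subset_weight A *
    \int[Q]_w ((g (X finset.set0 w) - g (X [set j]%SET w)) *
               (f (X A w) - f (X (j |: A)%SET w))).
Proof.
(* At the empty set this is the expectation of the product; at the full set it is the product of the
   expectations, as the two copies are independent. *)
pose F A := \int[Q]_w (g (X finset.set0 w) * f (X A w)).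
have -> : \int[P]_w (g (tup w) * f (tup w)) = F finset.set0.
  rewrite /F (Rintegral_mixs finset.set0 (f := fun x => g x * f x))//.
  exact: measurable_funM.
have -> : (\int[P]_w g (tup w)) * (\int[P]_w f (tup w)) = F finset.setT.
  rewrite -Rintegral_prodM//; apply: eq_Rintegral => w _.
  by rewrite mixs0 mixsT.
rewrite -subset_telescope mulr_sumr; apply: eq_bigr => A _.
rewrite mulr_sumr; apply: eq_bigr => j jA; rewrite mulrCA -swap_difference//.
congr (_ * _); rewrite /F -RintegralB//; [|exact: Q1..].
by apply: eq_Rintegral => w _; rewrite mulrBr.
Qed.

End fg.

(** The case [g = f] of the covariance formula: each cross product is at most the half sum of two
    squares with the same law, and for each [j] the weights add up to 1. *)
Lemma efron_stein (F : n.-tuple E -> R) : measurable_fun setT F ->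
  mom P 2 (F \o tup) ->
  \int[P]_w (F (tup w) ^+ 2) - (\int[P]_w F (tup w)) ^+ 2 <=
  2^-1 * \sum_(j < n) \int[Q]_w ((F (X finset.set0 w) - F (X [set j]%SET w)) ^+ 2).
Proof.
move=> mF F2; rewrite expr2 (covariance_swap mF mF F2 F2).
rewrite ler_pM2l ?invr_gt0//.
pose D j := \int[Q]_w ((F (X finset.set0 w) - F (X [set j]%SET w)) ^+ 2).
have momF A : mom Q 2 (fun w => F (X A w)) by exact: mom_mixs.
have ID A B : Q.-integrable setT (EFin \o (fun w => (F (X A w) - F (X B w)) ^+ 2)).
  by apply: mom_integrable; apply: (momM (q := 1)); exact: momB.
have -> : \sum_(j < n) D j =
    \sum_(A : {set 'I_n}) \sum_(j | j \notin A) subset_weight A * D j.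
  rewrite (exchange_big_dep predT)//=; apply: eq_bigr => j _.
  by rewrite -mulr_suml sum_subset_weight_notin mul1r.
apply: ler_sum => A _; apply: ler_sum => j jA.
apply: ler_wpM2l; first exact: subset_weight_ge0.
pose V A' := \int[Q]_w ((F (X A' w) - F (X (j |: A')%SET w)) ^+ 2).
have e : V A = D j.
  pose h (z : n.-tuple E * n.-tuple E) := (F z.1 - F z.2) ^+ 2.
  have mh : measurable_fun setT h.
    by apply: measurable_funX; apply: measurable_funB; exact: (measurableT_comp mF).
  exact: (law_eq_Rintegral (law_mixs_pair jA) mh).
apply: (@le_trans _ _ (2^-1 * (D j + V A))); last by rewrite e; lra.
rewrite -RintegralD//; [|exact: ID..].
rewrite -RintegralZl//; last first.
  have := integrableD measurableT (ID finset.set0 [set j]%SET) (ID A (j |: A)%SET).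
  by [].
apply: le_Rintegral => //.
- by apply: mom_integrable; apply: momM; exact: momB.
- apply: mom_integrable; apply: momZ; apply: momD; apply: integrable_mom; exact: ID.
move=> w _; set a := _ - _; set b := _ - _.
have := sqr_ge0 (a - b); rewrite sqrrB; lra.
Qed.

End covariance_swap.

Lemma Rintegral_sum {dT} {T : measurableType dT} {R : realType}
  (P : probability T R) (I : Type) (r : seq I) (p : pred I) (f : I -> T -> R) :
  (forall i, p i -> mom P 1 (f i)) ->
  \int[P]_x (\sum_(i <- r | p i) f i x) = \sum_(i <- r | p i) \int[P]_x f i x.
Proof.
move=> mf; elim: r => [|i r IH].
  rewrite big_nil (_ : (fun=> _) = (fun=> 0)); last by apply/funext => x; rewrite big_nil.
  by rewrite Rintegral_cst// mul0r.
rewrite big_cons; case: ifP => pi.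
  rewrite -IH -RintegralD//.
  - by apply: eq_Rintegral => x _; rewrite big_cons pi.
  - exact/mom_integrable/mf.
  - exact/mom_integrable/mom_sum.
by rewrite -IH; apply: eq_Rintegral => x _; rewrite big_cons pi.
Qed.

Lemma mom_norm {dT} {T : measurableType dT} {R : realType}
  (P : probability T R) q (f : T -> R) : mom P q f -> mom P q (fun x => `|f x|).
Proof.
move=> m; apply: (mom_dom _ _ m) => [|x]; last by rewrite normr_id.
by apply: measurableT_comp => //; exact: mom_measurable m.
Qed.

Lemma le_Rintegral_mom {dT} {T : measurableType dT} {R : realType}
  (P : probability T R) (f g : T -> R) : mom P 1 f -> mom P 1 g ->
  (forall x, f x <= g x) -> \int[P]_x f x <= \int[P]_x g x.
Proof. by move=> mf mg fg; apply: le_Rintegral => //; exact: mom_integrable. Qed.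

Lemma norm_Rintegral_le {dT} {T : measurableType dT} {R : realType}
  (P : probability T R) (f g : T -> R) : mom P 1 f -> mom P 1 g ->
  (forall x, `|f x| <= g x) -> `|\int[P]_x f x| <= \int[P]_x g x.
Proof.
move=> mf mg fg; apply: le_trans (le_normr_Rintegral _ _) _ => //.
  exact: mom_integrable.
by apply: le_Rintegral_mom => //; exact: mom_norm.
Qed.

(** Cauchy-Schwarz in the form [t <= t^2 / (2 s) + s / 2], with [s] slightly larger than [v] so that
    [v = 0] is covered. *)
Lemma L1_deviation {dT} {T : measurableType dT} {R : realType}
  (P : probability T R) (y : T -> R) (v : R) : mom P 2 y -> 0 <= v ->
  \int[P]_x (y x ^+ 2) - (\int[P]_x y x) ^+ 2 <= v ^+ 2 ->
  \int[P]_x `|y x - \int[P]_z y z| <= v.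
Proof.
move=> my v0 hv; set m := \int[P]_z y z.
have my1 : mom P 1 y by exact: mom_le my.
have my2 : mom P 1 (fun x => y x ^+ 2) by apply: (momM (q := 1)).
have md : mom P 2 (fun x => y x - m) by apply: momB => //; exact: mom_cst.
have md2 : mom P 1 (fun x => (y x - m) ^+ 2) by apply: (momM (q := 1)).
have eV : \int[P]_x ((y x - m) ^+ 2) <= v ^+ 2.
  apply: le_trans hv; rewrite le_eqVlt; apply/orP; left; apply/eqP.
  transitivity (\int[P]_x (y x ^+ 2 + ((- 2 * m) * y x + m ^+ 2))).
    by apply: eq_Rintegral => x _; ring.
  rewrite RintegralD//; [|exact: mom_integrable|by apply/mom_integrable/momD; [exact: momZ|exact: mom_cst]].
  rewrite RintegralD//; [|by apply/mom_integrable/momZ|by apply/mom_integrable/mom_cst].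
  rewrite RintegralZl//; last exact: mom_integrable.
  rewrite Rintegral_cst// -/m (_ : fine (P setT) = 1); last by rewrite probability_setT.
  ring.
apply/ler_addgt0Pr => e e0.
have s0 : 0 < v + e by lra.
apply: (@le_trans _ _ (\int[P]_x ((2 * (v + e))^-1 * (y x - m) ^+ 2 + (v + e) / 2))).
  apply: le_Rintegral_mom.
  - exact/mom_norm/(mom_le _ md).
  - by apply: momD; [exact: momZ|exact: mom_cst].
  move=> x; set t := y x - m; set s := v + e in s0 *.
  set k := (2 * s)^-1.
  have k0 : 0 <= k by rewrite invr_ge0 mulr_ge0// ltW.
  have ks : k * (2 * s) = 1 by rewrite mulVf// gt_eqF// mulr_gt0.
  have := mulr_ge0 k0 (sqr_ge0 (`|t| - s)).
  have -> : k * (`|t| - s) ^+ 2 = k * `|t| ^+ 2 - (k * (2 * s)) * `|t| + (k * (2 * s)) * (s / 2) by field.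
  rewrite ks real_normK ?num_real//; lra.
rewrite RintegralD//; [|by apply/mom_integrable/momZ|by apply/mom_integrable/mom_cst].
rewrite Rintegral_cst// (_ : fine (P setT) = 1); last by rewrite probability_setT.
rewrite RintegralZl//; last exact: (mom_integrable md2).
rewrite mulr1; set k := (2 * (v + e))^-1.
have k0 : 0 <= k by rewrite invr_ge0 mulr_ge0// ltW.
have ks : k * (2 * (v + e)) = 1 by rewrite mulVf// gt_eqF// mulr_gt0.
apply: (le_trans (lerD (ler_wpM2l k0 eV) (lexx _))).
apply: (@le_trans _ _ (k * (v + e) ^+ 2 + (v + e) / 2)).
  by rewrite lerD2r ler_wpM2l// lerXn2r ?nnegrE; lra.
have -> : k * (v + e) ^+ 2 = (k * (2 * (v + e))) * ((v + e) / 2) by field.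
rewrite ks; lra.
Qed.

(** * Normal approximation by swapping *)

Section stein_swap.
Context {dT} {T : measurableType dT} {R : realType} (P : probability T R).
Context {dE} {E : measurableType dE} {n : nat} (Y : 'I_n -> {RV P >-> E}).
Hypothesis sw : swappable Y.
Local Notation Q := (P \x P)%E.
Local Notation X := (mixs Y).
Local Notation tup := (tup Y).
Variables (F : n.-tuple E -> R) (mF : measurable_fun setT F).
Hypothesis F4 : mom P 4 (F \o tup).

Definition swap_sum (A : {set 'I_n}) (w : T * T) : R :=
  \sum_(j | j \notin A) (F (X finset.set0 w) - F (X [set j]%SET w)) *
                        (F (X A w) - F (X (j |: A)%SET w)).

Lemma mom_swap_sum A : mom Q 2 (swap_sum A).
Proof. by apply: mom_sum => j _; apply: (momM (q := 2)); apply: momB; exact: mom_mixs. Qed.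

Hypotheses (EF0 : \int[P]_w F (tup w) = 0) (EF1 : \int[P]_w (F (tup w) ^+ 2) = 1).
Variables (g g' : R -> R) (C : R).
Hypotheses (mg : measurable_fun setT g) (mg' : measurable_fun setT g').
Hypotheses (gb : forall x, `|g x| <= C) (gb' : forall x, `|g' x| <= C).
Hypothesis taylor : forall a b, `|g b - g a - g' a * (b - a)| <= C * (b - a) ^+ 2.
Variable v : {set 'I_n} -> R.
Hypothesis v0 : forall A, 0 <= v A.
Hypothesis var_swap_sum : forall A,
  \int[Q]_w (swap_sum A w ^+ 2) - (\int[Q]_w swap_sum A w) ^+ 2 <= v A ^+ 2.

(* [F g(F)] is expanded by [covariance_swap]; after a Taylor expansion of [g] the
   main term is [g'(F)] times the average of [swap_sum F A], whose mean is 1. *)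
Lemma stein_swap_bound :
  `| \int[P]_w (g' (F (tup w)) - F (tup w) * g (F (tup w))) | <=
  C * (2^-1 * \sum_(A : {set 'I_n}) subset_weight A * v A) +
  C * \sum_(j < n) \int[Q]_w (`|F (X finset.set0 w) - F (X [set j]%SET w)| ^+ 3).
Proof.
have mtup := measurable_tup Y.
have C0 : 0 <= C by apply: le_trans (gb 0).
pose D j (w : T * T) := F (X finset.set0 w) - F (X [set j]%SET w).
pose DA A j (w : T * T) := F (X A w) - F (X (j |: A)%SET w).
have mX A q : (q <= 4)%N -> mom Q q (fun w => F (X A w)).
  by move=> q4; apply: (mom_le q4); exact: mom_mixs.
have bounded_mom (dU : measure_display) (U : measurableType dU) (p : probability U R) q (h : R -> R) (k : U -> R) :
    measurable_fun setT h -> measurable_fun setT k -> (forall x, `|h x| <= C) ->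
    mom p q (fun x => h (k x)).
  move=> mh mk hb; apply: (mom_dom _ _ (mom_cst p q C)); first exact: measurableT_comp.
  by move=> x; rewrite (ger0_norm C0).
have mgF A q (h : R -> R) : measurable_fun setT h -> (forall x, `|h x| <= C) ->
    mom Q q (fun w => h (F (X A w))).
  by move=> mh hb; apply: bounded_mom => //; exact: (measurableT_comp mF (measurable_mixs Y A)).
have mgP q (h : R -> R) : measurable_fun setT h -> (forall x, `|h x| <= C) ->
    mom P q (fun w => h (F (tup w))).
  by move=> mh hb; apply: bounded_mom => //; exact: (measurableT_comp mF).
have mFP q : (q <= 4)%N -> mom P q (fun w => F (tup w)).
  by move=> q4; exact: mom_le F4.
have c1 := @covariance_swap _ _ _ P _ _ _ Y sw (g \o F) F (measurableT_comp mg mF)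
  mF (mgP 2%N g mg gb) (mFP 2%N isT).
have c2 := @covariance_swap _ _ _ P _ _ _ Y sw F F mF mF (mFP 2%N isT) (mFP 2%N isT).
rewrite EF0 mulr0 subr0 in c1; rewrite EF0 mulr0 subr0 in c2.
(* The covariance formula for [F] with itself: unit variance writes 1 as the averaged mean of the
   [swap_sum], which will centre the main term. *)
have {c2}c2 : 1 = 2^-1 * \sum_(A : {set 'I_n}) subset_weight A * \int[Q]_w swap_sum A w.
  transitivity (\int[P]_w (F (tup w) * F (tup w))); first by rewrite -EF1; apply: eq_Rintegral.
  rewrite c2; congr (_ * _); apply: eq_bigr => A _.
  rewrite -mulr_sumr -Rintegral_sum// => j _.
  by apply: (momM (q := 1)); apply: momB; exact: mX.
have mDD A j : mom Q 1 (fun w => D j w * DA A j w).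
  by apply: (momM (q := 1)); apply: momB; exact: mX.
have mrem A j : mom Q 1 (fun w => (g (F (X finset.set0 w)) - g (F (X [set j]%SET w)) -
    g' (F (X finset.set0 w)) * D j w) * DA A j w).
  apply: (momM (q := 1)); last by apply: momB; exact: mX.
  apply: momB; first by apply: momB; exact: mgF.
  by apply: (momM (q := 2)); [exact: mgF|apply: momB; exact: mX].
have mgS A : mom Q 1 (fun w => g' (F (X finset.set0 w)) * swap_sum A w).
  by apply: (momM (q := 1)); [exact: mgF|exact: mom_swap_sum].
have eg' : \int[P]_w g' (F (tup w)) = \int[Q]_w g' (F (X finset.set0 w)).
  by rewrite -(Rintegral_mixs sw finset.set0 (f := g' \o F))//; exact: measurableT_comp.
rewrite RintegralB//; [|by apply/mom_integrable; exact: mgP|]; last first.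
  by apply/mom_integrable/(momM (q := 1)); [exact: mFP|exact: mgP].
have -> : \int[P]_w (F (tup w) * g (F (tup w))) = \int[P]_w ((g \o F) (tup w) * F (tup w)).
  by apply: eq_Rintegral => w _; rewrite mulrC.
rewrite c1 eg'.
set EG := \int[Q]_w g' (F (X finset.set0 w)).
pose Rem A j := \int[Q]_w ((g (F (X finset.set0 w)) - g (F (X [set j]%SET w)) -
    g' (F (X finset.set0 w)) * D j w) * DA A j w).
pose GS A := \int[Q]_w (g' (F (X finset.set0 w)) * swap_sum A w).
pose ES A := \int[Q]_w swap_sum A w.
have -> : \sum_(A : {set 'I_n}) \sum_(j | j \notin A) subset_weight A *
    \int[Q]_w (((g \o F) (X finset.set0 w) - (g \o F) (X [set j]%SET w)) *
               (F (X A w) - F (X (j |: A)%SET w))) =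
    \sum_(A : {set 'I_n}) subset_weight A * (GS A + \sum_(j | j \notin A) Rem A j).
  apply: eq_bigr => A _; rewrite -mulr_sumr; congr (_ * _).
  rewrite -Rintegral_sum; last first.
    by move=> j _; apply: (momM (q := 1)); apply: momB; first [exact: mX|exact: mgF].
  rewrite /GS /Rem -[X in _ = _ + X]Rintegral_sum; last by move=> j _; exact: mrem.
  rewrite -RintegralD//; [|exact/mom_integrable/mgS|]; last first.
    by apply/mom_integrable/mom_sum => j _; exact: mrem.
  apply: eq_Rintegral => w _; rewrite /swap_sum mulr_sumr -big_split/=.
  by apply: eq_bigr => j _; rewrite /D /DA; ring.
(* Multiplying [EG] by this expression of 1 pairs it with the means [ES A], so that the first sum
   only sees the deviation of [swap_sum A] from its mean. *)
have -> : EG - 2^-1 * \sum_(A : {set 'I_n}) subset_weight A * (GS A + \sum_(j | j \notin A) Rem A j) =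
  2^-1 * \sum_(A : {set 'I_n}) subset_weight A * (EG * ES A - GS A) -
  2^-1 * \sum_(A : {set 'I_n}) \sum_(j | j \notin A) subset_weight A * Rem A j.
  rewrite -{1}[EG]mulr1 {1}c2 mulrCA -!mulrBr; congr (_ * _).
  rewrite mulr_sumr -!sumrB; apply: eq_bigr => A _; rewrite -mulr_sumr /ES; ring.
apply: le_trans (ler_normB _ _) _; apply: lerD.
  rewrite normrM ger0_norm ?invr_ge0// [leRHS]mulrCA ler_pM2l ?invr_gt0//.
  rewrite mulr_sumr; apply: le_trans (ler_norm_sum _ _ _) _; apply: ler_sum => A _.
  rewrite normrM ger0_norm ?subset_weight_ge0// mulrCA ler_wpM2l ?subset_weight_ge0//.
  rewrite /GS /EG mulrC -RintegralZl//; last by apply/mom_integrable; exact: mgF.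
  have mES : mom Q 1 (fun w => ES A * g' (F (X finset.set0 w))) by apply: momZ; exact: mgF.
  have mSA : mom Q 1 (fun w => `|swap_sum A w - ES A|).
    by apply/mom_norm/momB; [exact: (mom_le _ (mom_swap_sum A))|exact: mom_cst].
  rewrite -RintegralB//; [|exact: mom_integrable..].
  apply: (@le_trans _ _ (C * \int[Q]_w `|swap_sum A w - ES A|)); last first.
    by rewrite ler_wpM2l//; apply: L1_deviation => //; exact: mom_swap_sum.
  rewrite -RintegralZl//; last exact: mom_integrable.
  apply: norm_Rintegral_le; [exact: momB|exact: momZ|] => w.
  rewrite mulrC -mulrBr normrM distrC ler_wpM2r//.
rewrite normrM ger0_norm ?invr_ge0//.
pose T3 A j := \int[Q]_w (`|DA A j w| ^+ 3).
have m3 A j : mom Q 1 (fun w => `|DA A j w| ^+ 3).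
  have /(mom_le (q := 4)) h : mom Q 4 (DA A j) by apply: momB; exact: mX.
  have [m1 m2] := h 3%N isT; split; first exact: measurable_normX.
  apply: le_lt_trans m2; rewrite le_eqVlt; apply/orP; left; apply/eqP.
  by apply: eq_integral => w _; rewrite expr1 normrX normr_id.
have eT (A : {set 'I_n}) (j : 'I_n) : j \notin A -> T3 A j = \int[Q]_w (`|D j w| ^+ 3).
  move=> jA; pose h (z : n.-tuple E * n.-tuple E) := `|F z.1 - F z.2| ^+ 3.
  have mh : measurable_fun setT h.
    by apply: measurable_normX; apply: measurable_funB; exact: (measurableT_comp mF).
  exact: (law_eq_Rintegral (law_mixs_pair sw jA) mh).
have -> : \sum_(j < n) \int[Q]_w (`|F (X finset.set0 w) - F (X [set j]%SET w)| ^+ 3) =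
    \sum_(A : {set 'I_n}) \sum_(j | j \notin A) subset_weight A * \int[Q]_w (`|D j w| ^+ 3).
  rewrite (exchange_big_dep predT)//=; apply: eq_bigr => j _.
  by rewrite -mulr_suml sum_subset_weight_notin mul1r.
rewrite !mulr_sumr; apply: le_trans (ler_wpM2l _ (ler_norm_sum _ _ _)) _.
  by rewrite invr_ge0.
rewrite mulr_sumr; apply: ler_sum => A _; rewrite mulr_sumr.
apply: le_trans (ler_wpM2l _ (ler_norm_sum _ _ _)) _; first by rewrite invr_ge0.
rewrite mulr_sumr; apply: ler_sum => j jA.
rewrite normrM ger0_norm ?subset_weight_ge0// mulrCA [leRHS]mulrCA.
rewrite ler_wpM2l ?subset_weight_ge0// ler_pdivrMl//.
have m3' : mom Q 1 (fun w => `|D j w| ^+ 3).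
  have -> : D j = DA finset.set0 j by rewrite /D /DA finset.setU0.
  exact: m3.
(* The remainder is at most [C D^2 |DA| <= C (|D|^3 + |DA|^3)]. Both cubes have the same
   expectation, and the resulting factor 2 cancels the [1/2] of the covariance formula. *)
apply: (@le_trans _ _ (\int[Q]_w (C * (`|D j w| ^+ 3 + `|DA A j w| ^+ 3)))).
  apply: norm_Rintegral_le => //; first by apply: momZ; exact: momD.
  move=> w; rewrite normrM.
  apply: (@le_trans _ _ (C * `|D j w| ^+ 2 * `|DA A j w|)).
    apply: ler_wpM2r => //.
    have := taylor (F (X finset.set0 w)) (F (X [set j]%SET w)).
    rewrite real_normK ?num_real// /D -[X in `|X|]opprK normrN -[(_ - _) ^+ 2 in leRHS]sqrrN.
    by congr (`|_| <= C * _ ^+ 2); ring.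
  rewrite -mulrA ler_wpM2l//.
  set a := `|D j w|; set b := `|DA A j w|.
  have a0 : 0 <= a by exact: normr_ge0.
  have b0 : 0 <= b by exact: normr_ge0.
  case: (leP a b) => ab.
    rewrite (@le_trans _ _ (b ^+ 3)) ?lerDr ?exprn_ge0// (exprSr b 2) ler_wpM2r//.
    by rewrite lerXn2r// nnegrE.
  rewrite (@le_trans _ _ (a ^+ 3)) ?lerDl ?exprn_ge0// (exprSr a 2) ler_wpM2l ?exprn_ge0// ltW//.
rewrite RintegralZl//; last by apply/mom_integrable/momD.
rewrite RintegralD//; [|exact: mom_integrable..].
rewrite -/(T3 A j) eT// le_eqVlt; apply/orP; left; apply/eqP; ring.
Qed.

End stein_swap.

(** * The Stein equation *)

Section derive1_rules.
Context {R : realType}.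
Implicit Types (u v : R -> R) (x du dv : R).

Lemma is_derive1D u v x du dv : is_derive x 1 u du -> is_derive x 1 v dv ->
  is_derive x 1 (fun t => u t + v t) (du + dv).
Proof. by move=> hu hv; exact: is_deriveD. Qed.

Lemma is_derive1Z (a : R) u x du : is_derive x 1 u du ->
  is_derive x 1 (fun t => a * u t) (a * du).
Proof. by move=> hu; exact: (is_deriveZ a hu). Qed.

Lemma is_derive1M u v x du dv : is_derive x 1 u du -> is_derive x 1 v dv ->
  is_derive x 1 (fun t => u t * v t) (u x * dv + v x * du).
Proof. by move=> hu hv; exact: (is_deriveM hu hv). Qed.

Lemma is_derive1V v x dv : v x != 0 -> is_derive x 1 v dv ->
  is_derive x 1 (fun t => (v t)^-1) (- (v x ^- 2) * dv).
Proof. by move=> vx hv; exact: (is_deriveV vx hv). Qed.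

Lemma is_derive_continuous u du x : is_derive x 1 u du -> {for x, continuous u}.
Proof.
by move=> [h _]; apply: differentiable_continuous; exact/derivable1_diffP.
Qed.

(** On the half-line [w] decreases to 0, hence stays nonnegative. The rate [M / t] exhibits a point
    where a negative value would be contradicted. *)
Lemma tail_nonneg (w w' : R -> R) (x M : R) : 0 < x ->
  (forall t : R, is_derive t 1 w (w' t)) -> (forall t, x <= t -> w' t <= 0) ->
  (forall t : R, 0 < t -> `|w t| <= M / t) -> 0 <= w x.
Proof.
move=> x0 dw w0 wM; rewrite leNgt; apply/negP => wx.
have M0 : 0 <= M by have := wM 1 ltr01; rewrite divr1; apply: le_trans.
(* Chosen so that [- w x * y = - w x * x + M + 1], which exceeds [M]. *)
pose y := x + (M + 1) / (- w x).
have wx0 : 0 < - w x by rewrite oppr_gt0.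
have xy : x <= y by rewrite lerDl divr_ge0// ?ltW//; lra.
have y0 : 0 < y by apply: lt_le_trans xy.
have [|c] := @MVT_segment R w w' x y xy (fun t _ => dw t).
  by apply: continuous_subspaceT => t; exact: is_derive_continuous (dw t).
rewrite in_itv/= => /andP[xc _] e.
have wy : w y <= w x by rewrite -subr_le0 e mulr_le0_ge0 ?w0// subr_ge0.
have := wM y y0; rewrite ler_pdivlMr// ler0_norm; last by rewrite (le_trans wy)// ltW.
apply/negP; rewrite -ltNge.
apply: (@lt_le_trans _ _ (- w x * y)); last by rewrite (ler_pM2r y0) lerN2.
rewrite /y mulrDr mulrCA mulfV ?gt_eqF// mulr1.
by have := mulr_gt0 wx0 x0; lra.
Qed.

End derive1_rules.

(** * Comparison of Gaussian tail integrals *)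

Section barrier.
Context {R : realType}.
Variables (p m : R -> R) (Mp Mm : R).
Hypothesis p0 : forall t, 0 < p t.
Hypothesis dp : forall t : R, is_derive t 1 p (- t * p t).
Hypothesis pM : forall t : R, 0 < t -> `|p t| <= Mp / t.
Hypothesis dm : forall t : R, is_derive t 1 m (- p t).
Hypothesis mM : forall t : R, 0 < t -> `|m t| <= Mm / t.

(** Here [p] stands for the Gaussian density and [m] for its upper tail. With [x] frozen,
    [p t - x * m t] has derivative [(x - t) p t], nonpositive beyond [x]. *)
Lemma mills_upper (x : R) : 0 < x -> x * m x <= p x.
Proof.
move=> x0; rewrite -subr_ge0.
apply: (@tail_nonneg _ (fun t => p t - x * m t) (fun t => (x - t) * p t) x (Mp + x * Mm)) => //.
- move=> t; have h := is_derive1D (dp t) (is_derive1Z (- x) (dm t)).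
  have -> : (fun t => p t - x * m t) = (fun t => p t + - x * m t).
    by apply/funext => s; rewrite mulNr.
  by apply: (is_derive_eq h); ring.
- by move=> t xt; apply: mulr_le0_ge0; [rewrite subr_le0|exact: ltW].
- move=> t t0; rewrite mulrDl -mulrA; apply: le_trans (ler_normB _ _) _.
  by rewrite lerD ?pM// normrM (gtr0_norm x0) ler_wpM2l ?mM// ltW.
Qed.

Lemma mills_lower (x : R) : 0 < x -> p x * (x / (1 + x ^+ 2)) <= m x.
Proof.
move=> x0; rewrite -subr_ge0.
have q0 (t : R) : 0 < 1 + t ^+ 2 :> R by rewrite ltr_pwDl// sqr_ge0.
have q1 (t : R) : 0 < t -> 0 <= t / (1 + t ^+ 2) <= 1.
  move=> t0; rewrite divr_ge0 ?(ltW (q0 t)) ?(ltW t0)//= ler_pdivrMr// mul1r.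
  by have := sqr_ge0 (t - 1); rewrite sqrrB; have := ltW t0; lra.
apply: (@tail_nonneg _ (fun t => m t - p t * (t / (1 + t ^+ 2)))
  (fun t => - 2 * p t / (1 + t ^+ 2) ^+ 2) x (Mm + Mp)) => //.
- move=> t.
  have d1 : is_derive t 1 (fun t : R => 1 + t * t) (0 + (t * 1 + t * 1)).
    exact: (is_derive1D (is_derive_cst _ _ _) (is_derive1M (is_derive_id _ _) (is_derive_id _ _))).
  have d2 := is_derive1V (v := fun t : R => 1 + t * t) (lt0r_neq0 (q0 t)) d1.
  have d3 := is_derive1M (@is_derive_id R R t 1) d2.
  have d4 := is_derive1D (dm t) (is_derive1Z (-1) (is_derive1M (dp t) d3)).
  have -> : (fun t => m t - p t * (t / (1 + t ^+ 2))) =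
    (fun t => m t + -1 * (p t * (id t * (1 + t * t)^-1))).
    by apply/funext => s; rewrite mulN1r.
  apply: (is_derive_eq d4) => /=.
  have := q0 t; rewrite expr2 => qt.
  by field; rewrite gt_eqF.
- move=> t xt; rewrite -mulrA mulNr oppr_le0; apply: mulr_ge0 => //.
  by apply: divr_ge0; [exact: ltW|apply: exprn_ge0; exact: ltW].
- move=> t t0; rewrite mulrDl; apply: le_trans (ler_normB _ _) _.
  rewrite lerD ?mM// normrM; have /andP[a b] := q1 _ t0.
  rewrite (ger0_norm a); apply: le_trans (pM t0).
  by rewrite ler_piMr.
Qed.

Variables (k u : R -> R) (c Mu : R).
Hypothesis c0 : 0 <= c.

(** If [u] is a primitive of [k p] vanishing at infinity, then [- u x] is the integral of [k p]
    beyond [x]. A 1-Lipschitz [k] lies there below the affine function [t |-> k x + (t - x)], whose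
    integral is [(k x - x) m x + p x]. *)
Lemma barrier_below (x : R) : 0 < x ->
  (forall s t, `|k s - k t| <= `|s - t|) ->
  (forall t : R, is_derive t 1 u (k t * p t)) ->
  (forall t : R, 0 < t -> `|u t| <= Mu / t) ->
  0 <= u x + (k x - x) * m x + p x.
Proof.
move=> x0 kl du uM.
apply: (@tail_nonneg _ (fun t => u t + (k x - x) * m t + p t)
  (fun t => (k t - k x - (t - x)) * p t) x (Mu + `|k x - x| * Mm + Mp)) => //.
- move=> t; have h := is_derive1D (is_derive1D (du t) (is_derive1Z (k x - x) (dm t))) (dp t).
  by apply: (is_derive_eq h); ring.
- move=> t xt; apply: mulr_le0_ge0; last exact: ltW.
  rewrite subr_le0.
  by apply: le_trans (ler_norm _) _; rewrite (le_trans (kl _ _))// ger0_norm ?subr_ge0.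
- move=> t t0; rewrite [leRHS]mulrDl [X in _ <= X + _]mulrDl; apply: le_trans (ler_normD _ _) _.
  rewrite lerD ?pM//; apply: le_trans (ler_normD _ _) _.
  by rewrite lerD ?uM// normrM -mulrA ler_wpM2l ?mM.
Qed.
End barrier.

Section right_bounds.
Context {R : realType}.
Variables (p m : R -> R) (Mp Mm : R).
Hypothesis p0 : forall t, 0 < p t.
Hypothesis dp : forall t : R, is_derive t 1 p (- t * p t).
Hypothesis pM : forall t : R, 0 < t -> `|p t| <= Mp / t.
Hypothesis dm : forall t : R, is_derive t 1 m (- p t).
Hypothesis mM : forall t : R, 0 < t -> `|m t| <= Mm / t.
Variables (k u : R -> R) (c Mu : R).
Hypothesis c0 : 0 <= c.
Hypothesis kl : forall s t, `|k s - k t| <= `|s - t|.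
Hypothesis kc : forall t, `|k t| <= c + `|t|.
Hypothesis du : forall t : R, is_derive t 1 u (k t * p t).
Hypothesis uM : forall t : R, 0 < t -> `|u t| <= Mu / t.

(** For the Stein solution [g = u / p], these bound [g], [g'] and [x g'] once divided by [p]. The
    third one is what makes [x g], and therefore [g'], Lipschitz. *)
Lemma right_bounds (x : R) : 1 <= x ->
  [/\ `|u x| <= (c + 3) * p x, `|x * u x + k x * p x| <= (c + 2) * p x
    & `|x * (x * u x + k x * p x)| <= (c + 2) * p x].
Proof.
move=> x1; have x0 : 0 < x by lra.
have lo := barrier_below p0 dp pM dm mM x0 kl du uM.
have hi : 0 <= - u x + (- k x - x) * m x + p x.
  apply: (@barrier_below _ p m Mp Mm p0 dp pM dm mM (fun t => - k t) (fun t => - u t) Mu x x0).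
  - by move=> s t; rewrite -opprD normrN; exact: kl.
  - move=> t; have h := is_derive1Z (-1) (du t).
    have -> : (fun t => - u t) = (fun t => -1 * u t) by apply/funext => s; rewrite mulN1r.
    by apply: (is_derive_eq h); ring.
  - by move=> t t0; rewrite normrN; exact: uM.
have mu := mills_upper p0 dp pM dm mM x0.
have ml := mills_lower p0 dp pM dm mM x0.
have q0 : 0 < 1 + x ^+ 2 :> R by rewrite ltr_pwDl// sqr_ge0.
have kx : `|k x| <= c + x by have := kc x; rewrite (gtr0_norm x0).
have px := p0 x.
have m0 : 0 <= m x.
  by apply: le_trans ml; rewrite mulr_ge0 ?divr_ge0 ?(ltW q0) ?(ltW px) ?(ltW x0).
have d1 : p x - x * m x <= p x / (1 + x ^+ 2).
  have -> : p x / (1 + x ^+ 2) = p x - x * (p x * (x / (1 + x ^+ 2))) by field; rewrite gt_eqF.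
  by rewrite lerD2l lerN2 ler_wpM2l// ltW.
move: kx; rewrite ler_norml => /andP[k1 k2].
have A : `|u x| <= (c + 2 * x) * m x + p x.
  by rewrite ler_norml; apply/andP; split; nra.
(* Applied to [k] and [- k], the barrier gives [u + k m] at most [p - x m] in absolute value; then
   [x u + k p = x (u + k m) + k (p - x m)]. *)
have B : `|x * u x + k x * p x| <= (c + 2 * x) * (p x - x * m x).
  by rewrite ler_norml; apply/andP; split; nra.
have B' : `|x * u x + k x * p x| <= (c + 2 * x) * (p x / (1 + x ^+ 2)).
  by apply: le_trans B _; rewrite ler_wpM2l//; lra.
have C : x * (c + 2 * x) <= (c + 2) * (1 + x ^+ 2).
  rewrite -subr_ge0; have -> : (c + 2) * (1 + x ^+ 2) - x * (c + 2 * x) = c * (1 + x * (x - 1)) + 2 by ring.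
  by apply: addr_ge0 => //; apply: mulr_ge0 => //; have /(addr_ge0 ler01) : 0 <= x * (x - 1) by apply: mulr_ge0; lra.
have D : `|x * (x * u x + k x * p x)| <= (c + 2) * p x.
  rewrite normrM (gtr0_norm x0).
  apply: (@le_trans _ _ (x * ((c + 2 * x) * (p x / (1 + x ^+ 2))))).
    by rewrite ler_wpM2l// ltW.
  rewrite !mulrA ler_pdivrMr// -[leRHS]mulrA [p x * _]mulrC [leRHS]mulrA.
  by rewrite ler_wpM2r// ltW.
split=> //.
  apply: le_trans A _.
  have mp : m x <= p x by apply: le_trans mu; rewrite ler_peMl.
  have := ler_wpM2l c0 mp; lra.
apply: le_trans D; rewrite normrM (gtr0_norm x0) ler_peMl//.
Qed.

End right_bounds.

(** * The standard normal density and its integrals *)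

Section gaussian.
Context {R : realType}.
Local Notation mu := (@lebesgue_measure R).
Local Notation p := (normal_pdf (0 : R) 1).
Local Notation nu := (normal_prob (0 : R) 1).

Lemma stdpdfE x : p x = normal_peak 1 * expR (- (x * x / 2)).
Proof.
rewrite normal_pdfE ?oner_eq0// /normal_fun subr0 expr2 expr1n mulr2n.
by congr (_ * expR _); rewrite -[1 + 1]/(2 : R); field.
Qed.

Lemma stdpdf_gt0 x : 0 < p x.
Proof. by rewrite stdpdfE mulr_gt0 ?expR_gt0// normal_peak_gt0// oner_eq0. Qed.

Lemma stdpdfN x : p (- x) = p x.
Proof. by rewrite !stdpdfE mulrNN. Qed.

Lemma is_derive_stdpdf (x : R) : is_derive x 1 p (- x * p x).
Proof.
have d1 := is_derive1Z (- 2^-1) (is_derive1M (@is_derive_id R R x 1) (@is_derive_id R R x 1)).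
have d2 := @is_derive1_comp R expR (fun t => - 2^-1 * (id t * id t)) x _ _
  (is_derive_expR _) d1.
have d3 := is_derive1Z (normal_peak 1) d2.
have -> : p = (fun t => normal_peak 1 * (expR \o (fun t => - 2^-1 * (id t * id t))) t).
  by apply/funext => t; rewrite stdpdfE /=; congr (_ * expR _); field.
by apply: (is_derive_eq d3) => /=; field.
Qed.

(** Domination by a multiple of the normal density of standard deviation 2: up to the normalizing
    peaks the quotient is [(1 + x^2) exp(- 3 x^2 / 8)], which is at most 4 since
    [exp y >= 1 + y]. *)
Lemma stdpdf_moment2_integrable :
  mu.-integrable setT (EFin \o (fun x => (1 + x ^+ 2) * p x)).
Proof.
pose q := normal_pdf (0 : R) 2.
pose c : R := 4 * normal_peak 1 / normal_peak 2.
have pk1 : 0 < normal_peak 1 :> R by rewrite normal_peak_gt0// oner_eq0.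
have pk2 : 0 < normal_peak 2 :> R by rewrite normal_peak_gt0.
have c0 : 0 < c by rewrite divr_gt0// mulr_gt0.
have qi : mu.-integrable setT (EFin \o (fun x => c * q x)).
  have -> : EFin \o (fun x => c * q x) = (fun x => c%:E * (q x)%:E)%E.
    by apply/funext => x; rewrite /= EFinM.
  by apply: integrableZl => //; exact: integrable_normal_pdf.
apply: (le_integrable measurableT _ _ qi) => /=.
  apply/measurable_EFinP; apply: measurable_funM; last exact: measurable_normal_pdf.
  by apply: measurable_funD => //; exact: measurable_funX.
move=> x _; rewrite lee_fin !ger0_norm; last 2 first.
- by rewrite mulr_ge0 ?(ltW c0)//; exact: normal_pdf_ge0.
- by rewrite mulr_ge0 ?normal_pdf_ge0// addr_ge0// sqr_ge0.
rewrite /q (normal_pdfE 0 (s := 2))// stdpdfE /c /normal_fun subr0.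
have -> : 4 * normal_peak 1 / normal_peak 2 *
    (normal_peak 2 * expR (- x ^+ 2 / (2 ^+ 2 *+ 2))) =
    normal_peak 1 * (4 * expR (- x ^+ 2 / (2 ^+ 2 *+ 2))) :> R.
  by field; rewrite gt_eqF.
rewrite mulrCA ler_wpM2l ?(ltW pk1)//.
have -> : - (x * x / 2) = - x ^+ 2 / (2 ^+ 2 *+ 2) - (3 / 8) * x ^+ 2.
  by rewrite mulr2n; field.
rewrite expRD mulrA [_ * expR (- (_ * _))]mulrC mulrA ler_wpM2r ?expR_ge0//.
rewrite expRN ler_pdivrMl ?expR_gt0//.
have := expR_ge1Dx (3 / 8 * x ^+ 2); have := sqr_ge0 x.
set y := x ^+ 2; set e := expR _; nra.
Qed.

Lemma integrable_stdpdf (k : R -> R) (c : R) : measurable_fun setT k ->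
  (forall x, `|k x| <= c * (1 + x ^+ 2)) ->
  mu.-integrable setT (EFin \o (fun x => k x * p x)).
Proof.
move=> mk kc.
have ci : mu.-integrable setT (EFin \o (fun x => c * ((1 + x ^+ 2) * p x))).
  have -> : EFin \o (fun x => c * ((1 + x ^+ 2) * p x)) =
      (fun x => c%:E * ((1 + x ^+ 2) * p x)%:E)%E.
    by apply/funext => x; rewrite /= EFinM.
  by apply: integrableZl => //; exact: stdpdf_moment2_integrable.
apply: (le_integrable measurableT _ _ ci) => /=.
  by apply/measurable_EFinP; apply: measurable_funM => //; exact: measurable_normal_pdf.
move=> x _; rewrite lee_fin mulrA !normrM ler_wpM2r//.
rewrite (le_trans (kc x))// -normrM ler_norm//.
Qed.

(** The explicit density and the Radon-Nikodym derivative have the same integral over every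
    measurable set, hence agree almost everywhere. *)
Lemma ge0_integral_stdnormal (f : R -> \bar R) :
  measurable_fun setT f -> (forall x, 0 <= f x)%E ->
  (\int[nu]_x f x = \int[mu]_x (f x * (p x)%:E))%E.
Proof.
move=> mf f0.
have dom : nu `<< mu := @normal_prob_dominates R 0 1.
rewrite -(@Radon_Nikodym_SigmaFinite.change_of_variables _ _ _ nu mu dom f setT)//.
apply: ae_eq_integral => //.
- apply: emeasurable_funM => //; apply: (measurable_int mu).
  exact: Radon_Nikodym_SigmaFinite.f_integrable.
- by apply: emeasurable_funM => //; apply/measurable_EFinP; exact: measurable_normal_pdf.
apply: ae_eqe_mul2l; apply: integral_ae_eq => //.
- exact: Radon_Nikodym_SigmaFinite.f_integrable.
- by apply/measurable_EFinP; exact: measurable_normal_pdf.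
- by move=> E _ mE; rewrite -Radon_Nikodym_SigmaFinite.f_integral.
Qed.

Lemma integral_stdnormal (h : R -> R) (c : R) : measurable_fun setT h ->
  (forall x, `|h x| <= c * (1 + x ^+ 2)) ->
  nu.-integrable setT (EFin \o h) /\
  \int[nu]_x h x = \int[mu]_x (h x * p x).
Proof.
move=> mh hc; have mh' := (measurable_EFinP _ _).2 mh.
have hi := integrable_stdpdf mh hc.
split.
  apply/integrableP; split => //.
  rewrite (@ge0_integral_stdnormal (fun x => `|(EFin \o h) x|%E))//; last first.
    exact: measurableT_comp.
  case/integrableP : hi => _; congr (_ < _)%E; apply: eq_integral => x _ /=.
  by rewrite normrM (ger0_norm (normal_pdf_ge0 _ _ _)) EFinM.
congr fine; rewrite [LHS]integralE [RHS]integralE.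
rewrite (ge0_integral_stdnormal (measurable_funepos mh') (funepos_ge0 _)).
rewrite (ge0_integral_stdnormal (measurable_funeneg mh') (funeneg_ge0 _)).
have pp x : (0 <= (p x)%:E)%E by rewrite lee_fin normal_pdf_ge0.
congr (_ - _)%E; apply: eq_integral => x _; rewrite !unlock /=.
  by rewrite EFinM maxe_pMl ?mul0e.
by rewrite -mulNr EFinM maxe_pMl ?mul0e.
Qed.

End gaussian.

Lemma mean_value_bound {R : realType} (f f' : R -> R) (B : R) :
  (forall t : R, is_derive t 1 f (f' t)) -> (forall t, `|f' t| <= B) ->
  forall a b, `|f b - f a| <= B * `|b - a|.
Proof.
move=> df fB; have main a b : a <= b -> `|f b - f a| <= B * `|b - a|.
  move=> ab; have [|c _ ->] := @MVT_segment R f f' a b ab (fun t _ => df t).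
    by apply: continuous_subspaceT => t; exact: is_derive_continuous (df t).
  by rewrite normrM ler_wpM2r.
move=> a b; have [/main//|/ltW ba] := leP a b.
by rewrite distrC [X in _ * X]distrC main.
Qed.

(** * Construction and bounds of the Stein solution *)

Section stein_equation.
Context {R : realType}.
Local Notation mu := (@lebesgue_measure R).
Local Notation p := (normal_pdf (0 : R) 1).
Local Notation nu := (normal_prob (0 : R) 1).

Lemma stdpdf_decay (t : R) : 0 < t -> `|p t| <= normal_peak 1 / t.
Proof.
move=> t0; rewrite gtr0_norm ?stdpdf_gt0// stdpdfE ler_wpM2l ?normal_peak_ge0//.
rewrite expRN lef_pV2 ?posrE ?expR_gt0//.
apply: le_trans (expR_ge1Dx _); have := sqr_ge0 (t - 1); rewrite sqrrB expr2; lra.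
Qed.

(** Divided by the density [p], this solves [g' - x g = k]. *)
Definition cumul (k : R -> R) (x : R) : R := \int[mu]_(t in `]-oo, x]) (k t * p t).

Section linear_growth.
Variables (k : R -> R) (c : R).
Hypotheses (kcont : continuous k) (c0 : 0 <= c) (kc : forall x, `|k x| <= c + `|x|).

Let mk : measurable_fun setT k.
Proof. exact: continuous_measurable_fun. Qed.

Let kp_integrable : mu.-integrable setT (EFin \o (fun x => k x * p x)).
Proof.
apply: (integrable_stdpdf (c := c + 1)) => // x; apply: le_trans (kc x) _.
have := sqr_ge0 (`|x| - 1); rewrite sqrrB real_normK ?num_real// => h.
have : 0 <= c * x ^+ 2 by rewrite mulr_ge0// sqr_ge0.
have := sqr_ge0 x; lra.
Qed.

Lemma is_derive_cumul (x : R) : is_derive x 1 (cumul k) (k x * p x).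
Proof.
have x1 : x < x + 1 by rewrite ltrDl.
have i1 : mu.-integrable [set` Interval (BInfty _ true) (BRight (x + 1))]
    (EFin \o (fun t => k t * p t)).
  exact: (integrableS measurableT _ (subsetT _) kp_integrable).
have cc : {for x, continuous (fun t => k t * p t)}.
  by apply: continuousM; [exact: kcont|exact: (is_derive_continuous (is_derive_stdpdf x))].
have [d1 d2] := continuous_FTC1 x1 i1 (ltNyr _) cc.
have d1' : derivable (cumul k) x 1 := d1.
have d2' : derive1 (cumul k) x = k x * p x := d2.
by apply: (DeriveDef d1'); rewrite -derive1E d2'.
Qed.

Lemma cumul_tail (x : R) :
  \int[mu]_(t in `]x, +oo[) (k t * p t) = \int[mu]_t (k t * p t) - cumul k x.
Proof.
have -> : [set: R] = `]-oo, x]%classic `|` `]x, +oo[%classic.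
  by rewrite -itv_bndbnd_setU// -set_itvNyy.
rewrite Rintegral_setU//.
- by rewrite addrAC subrr add0r.
- by apply: (integrableS measurableT _ (subsetT _) kp_integrable); exact: measurableU.
apply/disj_set2P; rewrite -subset0 => z [] /=; rewrite !in_itv /= andbT => h1 h2.
by move: (lt_le_trans h2 h1); rewrite ltxx.
Qed.

Lemma tail_mass_bound (D : set R) (G : R -> R) : measurable D ->
  measurable_fun setT G -> (forall x, 0 <= G x <= (c + 1) * (1 + x ^+ 2)) ->
  (forall x, D x -> `|k x| <= G x) ->
  `|\int[mu]_(t in D) (k t * p t)| <= \int[mu]_t (G t * p t).
Proof.
move=> mD mG Gc kG.
have Gi : mu.-integrable setT (EFin \o (fun x => G x * p x)).
  apply: (integrable_stdpdf (c := c + 1)) => // x.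
  by have /andP[g0 g1] := Gc x; rewrite ger0_norm.
rewrite Rintegral_mkcond.
have iD : mu.-integrable setT (EFin \o ((fun t => k t * p t) \_ D)).
  rewrite -restrict_EFin; apply/integrable_restrict => //; rewrite setTI.
  exact: (integrableS measurableT _ (subsetT _) kp_integrable).
apply: le_trans (le_normr_Rintegral _ iD) _ => //.
apply: le_Rintegral => //; first by have := integrable_abse iD.
move=> x _; rewrite patchE; case: ifPn => [|_].
  rewrite inE => Dx; rewrite normrM ler_pM// ?kG// ger0_norm//; exact: normal_pdf_ge0.
by rewrite normr0 mulr_ge0// ?normal_pdf_ge0//; case/andP: (Gc x).
Qed.

(** Markov's inequality: on [D], [y |k t| <= |t| (c + |t|) <= (c + 1) (1 + t^2)]. It supplies the
    decay in [1 / x] required by the barrier lemmas. *)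
Lemma tail_markov (D : set R) (y : R) : measurable D -> 0 < y ->
  (forall x, D x -> y <= `|x|) ->
  `|\int[mu]_(t in D) (k t * p t)| <= (\int[mu]_t ((c + 1) * (1 + t ^+ 2) * p t)) / y.
Proof.
move=> mD y0 Dy.
rewrite ler_pdivlMr// mulrC -{1}(gtr0_norm y0) -normrM.
rewrite -RintegralZl//; last exact: (integrableS measurableT _ (subsetT _) kp_integrable).
rewrite Rintegral_mkcond.
have iD : mu.-integrable setT (EFin \o ((fun t => y * (k t * p t)) \_ D)).
  rewrite -restrict_EFin; apply/integrable_restrict => //; rewrite setTI.
  rewrite (_ : EFin \o _ = (fun t => y%:E * (k t * p t)%:E)%E); last first.
    by apply/funext => t; rewrite /= EFinM.
  apply: integrableZl => //.
  exact: (integrableS measurableT _ (subsetT _) kp_integrable).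
have Gi : mu.-integrable setT (EFin \o (fun x => (c + 1) * (1 + x ^+ 2) * p x)).
  apply: (integrable_stdpdf (c := c + 1)).
    by apply: measurable_funM => //; apply: measurable_funD => //; exact: measurable_funX.
  by move=> x; rewrite ger0_norm// mulr_ge0 ?addr_ge0 ?sqr_ge0.
apply: le_trans (le_normr_Rintegral _ iD) _ => //.
apply: le_Rintegral => //; first by have := integrable_abse iD.
have pp x : 0 <= p x by exact: normal_pdf_ge0.
move=> x _; rewrite patchE; case: ifPn => [|_]; last first.
  by rewrite normr0 !mulr_ge0 ?addr_ge0 ?sqr_ge0.
rewrite inE => Dx; rewrite mulrA normrM (ger0_norm (pp x)) ler_wpM2r//.
rewrite normrM (gtr0_norm y0).
apply: (@le_trans _ _ (`|x| * (c + `|x|))); first by apply: ler_pM; [exact: ltW|by []|exact: Dy|exact: kc].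
have := sqr_ge0 (`|x| - 1); rewrite sqrrB mulrDr -expr2 real_normK ?num_real//.
have : 0 <= c * (1 + x ^+ 2 - `|x|).
  rewrite mulr_ge0// -[x ^+ 2]real_normK ?num_real//.
  by have := sqr_ge0 (`|x| - 1); rewrite sqrrB; have := normr_ge0 x; lra.
have := normr_ge0 x; have := sqr_ge0 x; lra.
Qed.

End linear_growth.

(** The upper Gaussian tail itself, not its ratio to the density. Writing it through [cumul] of the
    constant 1 provides its derivative and its decay. *)
Definition mills (x : R) : R := \int[mu]_t (1 * p t) - cumul (cst 1) x.

Lemma is_derive_mills (x : R) : is_derive x 1 mills (- p x).
Proof.
have c1 : continuous (cst 1 : R -> R) by move=> z; exact: cvg_cst.
have k1 (z : R) : `|cst (1 : R) z| <= 1 + `|z| by rewrite normr1 lerDl.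
have h := is_derive1D (is_derive_cst (\int[mu]_t (1 * p t)) x 1)
  (is_derive1Z (-1) (is_derive_cumul c1 ler01 k1 x)).
have -> : mills = (fun t => cst (\int[mu]_t (1 * p t)) t + -1 * cumul (cst 1) t).
  by apply/funext => t; rewrite /mills mulN1r.
by apply: (is_derive_eq h); rewrite /=; ring.
Qed.

Lemma mills_decay : exists M : R, forall x : R, 0 < x -> `|mills x| <= M / x.
Proof.
have c1 : continuous (cst 1 : R -> R) by move=> z; exact: cvg_cst.
have k1 (z : R) : `|cst (1 : R) z| <= 1 + `|z| by rewrite normr1 lerDl.
exists (\int[mu]_t ((1 + 1) * (1 + t ^+ 2) * p t)) => x x0.
rewrite /mills -(cumul_tail c1 ler01 k1).
apply: (tail_markov c1 ler01 k1) => // z /=; rewrite in_itv /= andbT => xz.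
by rewrite gtr0_norm ?(lt_trans x0)// ltW.
Qed.

Lemma lipschitz1P (h : R -> R) : 1.-lipschitz h ->
  forall s t, `|h s - h t| <= `|s - t|.
Proof. by move=> hl s t; have := hl (s, t) (conj I I); rewrite /= mul1r. Qed.

Lemma lipschitz1_continuous (h : R -> R) :
  (forall s t, `|h s - h t| <= `|s - t|) -> continuous h.
Proof.
move=> hl x; apply/cvgrPdist_le => /= e e0; near=> t.
apply: le_trans (hl _ _) _; rewrite distrC.
by near: t; apply/nbhs_ballP; exists e => //= t; rewrite /ball /= distrC => /ltW.
Unshelve. all: by end_near. Qed.

(** The solution is [u / p] with [u = cumul k] and [k] the centred [h]. The constant does not depend
    on [h], because [k] is 1-Lipschitz and bounded by the absolute normal moment plus [|x|]. Tail
    bounds serve for [|x| >= 1], the left one by reflection, and a crude bound serves on the middle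
    interval. *)
Theorem stein_solution : exists C : R, forall h : R -> R, 1.-lipschitz h ->
  [/\ measurable_fun setT h, nu.-integrable setT (EFin \o h) &
   exists g g' : R -> R,
  [/\ measurable_fun setT g, measurable_fun setT g',
      (forall x, `|g x| <= C) /\ (forall x, `|g' x| <= C),
      forall a b, `|g b - g a - g' a * (b - a)| <= C * (b - a) ^+ 2 &
      forall x, g' x - x * g x = h x - \int[nu]_z h z]].
Proof.
have mnorm : measurable_fun setT (fun x : R => `|x|) by exact: measurableT_comp.
have norm2 (x : R) : `|(`|x|)| <= 1 * (1 + x ^+ 2).
  rewrite normr_id mul1r -[x ^+ 2]real_normK ?num_real//.
  by have := sqr_ge0 (`|x| - 1); rewrite sqrrB; have := normr_ge0 x; lra.
have [inorm _] := integral_stdnormal mnorm norm2.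
pose c : R := \int[nu]_x `|x|.
have c0 : 0 <= c by exact: Rintegral_ge0.
have [Mm mM] := mills_decay.
pose Mk : R := \int[mu]_t ((c + 1) * (1 + t ^+ 2) * p t).
(* Bounds [u / p] on [[-1, 1]], where the density is at least [p 1]. *)
pose G0 : R := Mk / p 1.
have Mk0 : 0 <= Mk.
  by apply: Rintegral_ge0 => x _; rewrite !mulr_ge0 ?addr_ge0 ?sqr_ge0 ?normal_pdf_ge0.
have G00 : 0 <= G0 by rewrite divr_ge0// normal_pdf_ge0.
pose C1 := c + 3 + G0.
exists (2 * C1 + 1) => h /lipschitz1P hl.
have hcont := lipschitz1_continuous hl.
have mh : measurable_fun setT h by exact: continuous_measurable_fun.
have hb x : `|h x| <= `|h 0| + `|x|.
  rewrite -[h x](subrK (h 0)) addrC; apply: le_trans (ler_normD _ _) _.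
  by rewrite lerD2l (le_trans (hl _ _))// subr0.
have hb2 x : `|h x| <= (`|h 0| + 1) * (1 + x ^+ 2).
  apply: le_trans (hb x) _; have := norm2 x; rewrite normr_id mul1r.
  by have := mulr_ge0 (normr_ge0 (h 0)) (sqr_ge0 x); lra.
have [ih _] := integral_stdnormal mh hb2.
split => //.
set Nh := \int[nu]_z h z.
pose k x := h x - Nh.
have kl s t : `|k s - k t| <= `|s - t|.
  by rewrite /k opprB addrA subrK; exact: hl.
have kcont : continuous k := lipschitz1_continuous kl.
have mk : measurable_fun setT k by exact: continuous_measurable_fun.
(* Writing [k x] as the normal average of [h x - h z] makes [h 0] disappear, which is where
   uniformity in [h] is gained. *)
have kc x : `|k x| <= c + `|x|.
  have -> : k x = \int[nu]_z (h x - h z).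
    rewrite RintegralB//; last exact: (mom_integrable (mom_cst nu 1 (h x))).
    by rewrite Rintegral_cst// (_ : fine (nu setT) = 1) ?mulr1// probability_setT.
  have -> : c + `|x| = \int[nu]_z (`|z| + `|x|).
    rewrite RintegralD//; last exact: (mom_integrable (mom_cst nu 1 `|x|)).
    by rewrite Rintegral_cst// (_ : fine (nu setT) = 1) ?mulr1// probability_setT.
  have m1 : mom nu 1 h by exact: integrable_mom.
  have m2 : mom nu 1 (fun z => `|z|) by exact: integrable_mom.
  apply: norm_Rintegral_le.
  - by apply: momB => //; exact: mom_cst.
  - by apply: momD => //; exact: mom_cst.
  - by move=> z; rewrite (le_trans (hl _ _))// [leRHS]addrC ler_normB.
have kc2 x : `|k x| <= (c + 1) * (1 + x ^+ 2).
  apply: le_trans (kc x) _; have := norm2 x; rewrite normr_id mul1r.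
  by have := mulr_ge0 c0 (sqr_ge0 x); lra.
(* Centring makes [u] vanish at plus infinity as well: [u x] is minus the integral of [k p] beyond
   [x]. *)
have k0 : \int[mu]_t (k t * p t) = 0.
  have [_ <-] := integral_stdnormal mk kc2.
  rewrite RintegralB//; last exact: (mom_integrable (mom_cst nu 1 Nh)).
  by rewrite Rintegral_cst// (_ : fine (nu setT) = 1) ?mulr1 ?subrr// probability_setT.
pose u := cumul k.
have du (t : R) : is_derive t 1 u (k t * p t) by exact: (is_derive_cumul kcont c0 kc).
have uR (x : R) : 0 < x -> `|u x| <= Mk / x.
  move=> x0; have := cumul_tail kcont c0 kc x; rewrite k0 sub0r => e.
  rewrite -[u x]opprK -[- u x]e normrN.
  apply: (tail_markov kcont c0 kc) => // z /=; rewrite in_itv /= andbT => xz.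
  by rewrite gtr0_norm ?(lt_trans x0)// ltW.
have uL (x : R) : 0 < x -> `|- u (- x)| <= Mk / x.
  move=> x0; rewrite normrN.
  apply: (tail_markov kcont c0 kc) => // z /=; rewrite in_itv /= => xz.
  by rewrite ler0_norm; lra.
have dmid (x : R) : `|u x| <= Mk.
  apply: (@tail_mass_bound k c kcont c0 kc `]-oo, x]%classic (fun x => (c + 1) * (1 + x ^+ 2))) => //.
    by apply: measurable_funM => //; apply: measurable_funD => //; exact: measurable_funX.
  by move=> z; rewrite lexx andbT mulr_ge0 ?addr_ge0 ?sqr_ge0.
have p0 (t : R) : 0 < p t by exact: stdpdf_gt0.
have bR := right_bounds p0 is_derive_stdpdf stdpdf_decay is_derive_mills mM c0 kl kc du uR.
(* The reflected functions [k (- t)] and [- u (- t)] satisfy the same hypotheses, since [p] is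
   even. *)
have klN s t : `|k (- s) - k (- t)| <= `|s - t|.
  by rewrite (le_trans (kl _ _))// -opprD normrN.
have kcN t : `|k (- t)| <= c + `|t| by rewrite -[X in _ <= _ + X]normrN.
have duN (t : R) : is_derive t 1 (fun t => - u (- t)) (k (- t) * p t).
  have d1 := @is_derive1_comp R u (fun t => -1 * id t) t _ _ (du _) (is_derive1Z (-1) (@is_derive_id R R t 1)).
  have d2 := is_derive1Z (-1) d1.
  have -> : (fun t => - u (- t)) = (fun t => -1 * (u \o (fun t => -1 * id t)) t).
    by apply/funext => s /=; rewrite !mulN1r.
  by apply: (is_derive_eq d2) => /=; rewrite !mulN1r stdpdfN; ring.
have bL := right_bounds p0 is_derive_stdpdf stdpdf_decay is_derive_mills mM c0 klN kcN duN uL.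
pose g x := u x / p x; pose g' x := x * g x + k x.
have gE x : `|g x| = `|u x| / p x by rewrite normrM normfV (gtr0_norm (p0 x)).
have g'E x : g' x = (x * u x + k x * p x) / p x.
  by rewrite /g' /g; field; rewrite gt_eqF.
have gall x : [/\ `|g x| <= C1, `|g' x| <= C1 & `|x * g' x| <= C1].
  have [x1|x1] := leP 1 `|x|.
    have : [/\ `|u x| <= (c + 3) * p x, `|x * u x + k x * p x| <= (c + 2) * p x
        & `|x * (x * u x + k x * p x)| <= (c + 2) * p x].
      have [x0|x0] := leP 0 x; first by apply: bR; rewrite ger0_norm in x1.
      have := bL (- x); rewrite ltr0_norm// in x1; move=> /(_ x1).
      rewrite !opprK stdpdfN normrN => -[a b' d]; split => //.
        by rewrite mulrNN in b'.
      by move: d; rewrite mulrNN mulNr normrN.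
    move=> [a b d]; rewrite g'E gE mulrA !normrM normfV (gtr0_norm (p0 x)) -!normrM !ler_pdivrMr//.
    split; [apply: le_trans a _|apply: le_trans b _|apply: le_trans d _];
      rewrite ler_pM2r// /C1; lra.
  have g1 : `|g x| <= G0.
    rewrite gE ler_pM ?invr_ge0 ?(ltW (p0 _))// lef_pV2 ?posrE//.
    rewrite !stdpdfE ler_wpM2l ?normal_peak_ge0// ler_expR lerN2 mulr1.
    rewrite ler_pM2r ?invr_gt0// -expr2 -real_normK ?num_real//.
    by rewrite expr_le1// ltW.
  have g2 : `|g' x| <= G0 + (c + 1).
    apply: le_trans (ler_normD _ _) _; apply: lerD.
      by rewrite normrM -[leRHS]mul1r ler_pM// ltW.
    by apply: le_trans (kc x) _; rewrite lerD2l ltW.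
  split; rewrite /C1; [lra|lra|].
  rewrite normrM; apply: (@le_trans _ _ (1 * (G0 + (c + 1)))); last lra.
  by rewrite ler_pM// ltW.
have dg (x : R) : is_derive x 1 g (g' x).
  have d := is_derive1M (du x) (is_derive1V (lt0r_neq0 (p0 x)) (is_derive_stdpdf x)).
  apply: (is_derive_eq d); rewrite /g' /g.
  by have := p0 x => px; field; rewrite gt_eqF.
have dxg (x : R) : is_derive x 1 (fun t => id t * g t) (x * g' x + g x * 1).
  exact: (is_derive1M (@is_derive_id R R x 1) (dg x)).
have gcont : continuous g by move=> x; exact: is_derive_continuous (dg x).
(* By the Stein equation [g' = x g + k]. The derivative [x g' + g] of the first term is at most
   [2 C1], and [k] contributes 1. *)
have g'l a b : `|g' b - g' a| <= (2 * C1 + 1) * `|b - a|.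
  have -> : g' b - g' a = (b * g b - a * g a) + (k b - k a) by rewrite /g'; ring.
  apply: le_trans (ler_normD _ _) _; rewrite mulrDl mul1r lerD//.
  apply: (mean_value_bound dxg) => t; rewrite mulr1.
  have [t1 _ t3] := gall t; apply: le_trans (ler_normD _ _) _; lra.
have C10 : 0 <= C1 by rewrite /C1; lra.
exists g, g'; split.
- exact: continuous_measurable_fun.
- by apply: measurable_funD => //; apply: measurable_funM => //; exact: continuous_measurable_fun.
- by split=> x; have [a b _] := gall x; lra.
- move=> a b.
  (* The derivative is taken at an arbitrary point [e] of the interval, so that one statement covers
     both orders of [a] and [b]. *)
  have main (a' b' : R) : a' <= b' -> forall e, a' <= e <= b' ->
      `|g b' - g a' - g' e * (b' - a')| <= (2 * C1 + 1) * (b' - a') ^+ 2.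
    move=> ab e /andP[ae eb].
    have [|d] := @MVT_segment R g g' a' b' ab (fun t _ => dg t).
      exact: continuous_subspaceT.
    rewrite in_itv /= => /andP[d1 d2] ->.
    rewrite -mulrBl normrM -real_normK ?num_real// expr2 mulrA ler_wpM2r//.
    apply: le_trans (g'l _ _) _; rewrite ler_wpM2l ?addr_ge0 ?mulr_ge0//.
    by rewrite [leRHS]ger0_norm ?subr_ge0// ler_norml; apply/andP; split; lra.
  have [ab|/ltW ba] := leP a b; first by apply: main; rewrite ?lexx.
  have := main b a ba a; rewrite ba lexx => /(_ isT).
  rewrite -normrN -[(b - a) ^+ 2]sqrrN opprB.
  by congr (`|_| <= _); ring.
- by move=> x; rewrite /g' /k; ring.
Qed.

End stein_equation.

(** * Cones *)

Section cones.
Context {R : realType} {d : nat}.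
Implicit Types x y u v w : d.-tuple R.

Definition axpy (a : R) u x : d.-tuple R := [tuple tnth x i - a * tnth u i | i < d].

Lemma dotvC x y : dotv x y = dotv y x.
Proof. by apply: eq_bigr => i _; rewrite mulrC. Qed.

Lemma dotv_ge0 x : 0 <= dotv x x.
Proof. by apply: sumr_ge0 => i _; rewrite -expr2 sqr_ge0. Qed.

Lemma dotv_axpy a b u w x y :
  dotv (axpy a u x) (axpy b w y) =
  dotv x y - b * dotv x w - a * dotv u y + a * b * dotv u w.
Proof.
rewrite /dotv !mulr_sumr -!sumrB -big_split /=.
by apply: eq_bigr => i _; rewrite !tnth_mktuple; ring.
Qed.

Lemma dotv_eq0 x : dotv x x = 0 -> forall i, tnth x i = 0.
Proof.
move=> h i; have h0 (j : 'I_d) : true -> 0 <= tnth x j * tnth x j.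
  by move=> _; rewrite -expr2 sqr_ge0.
have := psumr_eq0P h0 h; move=> /(_ i isT)/eqP.
by rewrite mulf_eq0 orbb => /eqP.
Qed.

Lemma dotv_cauchy x y : dotv x y ^+ 2 <= dotv x x * dotv y y.
Proof.
have [x0|xn0] := eqVneq (dotv x x) 0.
  rewrite x0 mul0r /dotv big1 ?expr2 ?mul0r// => i _.
  by rewrite (dotv_eq0 x0) mul0r.
have xp : 0 < dotv x x by rewrite lt_neqAle eq_sym xn0 dotv_ge0.
pose t := dotv x y / dotv x x.
have := dotv_ge0 (axpy t x y); rewrite dotv_axpy (dotvC y x).
have -> : dotv y y - t * dotv x y - t * dotv x y + t * t * dotv x x =
  dotv y y - dotv x y ^+ 2 / dotv x x by rewrite /t; field.
by rewrite subr_ge0 ler_pdivrMr// mulrC.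
Qed.

Lemma euclid_norm_ge0 x : 0 <= euclid_norm x.
Proof. exact: sqrtr_ge0. Qed.

Lemma sqr_euclid_norm x : euclid_norm x ^+ 2 = dotv x x.
Proof. by rewrite sqr_sqrtr// dotv_ge0. Qed.

(** The triple angle formula at [pi / 2 = 3 (pi / 6)] gives [c (4 c^2 - 3) = 0] with [c]
    positive. *)
Lemma cos_pi6_sqr : cos (pi / 6 : R) ^+ 2 = 3 / 4.
Proof.
have p0 := pi_gt0 R.
have c0 : 0 < cos (pi / 6 : R) by apply: cos_gt0_pihalf; apply/andP; split; lra.
have e : pi / 2 = (pi / 6) *+ 2 + pi / 6 :> R by rewrite mulr2n; field.
have := @cos_pihalf R; rewrite e cosD cos_mulr2n sin_mulr2n.
have := cos2Dsin2 (pi / 6 : R).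
move: c0; set c := cos _; set s := sin _; move=> c0 cs h.
have s2 : s ^+ 2 = 1 - c ^+ 2 by rewrite -cs addrAC subrr add0r.
have : c * (4 * c ^+ 2 - 3) = 0.
  rewrite -h mulr2n [X in _ = _ - X](_ : _ = 2 * c * s ^+ 2); last by rewrite mulr2n; ring.
  by rewrite s2; ring.
by move/eqP; rewrite mulf_eq0 gt_eqF//= => /eqP h'; lra.
Qed.

Lemma cos_pi6_gt0 : 0 < cos (pi / 6 : R).
Proof. by have p0 := pi_gt0 R; apply: cos_gt0_pihalf; apply/andP; split; lra. Qed.

(** Two vectors within 30 degrees of the axis are within 60 degrees of each other. Their components
    along [u] contribute at least [3/4] of the product of the norms, and by Cauchy-Schwarz the
    orthogonal components take away at most [1/4]. *)
Lemma cone60_dot u v w : euclid_norm u = 1 -> cone60 u v -> cone60 u w ->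
  euclid_norm v * euclid_norm w <= 2 * dotv v w.
Proof.
rewrite /cone60 /= => u1; rewrite u1 !mul1r.
have uu : dotv u u = 1 by rewrite -sqr_euclid_norm u1 expr1n.
have c2 := cos_pi6_sqr; have c0 := cos_pi6_gt0.
have V0 := euclid_norm_ge0 v; have W0 := euclid_norm_ge0 w.
have VV := sqr_euclid_norm v; have WW := sqr_euclid_norm w.
set c := cos _ in c2 c0 *; set V := euclid_norm v in V0 VV *.
set W := euclid_norm w in W0 WW *; set a := dotv u v; set b := dotv u w => ha hb.
have CS := dotv_cauchy (axpy a u v) (axpy b u w).
rewrite !dotv_axpy uu (dotvC v u) (dotvC w u) -/a -/b -VV -WW in CS.
have a2 : 3 / 4 * V ^+ 2 <= a ^+ 2.
  by rewrite -c2 -exprMn lerXn2r ?nnegrE ?mulr_ge0 ?(ltW c0)// (le_trans _ ha)// mulr_ge0// ltW.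
have b2 : 3 / 4 * W ^+ 2 <= b ^+ 2.
  by rewrite -c2 -exprMn lerXn2r ?nnegrE ?mulr_ge0 ?(ltW c0)// (le_trans _ hb)// mulr_ge0// ltW.
have ab : 3 / 4 * (V * W) <= a * b.
  rewrite -c2 (_ : c ^+ 2 * (V * W) = (c * V) * (c * W)); last by ring.
  by rewrite ler_pM// mulr_ge0// ltW.
have CS2 : (dotv v w - a * b) ^+ 2 <= (V * W / 4) ^+ 2.
  have -> : dotv v w - a * b = dotv v w - b * a - a * b + a * b * 1 by ring.
  apply: le_trans CS _.
  have -> : (V * W / 4) ^+ 2 = (V ^+ 2 / 4) * (W ^+ 2 / 4) by field.
  apply: ler_pM.
  - have := dotv_ge0 (axpy a u v); rewrite dotv_axpy uu (dotvC v u) -/a -VV; lra.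
  - have := dotv_ge0 (axpy b u w); rewrite dotv_axpy uu (dotvC w u) -/b -WW; lra.
  - by move: a2; rewrite !expr2; lra.
  - by move: b2; rewrite !expr2; lra.
have : `|dotv v w - a * b| <= V * W / 4.
  rewrite -(ler_pXn2r (n := 2))// ?nnegrE// ?divr_ge0 ?mulr_ge0//.
  by rewrite real_normK ?num_real.
rewrite ler_norml => /andP[h _]; lra.
Qed.

Definition subv x y : d.-tuple R := [tuple tnth x i - tnth y i | i < d].

Lemma subv_axpy x y : subv x y = axpy 1 y x.
Proof. by apply: eq_from_tnth => i; rewrite !tnth_mktuple mul1r. Qed.

Lemma euclid_distE x y : euclid_dist x y = euclid_norm (subv x y).
Proof. by []. Qed.

Lemma euclid_dist_sqr x y :
  euclid_dist x y ^+ 2 = dotv x x - 2 * dotv x y + dotv y y.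
Proof.
by rewrite euclid_distE sqr_euclid_norm subv_axpy dotv_axpy (dotvC y x); ring.
Qed.

Lemma euclid_dist_ge0 x y : 0 <= euclid_dist x y.
Proof. exact: euclid_norm_ge0. Qed.

(* In a triangle with an angle of at most 60 degrees, the opposite side is
   shorter than the longest adjacent side, unless the triangle is equilateral. *)
Lemma cone60_closer u z x y : euclid_norm u = 1 ->
  cone60 u (subv x z) -> cone60 u (subv y z) ->
  0 < euclid_dist y z -> euclid_dist y z <= euclid_dist x z ->
  ~ (euclid_dist x y = euclid_dist x z /\ euclid_dist y z = euclid_dist x z) ->
  euclid_dist x y < euclid_dist x z.
Proof.
move=> u1 cx cy y0 yx neq.
have := cone60_dot u1 cx cy; rewrite -!euclid_distE.
have : dotv (subv x z) (subv y z) = (euclid_dist x z ^+ 2 + euclid_dist y z ^+ 2 - euclid_dist x y ^+ 2) / 2.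
  by rewrite !euclid_dist_sqr !subv_axpy dotv_axpy (dotvC z y); field.
move=> ->.
have d0 := euclid_dist_ge0 x y.
move: neq y0 yx d0; set V := euclid_dist x z; set W := euclid_dist y z; set D := euclid_dist x y.
move=> neq y0 yx d0 h.
(* The law of cosines gives [D^2 <= V^2 - W (V - W)]; equality of [D] and [V] then forces [V = W],
   the excluded equilateral case. *)
have DV : D ^+ 2 <= V ^+ 2 by nra.
have DV' : D <= V.
  by rewrite -(ler_pXn2r (n := 2))// nnegrE//; lra.
rewrite lt_neqAle DV' andbT; apply/eqP => e; apply: neq; split => //.
have : W * (V - W) <= 0 by rewrite e in h; lra.
rewrite pmulr_rle0// subr_le0 => VW.
by apply/eqP; rewrite eq_le yx VW.
Qed.

End cones.

Section cover.
Context {R : realType}.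

(** The axes are the normalized points of a grid of mesh [1 / N] in the cube [[-1, 1]^d]. With
    [N = 2 d], rounding a unit vector moves it by at most [1/2 = sin (pi / 6)], which keeps the
    angle within 30 degrees. *)
Lemma cone60_cover_exists (d : nat) : (0 < d)%N -> exists m, cone60_cover R d m.
Proof.
move=> d0; pose N := (2 * d)%N.
have N0 : (0 < N)%N by rewrite muln_gt0.
have NR0 : 0 < N%:R :> R by rewrite ltr0n.
pose I := {ffun 'I_d -> 'I_(2 * N).+1}.
pose pt (g : I) : d.-tuple R := [tuple (g i)%:R / N%:R - 1 | i < d].
(* Fallback axis for the zero grid point, which cannot be normalized. *)
pose e0 : d.-tuple R := [tuple (i == Ordinal d0)%:R | i < d].
have e01 : euclid_norm e0 = 1.
  rewrite /euclid_norm /dotv (bigD1 (Ordinal d0))//= big1 => [|i ii].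
    by rewrite !tnth_mktuple eqxx mulr1 addr0 sqrtr1.
  by rewrite !tnth_mktuple (negbTE ii) mulr0.
pose nrm (g : I) : d.-tuple R :=
  if euclid_norm (pt g) == 0 then e0 else [tuple (euclid_norm (pt g))^-1 * tnth (pt g) i | i < d].
have nrmE g y : euclid_norm (pt g) != 0 -> dotv (nrm g) y = (euclid_norm (pt g))^-1 * dotv (pt g) y.
  move=> g0; rewrite /nrm (negbTE g0) /dotv mulr_sumr; apply: eq_bigr => i _.
  by rewrite tnth_mktuple mulrA.
have nrm1 g : euclid_norm (nrm g) = 1.
  have [g0|g0] := eqVneq (euclid_norm (pt g)) 0; first by rewrite /nrm g0 eqxx.
  rewrite /euclid_norm nrmE// dotvC nrmE// -sqr_euclid_norm.
  by rewrite expr2 mulKf// mulVf// sqrtr1.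
exists #|I|, (fun i => nrm (enum_val i)); split => //.
apply/seteqP; split => // x _.
set X := euclid_norm x.
have [X0|Xn0] := eqVneq X 0.
  exists (enum_rank ([ffun=> ord0] : I)) => //.
  rewrite /cone60 /= nrm1 -/X X0 !mulr0 /dotv big1// => i _.
  by rewrite [tnth x i](dotv_eq0 _) ?mulr0// -sqr_euclid_norm -/X X0 expr2 mulr0.
have Xp : 0 < X by rewrite lt_neqAle eq_sym Xn0 sqrtr_ge0.
pose z i := tnth x i / X.
have zz : \sum_(i < d) z i ^+ 2 = 1.
  transitivity (dotv x x / X ^+ 2).
    by rewrite /dotv mulr_suml; apply: eq_bigr => i _; rewrite /z; field.
  by rewrite -sqr_euclid_norm -/X divff// expf_neq0.
have z1 i : -1 <= z i <= 1.
  rewrite -ler_norml -(expr_le1 (n := 2))// real_normK ?num_real// -zz (bigD1 i)//=.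
  by rewrite lerDl; apply: sumr_ge0 => j _; rewrite sqr_ge0.
pose fl i : nat := Num.truncn ((z i + 1) * N%:R).
have fl0 i : 0 <= (z i + 1) * N%:R by have /andP[a _] := z1 i; rewrite mulr_ge0//; lra.
have fl1 i : (fl i < (2 * N).+1)%N.
  rewrite ltnS -(ler_nat R); apply: (@le_trans _ _ ((z i + 1) * N%:R)).
    by rewrite truncn_le.
  rewrite natrM ler_wpM2r//; have /andP[_ a] := z1 i; lra.
pose g : I := [ffun i => Ordinal (fl1 i)].
have close i : (z i - tnth (pt g) i) ^+ 2 <= (N%:R ^-1) ^+ 2.
  rewrite tnth_mktuple ffunE /=.
  have /andP[h1 h2] := truncn_itv (fl0 i); rewrite -/(fl i) in h1 h2.
  have -> : z i - ((fl i)%:R / N%:R - 1) = ((z i + 1) * N%:R - (fl i)%:R) / N%:R.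
    by field; rewrite gt_eqF.
  rewrite exprMn ler_piMl ?exprn_ge0 ?invr_ge0//.
  by rewrite expr_le1// ?subr_ge0//; move: h2; rewrite -natr1; lra.
have sumclose : \sum_(i < d) (z i - tnth (pt g) i) ^+ 2 <= 1 / 4.
  apply: (@le_trans _ _ (\sum_(i < d) (N%:R ^-1 : R) ^+ 2)); first exact: ler_sum.
  rewrite sumr_const card_ord -(mulr_natl _ d) exprVn ler_pdivrMr ?exprn_gt0//.
  rewrite /N natrM.
  have d1 : 1 <= d%:R :> R by rewrite ler1n.
  nra.
set Y := euclid_norm (pt g).
have Y2 : Y ^+ 2 = \sum_(i < d) tnth (pt g) i ^+ 2.
  by rewrite sqr_euclid_norm; apply: eq_bigr => i _; rewrite expr2.
pose zy := \sum_(i < d) z i * tnth (pt g) i.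
have key : 1 - 2 * zy + Y ^+ 2 <= 1 / 4.
  have <- : \sum_(i < d) (z i - tnth (pt g) i) ^+ 2 = 1 - 2 * zy + Y ^+ 2; last exact: sumclose.
  rewrite -[X in X - _ + _]zz Y2 /zy mulr_sumr -sumrB -big_split/=.
  by apply: eq_bigr => i _; rewrite sqrrB -mulr_natl mulrA.
have Y0 : 0 <= Y by exact: sqrtr_ge0.
have Yn0 : Y != 0.
  apply/eqP => y0; have yi i : tnth (pt g) i = 0.
    by apply: dotv_eq0; rewrite -sqr_euclid_norm -/Y y0 expr2 mulr0.
  move: key; rewrite y0 /zy big1 => [|i _]; last by rewrite yi mulr0.
  by lra.
have Yp : 0 < Y by rewrite lt_neqAle eq_sym Yn0.
exists (enum_rank g) => //.
rewrite /cone60 /= enum_rankK nrm1 mul1r nrmE// -/Y -/X.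
have -> : dotv (pt g) x = X * zy.
  by rewrite /dotv /zy mulr_sumr; apply: eq_bigr => i _; rewrite /z; field; lra.
rewrite mulrCA [X in X <= _]mulrC ler_pM2l// ler_pdivlMl//.
have c2 := @cos_pi6_sqr R; move: c2; set c := cos _ => c2.
(* From [key], [2 zy >= 3/4 + Y^2 = c^2 + Y^2 >= 2 c Y]. *)
have := sqr_ge0 (Y - c); rewrite sqrrB c2; lra.
Qed.

(** Since some finite cover exists, a least one does and the default of [xget] is not reached; an
    empty family covers nothing, whence positivity. *)
Lemma cone60_numberP (d : nat) : (0 < d)%N ->
  cone60_cover R d (cone60_number R d) /\ (0 < cone60_number R d)%N.
Proof.
move=> d0; have [m cm] := cone60_cover_exists d0.
have ex : exists m, `[< cone60_cover R d m >] by exists m; exact/asboolP.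
have [m0 /asboolP m0c m0min] := ex_minnP ex.
have [h _] : cone60_cover R d (cone60_number R d) /\
    forall m', cone60_cover R d m' -> (cone60_number R d <= m')%N.
  apply: (@xgetPex _ 0%N [set m | cone60_cover R d m /\
      forall m', cone60_cover R d m' -> (m <= m')%N]).
  by exists m0; split=> // m' /asboolP; exact: m0min.
split => //; rewrite lt0n; apply/eqP => e; move: h; rewrite e => -[u [_]].
have x : d.-tuple R := [tuple 0 | _ < d].
by move=> /seteqP[_ /(_ x I)] [[]].
Qed.

End cover.

(** * Nearest neighbors *)

(** Turns a position in the sorted list of neighbors into a rank, hence membership in a prefix of
    length [k] into a cardinality condition. *)
Lemma index_sorted_count {T : eqType} (lt : rel T) (s : seq T) (j : T) :
  irreflexive lt -> transitive lt -> sorted lt s -> j \in s ->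
  index j s = count (fun m => lt m j) s.
Proof.
move=> irr tr; elim: s => // a s IH /= ps; rewrite inE.
have all_a := order_path_min tr ps.
have [->|ja] /= := eqVneq j a.
  move=> _; rewrite ?eqxx irr add0n; apply/esym/eqP; rewrite -leqn0 leqNgt -has_count.
  apply/hasPn => m ms; apply/negP => ma.
  by have := tr _ _ _ (allP all_a _ ms) ma; rewrite irr.
move=> js; rewrite (allP all_a _ js) add1n IH//.
exact: path_sorted ps.
Qed.

Lemma take_filter_notin {T : eqType} (k : nat) (s : seq T) (j : T) :
  j \notin take k s -> take k s = take k (seq.filter (predC1 j) s).
Proof.
elim: k s => [|k IH] [|a s] //=; first by rewrite take0.
rewrite inE negb_or => /andP[ja js].
by rewrite eq_sym ja /= -IH.
Qed.

Section ranks.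
Context {R : realType} {d n : nat}.
Implicit Types (x y : n.-tuple (d.-tuple R)) (l m j i : 'I_n) (k K : nat).

Definition dst x l m : R := euclid_dist (tnth x l) (tnth x m).

(** The lexicographic order on distance and index realized by the stable sort. Being strict, it
    determines the sorted list even in the presence of ties. *)
Definition closer x l : rel 'I_n := fun m j =>
  (dst x l m < dst x l j) || ((dst x l m == dst x l j) && (m < j)%N).

Definition nn_rank x l j : nat := #|[pred m | (m != l) && closer x l m j]|.

(** The point [l] counts as its own neighbor because moving [x_l] may change [f_l] too. The number
    [K] will exceed [k] to absorb resampled points. *)
Definition nb K x l j := (l == j) || (nn_rank x l j < K)%N.

Lemma closer_irr x l : irreflexive (closer x l).
Proof. by move=> m; rewrite /closer ltxx eqxx ltnn. Qed.

Lemma closer_trans x l : transitive (closer x l).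
Proof.
move=> b a c /orP[ab|/andP[/eqP ab ab']] /orP[bc|/andP[/eqP bc bc']]; apply/orP.
- by left; exact: lt_trans ab bc.
- by left; rewrite -bc.
- by left; rewrite ab.
- by right; rewrite ab bc eqxx (ltn_trans ab').
Qed.

Local Notation nn_sort x l := (sort
  (fun i j => euclid_dist (tnth x l) (tnth x i) <= euclid_dist (tnth x l) (tnth x j))
  (enum [pred m : 'I_n | m != l])).

Lemma nn_sort_sorted x l : sorted (closer x l) (nn_sort x l).
Proof.
have tot : total (fun i j => euclid_dist (tnth x l) (tnth x i) <= euclid_dist (tnth x l) (tnth x j)).
  by move=> a b; exact: le_total.
have tr : transitive (fun i j : 'I_n => (i < j)%N) by move=> b a c; exact: ltn_trans.
have so : sorted (fun i j : 'I_n => (i < j)%N) (enum [pred m : 'I_n | m != l]).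
  rewrite /enum_mem; apply: sorted_filter => //.
  by have := iota_ltn_sorted 0 n; rewrite -val_enum_ord sorted_map enumT.
have := sort_stable tot tr so; apply: sub_sorted => a b /andP[/= h1 h2].
move: h1; rewrite le_eqVlt => /orP[/eqP e|h]; rewrite /closer /dst; last by rewrite h.
by move: h2; rewrite e lexx eqxx /= => ->; rewrite orbT.
Qed.

Lemma mem_knn k x l j : j != l -> (j \in knn k x l) = (nn_rank x l j < k)%N.
Proof.
move=> jl; have js : j \in nn_sort x l by rewrite mem_sort mem_enum inE.
rewrite /knn in_take// (index_sorted_count (@closer_irr x l) (@closer_trans x l) (nn_sort_sorted x l))//.
congr (_ < _)%N; rewrite count_sort /nn_rank cardE /enum_mem size_filter count_filter.
by apply: eq_count => m; rewrite /= !inE andbC.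
Qed.

(** A point outside the first [k] can be deleted from the sorted list without affecting this prefix;
    what remains is sorted by the same order for both tuples. *)
Lemma knn_eq k x y l j : j != l ->
  (forall m, m != j -> tnth x m = tnth y m) ->
  ~~ (nn_rank x l j < k)%N -> ~~ (nn_rank y l j < k)%N ->
  [seq tnth x m | m <- knn k x l] = [seq tnth y m | m <- knn k y l].
Proof.
move=> jl xy rx ry; rewrite -mem_knn// in rx; rewrite -mem_knn// in ry.
have sxy : seq.filter (predC1 j) (nn_sort x l) = seq.filter (predC1 j) (nn_sort y l).
  apply: (irr_sorted_eq (@closer_trans x l) (@closer_irr x l)).
  - exact/(sorted_filter (@closer_trans x l))/nn_sort_sorted.
  - rewrite (@eq_in_sorted _ (predC1 j) (closer x l) (closer y l)).
    + exact/(sorted_filter (@closer_trans y l))/nn_sort_sorted.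
    + by move=> a b /= aj bj; rewrite /closer /dst !xy// eq_sym.
    + exact: filter_all.
  - by move=> m; rewrite !mem_filter !mem_sort.
rewrite /knn (take_filter_notin rx) (take_filter_notin ry) sxy.
apply/eq_in_map => m mt; apply: xy.
by have := mem_take mt; rewrite mem_filter => /andP[].
Qed.

Lemma knn_function_eq k (g : n.-tuple (d.-tuple R) -> R) l j x y :
  knn_function k l g -> (forall m, m != j -> tnth x m = tnth y m) ->
  ~~ nb k x l j -> ~~ nb k y l j -> g x = g y.
Proof.
move=> [h gh] xy; rewrite /nb !negb_or => /andP[lj rx] /andP[_ ry].
by rewrite !gh xy// (@knn_eq k x y l j)// eq_sym.
Qed.

Lemma nb_weaken K K' x l j : (K <= K')%N -> nb K x l j -> nb K' x l j.
Proof. by move=> KK /orP[/eqP ->|h]; rewrite /nb ?eqxx// (leq_trans h KK) orbT. Qed.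

(* Changing the points of [J] changes ranks by at most [#|J|]. *)
Lemma nb_agree K x y l j (J : {set 'I_n}) :
  (forall m, m \notin J -> tnth x m = tnth y m) -> l \notin J -> j \notin J ->
  nb K x l j -> nb (K + #|J|) y l j.
Proof.
move=> xy lJ jJ /orP[/eqP ->|h]; first by rewrite /nb eqxx.
apply/orP; right; rewrite /nn_rank.
apply: (@leq_ltn_trans (nn_rank x l j + #|J|)%N); last by rewrite ltn_add2r.
apply: (@leq_trans #|([set m | (m != l) && closer x l m j] :|: J)%SET|).
  apply/subset_leq_card/fintype.subsetP => m; rewrite !inE => /andP[ml cm].
  have [//|mJ] := boolP (m \in J); first by rewrite orbT.
  by rewrite ml orbF /=; move: cm; rewrite /closer /dst !xy.
apply: leq_trans (leq_card_setU _ _) _; rewrite leq_add2r.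
by rewrite cardsE.
Qed.

Lemma card_nb_out K x l : (#|[pred j | nb K x l j]| <= K.+1)%N.
Proof.
apply: (@leq_trans #|([set l] :|: [set j in knn K x l])%SET|).
  apply/subset_leq_card/fintype.subsetP => j; rewrite !inE /nb => /orP[/eqP ->|h].
    by rewrite eqxx.
  by have [//|jl] := eqVneq j l; rewrite mem_knn// h orbT.
apply: leq_trans (leq_card_setU _ _) _; rewrite cards1 add1n ltnS.
rewrite cardsE; apply: leq_trans (card_size _) _.
by rewrite size_take; case: ltnP => // ->.
Qed.

(** Rules out the equality case of [cone60_closer]. *)
Definition no_equilateral x := forall a b c : 'I_n, a != b -> a != c -> b != c ->
  ~ (dst x a b = dst x a c /\ dst x b c = dst x a c).

Definition distinct_points x := forall a b : 'I_n, a != b -> 0 < dst x a b.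

(* Among the points having [i] as a near neighbor and lying in a given cone with
   apex [i], the farthest one has all the others closer to it than [i] is. *)
Lemma card_nb_in (alpha K : nat) x i : cone60_cover R d alpha ->
  distinct_points x -> no_equilateral x ->
  (#|[pred l | nb K x l i]| <= 1 + alpha * K)%N.
Proof.
move=> [u [u1 cov]] sep nd.
pose L t : {set 'I_n} := [set l | [&& l != i, (nn_rank x l i < K)%N &
   `[< cone60 (u t) (subv (tnth x l) (tnth x i)) >]]]%SET.
have LK t : (#|L t| <= K)%N.
  have [->|/finset.set0Pn[l0 l0L]] := eqVneq (L t) finset.set0; first by rewrite cards0.
  have [l lL lmax] : exists2 l, l \in L t & forall m, m \in L t -> dst x m i <= dst x l i.
    have := @arg_maxP _ R _ l0 (mem (L t)) (fun m => dst x m i) l0L.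
    by case=> l lL h; exists l => // m mL; exact: h.
  have := lL; rewrite !inE => /and3P[li rl /asboolP cl].
  have sub : (L t :\ l)%SET \subset [set m | (m != l) && closer x l m i]%SET.
    apply/fintype.subsetP => m; rewrite !inE => /andP[ml /and3P[mi rm /asboolP cm]].
    rewrite ml /= /closer; apply/orP; left.
    apply: (cone60_closer (u1 t) cl cm).
    - exact: sep.
    - by apply: lmax; rewrite !inE mi rm; exact/asboolP.
    - by move=> [e1 e2]; apply: (nd l m i) => //; rewrite eq_sym.
  have := subset_leq_card sub; rewrite [X in (_ <= X)%N -> _]cardsE => h.
  rewrite (cardsD1 l) lL add1n; exact: leq_ltn_trans h rl.
apply: (@leq_trans #|([set i] :|: \bigcup_t L t)%SET|).
  apply/subset_leq_card/fintype.subsetP => l; rewrite !inE /nb => /orP[->//|rl].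
  have [//|li] := eqVneq l i; apply/orP; right.
  have : (setT : set (d.-tuple R)) (subv (tnth x l) (tnth x i)) by [].
  rewrite -cov => -[t _ ct]; apply/bigcupP; exists t => //.
  by rewrite !inE li rl; exact/asboolP.
apply: leq_trans (leq_card_setU _ _) _; rewrite cards1 leq_add2l.
have -> : (alpha * K = \sum_(t < alpha) K)%N by rewrite sum_nat_const card_ord.
apply: leq_trans (_ : \sum_(t < alpha) #|L t| <= _)%N; last exact: leq_sum.
elim/big_rec2: _ => [|t m A _ h]; first by rewrite cards0.
by apply: leq_trans (leq_card_setU _ _) _; rewrite leq_add2l.
Qed.

End ranks.

(** * General position *)

Section measurability_dist.
Context {R : realType} {d : nat} {dU} {U : measurableType dU}.

Lemma measurable_euclid_dist (f g : U -> d.-tuple R) :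
  measurable_fun setT f -> measurable_fun setT g ->
  measurable_fun setT (fun u => euclid_dist (f u) (g u)).
Proof.
move=> mf mg; rewrite /euclid_dist /euclid_norm /dotv.
apply: (@measurableT_comp _ _ _ _ _ _ (@Num.sqrt R)).
  by apply: continuous_measurable_fun; exact: sqrt_continuous.
apply: measurable_sumr => i _.
have m : measurable_fun setT (fun u => tnth (f u) i - tnth (g u) i).
  apply: measurable_funB.
    exact: (measurableT_comp (measurable_tnth i) mf).
  exact: (measurableT_comp (measurable_tnth i) mg).
by apply: measurable_funM; under eq_fun do rewrite tnth_mktuple.
Qed.

End measurability_dist.

Lemma measurable_eq_set {R : realType} {dU} {U : measurableType dU} (f g : U -> R) :
  measurable_fun setT f -> measurable_fun setT g -> measurable [set x | f x = g x].
Proof.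
move=> mf mg.
have := measurable_fun_eqr mf mg measurableT (Y := [set true]) I; rewrite setTI.
by congr measurable; apply/seteqP; split => x /= /eqP.
Qed.

Section pair_law.
Context {dT} {T : measurableType dT} {R : realType} (P : probability T R).
Context {dE} {E : measurableType dE}.

(** Both sides are the product of the marginal laws. This moves any pair of indices to the pair
    [(0, 1)], for which the absence of atoms is assumed. *)
Lemma pair_law (Y Z Y' Z' : {RV P >-> E}) :
  (forall A, measurable A -> distribution P Y A = distribution P Y' A) ->
  (forall A, measurable A -> distribution P Z A = distribution P Z' A) ->
  forall B : set (E * E), measurable B ->
  (P \x P)%E [set w | B (Y w.1, Z w.2)] = (P \x P)%E [set w | B (Y' w.1, Z' w.2)].
Proof.
move=> eY eZ B mB.
have main (V W : {RV P >-> E}) :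
    (forall A, measurable A -> distribution P V A = distribution P Y' A) ->
    (forall A, measurable A -> distribution P W A = distribution P Z' A) ->
    (distribution P Y' \x distribution P Z')%E B = (P \x P)%E [set w | B (V w.1, W w.2)].
  move=> eV eW.
  have m : measurable_fun setT (fun w : T * T => (V w.1, W w.2)).
    apply: measurable_fun_pair.
      exact: (measurableT_comp (measurable_funPT V) measurable_fst).
    exact: (measurableT_comp (measurable_funPT W) measurable_snd).
  pose aq := isMeasurableFun.Build _ _ _ _ _ m.
  pose q : {mfun _ >-> _} := HB.pack (fun w : T * T => (V w.1, W w.2)) aq.
  apply: (@product_measure_unique _ _ _ _ _ _ _ (distribution (P \x P)%E q)) => // A C mA mC.
  transitivity (distribution P V A * distribution P W C)%E; last first.
    by congr (_ * _)%E; [exact: eV|exact: eW].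
  transitivity ((P \x P)%E ((V @^-1` A) `*` (W @^-1` C))); first by [].
  apply: product_measure1E.
    by rewrite -[X in measurable X]setTI; exact: (measurable_funPT V).
  by rewrite -[X in measurable X]setTI; exact: (measurable_funPT W).
by rewrite -(main Y Z)// (main Y' Z').
Qed.

Lemma product_null (S : set (T * T)) : measurable S ->
  (forall w, P [set w' | S (w, w')] = 0%E) -> (P \x P)%E S = 0%E.
Proof.
move=> mS S0; rewrite /product_measure1 /=.
transitivity (\int[P]_(x in setT) (cst 0 x))%E; last by rewrite integral0.
apply: eq_integral => w _ /=; rewrite -[RHS](S0 w); congr (P _).
by apply/seteqP; split => w' /=; rewrite /xsection /= inE.
Qed.

End pair_law.

Section nondegeneracy.
Context {dT} {T : measurableType dT} {R : realType} (P : probability T R).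
Context {n d : nat} (X : 'I_n -> {RV P >-> d.-tuple R}).
Hypothesis indep : independent_rvs X.
Hypothesis iddist : identically_distributed X.
Hypothesis n2 : (2 <= n)%N.
Hypothesis no_atom : forall i j : 'I_n, i = 0%N :> nat -> j = 1%N :> nat ->
  no_point_mass P (fun w => euclid_dist (X i w) (X j w)).
Local Notation E := (d.-tuple R).

Lemma swappable_indep : swappable X.
Proof.
apply: (@swap_of_indep _ _ _ _ _ _ _ _ measurable).
- exact: measurableI.
- exact: measurableT.
- by rewrite sigma_algebra_id//; exact: sigma_algebra_measurable.
- exact: indep.
Qed.

(** Replacing part of the coordinates by their copies carries an event on the sample to the product
    space, where one may integrate over some points with the others fixed. *)
Lemma mixs_preimage (A : {set 'I_n}) (B : set (n.-tuple E)) : measurable B ->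
  P [set w | B (sample X w)] = (P \x P)%E [set w | B (mixs X A w)].
Proof.
move=> mB; have [_ _ h] := law_mixs swappable_indep A.
have := h B mB; rewrite /preimage => ->.
rewrite (_ : [set t | B (tup X t.1)] = [set w | B (sample X w)] `*` setT); last first.
  by apply/seteqP; split => w //= [].
have mt : measurable [set w | B (sample X w)].
  by rewrite -[X in measurable X]setTI; exact: (measurable_tup X).
transitivity (P [set w | B (sample X w)] * P setT)%E; last by apply/esym/product_measure1E.
by rewrite probability_setT mule1.
Qed.

Local Notation D := euclid_dist.

Let measurable_D_pair (r : R) : measurable [set z : E * E | D z.1 z.2 = r].
Proof.
have m : measurable_fun setT (fun z : E * E => D z.1 z.2) by exact: measurable_euclid_dist.
by have := m measurableT [set r] (measurable_set1 r); rewrite setTI.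
Qed.

Let mtn (i : 'I_n) : measurable_fun setT (fun x : n.-tuple E => tnth x i).
Proof. exact: measurable_tnth. Qed.

Let mD (i j : 'I_n) : measurable_fun setT (fun x : n.-tuple E => dst x i j).
Proof. exact: measurable_euclid_dist. Qed.

Lemma dist_pair_null (a b : 'I_n) (r : R) :
  (P \x P)%E [set w | D (X a w.1) (X b w.2) = r] = 0%E.
Proof.
pose i0 := Ordinal (ltnW n2); pose i1 := Ordinal n2.
rewrite (pair_law (iddist a i0) (iddist b i1) (measurable_D_pair r)).
have mB : measurable [set x : n.-tuple E | dst x i0 i1 = r].
  by have := mD i0 i1 measurableT (measurable_set1 r); rewrite setTI.
have := mixs_preimage [set i1]%SET mB.
rewrite (_ : [set w | _ (sample X w)] = (fun w => D (X i0 w) (X i1 w)) @^-1` [set r]); last first.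
  by apply/seteqP; split => w /=; rewrite /dst !tnth_mktuple.
rewrite (no_atom (i := i0) (j := i1) erefl erefl) => e.
apply: etrans (esym e); congr (product_measure1 _ _ _).
by apply/seteqP; split => w /=; rewrite /dst !tnth_mktuple !inE.
Qed.

Lemma dist_null (a b : 'I_n) (r : R) : a != b ->
  P [set w | dst (sample X w) a b = r] = 0%E.
Proof.
move=> ab; have mB : measurable [set x : n.-tuple E | dst x a b = r].
  by have := mD a b measurableT (measurable_set1 r); rewrite setTI.
rewrite (mixs_preimage [set b]%SET mB) -(dist_pair_null a b r); congr (_ _).
by apply/seteqP; split => w /=; rewrite /dst !tnth_mktuple !inE eqxx (negbTE ab).
Qed.

(* A distance takes a given value with positive probability for only countably
   many values; since the distance between two sample points has no atoms, the
   equilateral triangles over a fixed vertex [z] are negligible. *)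
Lemma equal_dist_null (a b : 'I_n) (z : E) : a != b ->
  P [set w | D (X a w) (X b w) = D (X a w) z /\ D (X b w) z = D (X a w) z] = 0%E.
Proof.
move=> ab.
have mfz (i : 'I_n) : measurable_fun setT (fun x : n.-tuple E => D (tnth x i) z).
  exact: measurable_euclid_dist.
have mB : measurable [set x : n.-tuple E | dst x a b = D (tnth x a) z /\
    D (tnth x b) z = D (tnth x a) z].
  by apply: measurableI; apply: measurable_eq_set.
have -> : [set w | D (X a w) (X b w) = D (X a w) z /\ D (X b w) z = D (X a w) z] =
   [set w | [set x : n.-tuple E | dst x a b = D (tnth x a) z /\
      D (tnth x b) z = D (tnth x a) z] (sample X w)].
  by apply/seteqP; split => w /=; rewrite /dst !tnth_mktuple.
rewrite (mixs_preimage [set b]%SET mB).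
set S := (X in _ X = _).
have SE : S = [set w | D (X a w.1) (X b w.2) = D (X a w.1) z /\ D (X b w.2) z = D (X a w.1) z].
  by apply/seteqP; split => w; rewrite /S /dst /= !tnth_mktuple !inE eqxx (negbTE ab).
have mz : measurable_fun setT (fun w => D (X b w) z) by exact: measurable_euclid_dist.
pose az := isMeasurableFun.Build _ _ _ _ _ mz.
pose Z : {RV P >-> R} := HB.pack (fun w => D (X b w) z) az.
have /countable_injP[f finj] := pmf_gt0_countable Z.
pose C := [set r | 0 < pmf Z r].
(* Enumerates the atoms of [Z]. The default 0 is harmless, as every level set of the distance
   between the two points is negligible. *)
pose r_ m := xget 0 [set r | C r /\ f r = m].
have m1 (i : 'I_n) : measurable_fun setT (fun w : T * T => X i w.1).
  exact: (measurableT_comp (measurable_funPT (X i)) measurable_fst).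
have m2 (i : 'I_n) : measurable_fun setT (fun w : T * T => X i w.2).
  exact: (measurableT_comp (measurable_funPT (X i)) measurable_snd).
have mS : measurable S.
  rewrite SE; apply: measurableI; apply: measurable_eq_set; exact: measurable_euclid_dist.
have mUr : measurable (\bigcup_m [set w : T * T | D (X a w.1) (X b w.2) = r_ m]).
  by apply: bigcup_measurable => m _; apply: measurable_eq_set => //; exact: measurable_euclid_dist.
pose U1 := \bigcup_m [set w : T * T | D (X a w.1) (X b w.2) = r_ m].
apply/(negligibleP _ mS).
apply: (@negligibleS _ _ _ _ (U1 `|` (S `\` U1))).
  by move=> w Sw; have [?|?] := pselect (U1 w); [left|right].
apply: negligibleU.
  apply: negligible_bigcup => m; apply/negligibleP; last exact: dist_pair_null.
  by apply: measurable_eq_set => //; exact: measurable_euclid_dist.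
apply/negligibleP; first exact: measurableD.
apply: product_null; first exact: measurableD.
move=> w; set r := D (X a w) z.
(* Slice at a fixed first coordinate: if [r] is not an atom, the condition on [X_b] alone is
   negligible; if it is, the event lies in [U1] and the slice is empty. *)
have [r0|rn0] := eqVneq (pmf Z r) 0.
  have Zr : P (Z @^-1` [set r]) = 0%E.
    by rewrite -[LHS]fineK ?fin_num_measure//; move: r0; rewrite /pmf => ->.
  apply/negligibleP.
    have := measurable_xsection (w) (measurableD mS mUr); congr measurable.
    by apply/seteqP; split => w'; rewrite /xsection /= inE.
  apply: (@negligibleS _ _ _ _ (Z @^-1` [set r])).
    by move=> w' [] /=; rewrite SE => -[_ e] _.
  by apply/negligibleP => //; rewrite -[X in measurable X]setTI; exact: mz.
rewrite (_ : [set _ | _] = set0) ?measure0//.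
apply/seteqP; split => w' //= [Sw nU]; apply: nU.
move: Sw; rewrite SE /= -/r => -[e1 e2].
have Cr : C r by rewrite /C /= lt_neqAle eq_sym rn0 pmf_ge0.
exists (f r) => //=; rewrite e1 /r_.
case: xgetP => [r' -> [Cr' fr']|/(_ r)]; last by case.
by apply: finj; rewrite ?inE.
Qed.

Definition good_tuple : set (n.-tuple E) := [set x | distinct_points x /\ no_equilateral x].

Let tie_sets (t : 'I_n * 'I_n) : set (n.-tuple E) :=
  [set x | t.1 != t.2 /\ dst x t.1 t.2 = 0].

Let triangle_sets (t : 'I_n * 'I_n * 'I_n) : set (n.-tuple E) :=
  [set x | [&& t.1.1 != t.1.2, t.1.1 != t.2 & t.1.2 != t.2] /\
    (dst x t.1.1 t.1.2 = dst x t.1.1 t.2 /\ dst x t.1.2 t.2 = dst x t.1.1 t.2)].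

Let measurable_propI (b : bool) (A : set (n.-tuple E)) :
  measurable A -> measurable [set x | b /\ A x].
Proof.
case: b => mA; first by rewrite (_ : [set x | _] = A)//; apply/seteqP; split => x //= [].
by rewrite (_ : [set x | _] = set0)//; apply/seteqP; split => x //= [].
Qed.

Let bad_tupleE : ~` good_tuple = (\bigcup_t tie_sets t) `|` (\bigcup_t triangle_sets t).
Proof.
apply/seteqP; split => [x|x [[[a b] _ [ab e]]|[[[a b] c] _ [/and3P[ab ac bc] e]]]].
- rewrite /good_tuple /= => /not_andP[|].
    move=> /existsNP[a /existsNP[b /not_implyP[ab /negP]]]; rewrite -leNgt => h.
    left; exists (a, b) => //; split => //.
    by apply/eqP; rewrite eq_le h euclid_dist_ge0.
  move=> /existsNP[a /existsNP[b /existsNP[c /not_implyP[ab /not_implyP[ac /not_implyP[bc /contrapT h]]]]]].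
  by right; exists ((a, b), c) => //; split => //; apply/and3P; split.
- by move=> [s _]; have := s a b ab; rewrite [X in _ < X]e ltxx.
- by move=> [_ nd]; exact: (nd a b c ab ac bc).
Qed.

Lemma measurable_good : measurable good_tuple.
Proof.
rewrite -[good_tuple]setCK; apply: measurableC; rewrite bad_tupleE.
apply: measurableU; apply: fin_bigcup_measurable => // t _; apply: measurable_propI.
  exact: measurable_eq_set.
by apply: measurableI; exact: measurable_eq_set.
Qed.

Let null_fin_bigcup (I : finType) (F : I -> set (n.-tuple E)) :
  (forall i, measurable (F i)) -> (forall i, P [set w | F i (sample X w)] = 0%E) ->
  P.-negligible [set w | (\bigcup_i F i) (sample X w)].
Proof.
move=> mF F0.
have : {ae P, forall w, forall i, ~ F i (sample X w)}.
  apply: filter_forall => i.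
  exists [set w | F i (sample X w)]; split => //.
    by rewrite -[X in measurable X]setTI; exact: (measurable_tup X).
  by move=> w /= /contrapT.
apply: negligibleS => w /= [i _ Fi]; by move=> /(_ i).
Qed.

Lemma bad_sample_null : P [set w | (~` good_tuple) (sample X w)] = 0%E.
Proof.
have mb : measurable [set w | (~` good_tuple) (sample X w)].
  rewrite -[X in measurable X]setTI; apply: (measurable_tup X) => //.
  by apply: measurableC; exact: measurable_good.
apply/(negligibleP _ mb).
rewrite (_ : [set w | _] = [set w | (\bigcup_t tie_sets t) (sample X w)] `|`
   [set w | (\bigcup_t triangle_sets t) (sample X w)]); last by rewrite bad_tupleE.
apply: negligibleU; apply: null_fin_bigcup => t.
- by apply: measurable_propI; exact: measurable_eq_set.
- have [ab|ab] := eqVneq t.1 t.2.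
    by rewrite (_ : [set w | _] = set0) ?measure0//; apply/seteqP; split => w //; rewrite /tie_sets /= ab eqxx => -[].
  rewrite -[RHS](dist_null 0 ab); congr (P _).
  by apply/seteqP; split => w; rewrite /tie_sets /= ab => // -[].
- by apply: measurable_propI; apply: measurableI; exact: measurable_eq_set.
case: t => -[a b] c.
have [ab|ab] := eqVneq a b.
  by rewrite (_ : [set w | _] = set0) ?measure0//; apply/seteqP; split => w //; rewrite /triangle_sets /= ab eqxx => -[].
have [ac|ac] := eqVneq a c.
  by rewrite (_ : [set w | _] = set0) ?measure0//; apply/seteqP; split => w //; rewrite /triangle_sets /= ac eqxx andbF => -[].
have [bc|bc] := eqVneq b c.
  by rewrite (_ : [set w | _] = set0) ?measure0//; apply/seteqP; split => w //; rewrite /triangle_sets /= bc eqxx !andbF => -[].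
pose B := [set x : n.-tuple E | dst x a b = dst x a c /\ dst x b c = dst x a c].
have mB : measurable B by apply: measurableI; exact: measurable_eq_set.
rewrite (_ : [set w | _] = [set w | B (sample X w)]); last first.
  by apply/seteqP; split => w; rewrite /triangle_sets /= ab ac bc => // -[].
(* Resampling [a] and [b] leaves [X_c] as a function of the first coordinate, so each slice concerns
   triangles over a fixed vertex. *)
rewrite (mixs_preimage [set a; b]%SET mB).
apply: product_null.
  by rewrite -[X in measurable X]setTI; exact: (measurable_mixs X [set a; b]%SET).
move=> w; rewrite -[RHS](equal_dist_null (X c w) ab); congr (P _).
have ca : (c == a) = false by rewrite eq_sym (negbTE ac).
have cb : (c == b) = false by rewrite eq_sym (negbTE bc).
by apply/seteqP; split => w' /=; rewrite /B /dst /= !tnth_mktuple !inE !eqxx ca cb orbT /=.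
Qed.

End nondegeneracy.

(** * Counting linked pairs *)

(** Induction through Chebyshev's sum inequality: the double sum of
    [(a_i - a_j) (a_i^(q+1) - a_j^(q+1))] is nonnegative. *)
Lemma power_mean {R : realType} {I : finType} (a : I -> R) (L : pred I) (q : nat) :
  (forall i, 0 <= a i) ->
  (\sum_(i | L i) a i) ^+ q.+1 <= #|L|%:R ^+ q * \sum_(i | L i) a i ^+ q.+1.
Proof.
move=> a0; elim: q => [|q IH]; first by rewrite !expr0 mul1r expr1.
have cheb : (\sum_(i | L i) a i) * (\sum_(i | L i) a i ^+ q.+1) <=
    #|L|%:R * \sum_(i | L i) a i ^+ q.+2.
  have e1 : #|L|%:R * \sum_(i | L i) a i ^+ q.+2 = \sum_(i | L i) \sum_(j | L j) a i ^+ q.+2.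
    by rewrite mulr_sumr; apply: eq_bigr => i _; rewrite sumr_const mulr_natl.
  have e1' : #|L|%:R * \sum_(i | L i) a i ^+ q.+2 = \sum_(i | L i) \sum_(j | L j) a j ^+ q.+2.
    by rewrite sumr_const mulr_natl.
  have e2 : (\sum_(i | L i) a i) * (\sum_(i | L i) a i ^+ q.+1) =
      \sum_(i | L i) \sum_(j | L j) a i * a j ^+ q.+1.
    by rewrite mulr_suml; apply: eq_bigr => i _; rewrite mulr_sumr.
  have e2' : (\sum_(i | L i) a i) * (\sum_(i | L i) a i ^+ q.+1) =
      \sum_(i | L i) \sum_(j | L j) a j * a i ^+ q.+1.
    by rewrite e2 exchange_big.
  have : 0 <= \sum_(i | L i) \sum_(j | L j) (a i - a j) * (a i ^+ q.+1 - a j ^+ q.+1).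
    apply: sumr_ge0 => i _; apply: sumr_ge0 => j _.
    have [ij|/ltW ij] := leP (a i) (a j).
      by apply: mulr_le0; rewrite subr_le0 ?lerXn2r ?nnegrE.
    by apply: mulr_ge0; rewrite subr_ge0 ?lerXn2r ?nnegrE.
  have -> : \sum_(i | L i) \sum_(j | L j) (a i - a j) * (a i ^+ q.+1 - a j ^+ q.+1) =
     \sum_(i | L i) \sum_(j | L j) a i ^+ q.+2 + \sum_(i | L i) \sum_(j | L j) a j ^+ q.+2
     - \sum_(i | L i) \sum_(j | L j) a i * a j ^+ q.+1
     - \sum_(i | L i) \sum_(j | L j) a j * a i ^+ q.+1.
    rewrite -big_split -!sumrB/=; apply: eq_bigr => i _.
    rewrite -big_split -!sumrB/=; apply: eq_bigr => j _.
    by rewrite !(exprS _ q.+1); ring.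
  rewrite -e1 -e1' -e2 -e2'; lra.
rewrite exprS; apply: le_trans (ler_wpM2l _ IH) _; first exact: sumr_ge0.
by rewrite mulrCA exprSr -mulrA ler_wpM2l// exprn_ge0.
Qed.

Lemma sum_bool_card {I : finType} (b : I -> bool) : (\sum_i b i = #|[pred i | b i]|)%N.
Proof. by rewrite -sum1_card [RHS]big_mkcond; apply: eq_bigr => i _; rewrite inE; case: (b i). Qed.

Section counts.
Context {R : realType} {d n : nat}.
Local Notation E := (d.-tuple R).
Implicit Types (x y : n.-tuple E) (l m j i : 'I_n) (k K : nat) (A : {set 'I_n}).

(** A summand [f_l] can feel both [x_i] and [x_j] only through such a common [l]. *)
Definition linked K x i j : bool := [exists l, nb K x l i && nb K x l j].

Lemma linked_weaken K K' x i j : (K <= K')%N -> linked K x i j -> linked K' x i j.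
Proof.
move=> KK /existsP[l /andP[a b]]; apply/existsP; exists l.
by rewrite !(nb_weaken KK).
Qed.

Lemma linked_self K x i : linked K x i i.
Proof. by apply/existsP; exists i; rewrite /nb eqxx. Qed.

Section square.
Variables (q : bool -> bool -> n.-tuple E) (i j : 'I_n).
Hypothesis ij : i != j.
Hypothesis qj : forall a a' b m, m != j -> tnth (q a b) m = tnth (q a' b) m.
Hypothesis qi : forall a b b' m, m != i -> tnth (q a b) m = tnth (q a b') m.

(** In [q a b], the first bit moves [j] and the second moves [i]. The mixed second difference of
    [f_l] vanishes unless [l] has [j] as a neighbor at some corner and [i] at some corner. These
    corners may differ, and bringing both facts to a common corner costs one rank, whence [k.+1]. *)
Lemma square_difference k (g : n.-tuple E -> R) l : knn_function k l g ->
  (forall a b, ~~ linked k.+1 (q a b) i j) ->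
  g (q false false) - g (q true false) = g (q false true) - g (q true true).
Proof.
move=> kg nl.
have [/existsP[a /existsP[b lj]]|hj] := boolP [exists a, exists b, nb k (q a b) l j]; last first.
  have no a b : ~~ nb k (q a b) l j.
    apply/negP => h; move/negP: hj; apply; apply/existsP; exists a.
    by apply/existsP; exists b.
  by rewrite !(knn_function_eq kg (@qj false true _) (no _ _) (no _ _)) !subrr.
have [/existsP[a' /existsP[b' li]]|hi] := boolP [exists a, exists b, nb k (q a b) l i]; last first.
  have no a' b' : ~~ nb k (q a' b') l i.
    apply/negP => h; move/negP: hi; apply; apply/existsP; exists a'.
    by apply/existsP; exists b'.
  by rewrite !(knn_function_eq kg (@qi _ false true) (no _ _) (no _ _)).
exfalso.
have [li0|li0] := eqVneq l i.
  move/negP: (nl a b); apply; apply/existsP; exists l.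
  by rewrite {1}li0 {1}/nb eqxx (nb_weaken (leqnSn k)).
have [lj0|lj0] := eqVneq l j.
  move/negP: (nl a' b'); apply; apply/existsP; exists l.
  by rewrite {2}lj0 {2}/nb eqxx (nb_weaken (leqnSn k)).
(* The corner [(a, b')] differs from the one where [i] is a neighbor only at [j], and from the one
   where [j] is a neighbor only at [i]. *)
move/negP: (nl a b'); apply; apply/existsP; exists l.
have h1 : nb (k + #|[set j]%SET|) (q a b') l i.
  apply: (nb_agree _ _ _ li); rewrite ?inE//.
  by move=> m; rewrite inE => mj; exact: qj.
have h2 : nb (k + #|[set i]%SET|) (q a b') l j.
  apply: (nb_agree _ _ _ lj); rewrite ?inE// 1?eq_sym//.
  by move=> m; rewrite inE => mi; exact: qi.
by move: h1 h2; rewrite !cards1 addn1 => -> ->.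
Qed.

End square.

Section deterministic_bounds.
Variables (alpha K : nat) (x : n.-tuple E) (A : {set 'I_n}).
Hypothesis (cov : cone60_cover R d alpha).
Hypotheses (dp : distinct_points x) (ne : no_equilateral x).
Let D := (1 + alpha * K)%N.
Let kappa := (D * K.+1)%N.

Let in_deg i : (\sum_l nb K x l i <= D)%N.
Proof. by rewrite sum_bool_card; exact: card_nb_in cov dp ne. Qed.

Let out_deg l : (\sum_j nb K x l j <= K.+1)%N.
Proof. by rewrite sum_bool_card; exact: card_nb_out. Qed.

Let linked_le i j : (linked K x i j <= \sum_l nb K x l i * nb K x l j)%N.
Proof.
case: (boolP (linked K x i j)) => // /existsP[l /andP[a b]].
by rewrite (bigD1 l)//= a b.
Qed.

(** At most [D] indices [l] have [i] as a neighbor, and each has at most [K.+1] neighbors [j]. *)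
Lemma linked_deg i : (\sum_j linked K x i j <= kappa)%N.
Proof.
apply: (@leq_trans (\sum_j \sum_l nb K x l i * nb K x l j)).
  by apply: leq_sum => j _; exact: linked_le.
rewrite exchange_big /=.
apply: (@leq_trans (\sum_l nb K x l i * K.+1)).
  by apply: leq_sum => l _; rewrite -big_distrr/= leq_mul2l out_deg orbT.
by rewrite -big_distrl/= leq_mul2r in_deg orbT.
Qed.

Lemma linkedC i j : linked K x i j = linked K x j i.
Proof. by apply/existsP/existsP => -[l]; rewrite andbC; exists l. Qed.

Let sum_pow (I : finType) (c : I -> nat) (C q : nat) : (forall t, c t <= C)%N ->
  (\sum_t c t ^ q.+1 <= C ^ q * \sum_t c t)%N.
Proof.
move=> cC; rewrite big_distrr/=; apply: leq_sum => t _.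
rewrite expnSr leq_mul2r; case: (q) => [|q']; first by rewrite !expn0 orbT.
by rewrite leq_exp2r// cC orbT.
Qed.

Let restrict_le (b : 'I_n -> bool) : (\sum_(j | j \notin A) b j <= \sum_j b j)%N.
Proof. by rewrite [X in (_ <= X)%N](bigID (fun j => j \notin A))/= leq_addr. Qed.

(** All powers but one are bounded by the maximal degree; the remaining sum is exchanged so that it
    runs over [j] outside [A], which produces the size of the complement of [A] instead of [n]. *)
Lemma sum_linked_pow q :
  (\sum_i (\sum_(j | j \notin A) linked K x i j) ^ q.+1 <= #|(~: A)%SET| * kappa ^ q.+1)%N.
Proof.
apply: leq_trans (sum_pow _ _) _.
  by move=> i; apply: leq_trans (restrict_le _) (linked_deg i).
rewrite expnSr mulnCA leq_mul2l; apply/orP; right.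
rewrite exchange_big/=; apply: (@leq_trans (\sum_(j | j \notin A) kappa)).
  apply: leq_sum => j _; apply: leq_trans (linked_deg j).
  by apply: leq_sum => i _; rewrite linkedC.
by rewrite sum_nat_const leq_mul2r; apply/orP; right; apply/subset_leq_card/fintype.subsetP => j; rewrite !inE.
Qed.

Lemma sum_in_pow q :
  (\sum_i (\sum_(j | j \notin A) nb K x j i) ^ q.+1 <= #|(~: A)%SET| * kappa ^ q.+1)%N.
Proof.
apply: (@leq_trans (#|(~: A)%SET| * (D ^ q * K.+1))%N); last first.
  rewrite leq_mul2l expnSr; apply/orP; right; apply: leq_mul.
    by rewrite /kappa expnMn leq_pmulr// expn_gt0.
  by rewrite /kappa leq_pmull// /D add1n.
apply: leq_trans (sum_pow _ _) _.
  by move=> i; apply: leq_trans (restrict_le _) (in_deg i).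
rewrite mulnCA leq_mul2l; apply/orP; right.
rewrite exchange_big/=; apply: (@leq_trans (\sum_(j | j \notin A) K.+1)).
  by apply: leq_sum => j _; exact: out_deg.
by rewrite sum_nat_const leq_mul2r; apply/orP; right; apply/subset_leq_card/fintype.subsetP => j; rewrite !inE.
Qed.

Lemma sum_out_pow q :
  (\sum_i \sum_l nb K x l i * (\sum_(j | j \notin A) nb K x l j) ^ q.+1 <=
   #|(~: A)%SET| * (D * K.+1 ^ q.+1))%N.
Proof.
rewrite exchange_big/=.
apply: (@leq_trans (\sum_l K.+1 * (\sum_(j | j \notin A) nb K x l j) ^ q.+1)).
  by apply: leq_sum => l _; rewrite -big_distrl/= leq_mul2r out_deg orbT.
rewrite -big_distrr/=.
have -> : (#|(~: A)%SET| * (D * K.+1 ^ q.+1) = K.+1 * (K.+1 ^ q * (#|(~: A)%SET| * D)))%N.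
  by rewrite expnS; ring.
rewrite leq_mul2l /=; apply: leq_trans (sum_pow _ _) _.
  by move=> l; apply: leq_trans (restrict_le _) (out_deg l).
rewrite leq_mul2l; apply/orP; right.
rewrite exchange_big/=; apply: (@leq_trans (\sum_(j | j \notin A) D)).
  by apply: leq_sum => j _; exact: in_deg.
by rewrite sum_nat_const leq_mul2r; apply/orP; right; apply/subset_leq_card/fintype.subsetP => j; rewrite !inE.
Qed.

End deterministic_bounds.
End counts.

(** * Resampling one pair *)

Section config.
Context {E : Type} {n : nat}.

(** The counterpart of [mixt] on tuples of pairs: a pair [(X_i, X'_i)] is one coordinate, which the
    Efron-Stein inequality can resample. Likewise [pair_sum] is [swap_sum] as a function of such a
    tuple. *)
Definition cfg (A : {set 'I_n}) (y : n.-tuple (E * E)) : n.-tuple E :=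
  [tuple if i \in A then (tnth y i).2 else (tnth y i).1 | i < n].

Definition pair_sum {R : realType} (F : n.-tuple E -> R) (A : {set 'I_n}) (y : n.-tuple (E * E)) : R :=
  \sum_(j | j \notin A) (F (cfg finset.set0 y) - F (cfg [set j]%SET y)) *
                        (F (cfg A y) - F (cfg (j |: A)%SET y)).

End config.

Section local_difference.
Context {R : realType} {d n : nat}.
Local Notation E := (d.-tuple R).
Variables (k : nat) (f_ : 'I_n -> n.-tuple E -> R) (c0 : R) (F : n.-tuple E -> R).
Hypothesis kf : forall l, knn_function k l (f_ l).
Hypothesis c00 : 0 <= c0.
Hypothesis FE : forall x, F x = c0 * \sum_l f_ l x.

(** At most [2 D0] summands have [j] as a neighbor in one of the two tuples, and each changes by at
    most [2 M]. *)
Lemma local_difference (x x' : n.-tuple E) (j : 'I_n) (M : R) (D0 : nat) :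
  (forall m, m != j -> tnth x m = tnth x' m) -> 0 <= M ->
  (forall l, `|f_ l x| <= M) -> (forall l, `|f_ l x'| <= M) ->
  (\sum_l nb k x l j <= D0)%N -> (\sum_l nb k x' l j <= D0)%N ->
  `|F x - F x'| <= 4 * c0 * D0%:R * M.
Proof.
move=> xx M0 fM fM' d1 d2.
rewrite !FE -mulrBr -sumrB normrM (ger0_norm c00).
have -> : 4 * c0 * D0%:R * M = c0 * ((D0%:R + D0%:R) * (2 * M)) by ring.
apply: ler_wpM2l => //.
apply: (@le_trans _ _ (\sum_l ((nb k x l j)%:R + (nb k x' l j)%:R) * (2 * M))).
  apply: le_trans (ler_norm_sum _ _ _) _; apply: ler_sum => l _.
  have b2 : `|f_ l x - f_ l x'| <= 2 * M.
    apply: le_trans (ler_normB _ _) _; have := fM l; have := fM' l; lra.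
  have [h|h] := boolP (nb k x l j); have [h'|h'] := boolP (nb k x' l j).
  - apply: le_trans b2 _; have -> : (true%:R + true%:R) * (2 * M) = 4 * M by rewrite /=; ring.
    by lra.
  - by apply: le_trans b2 _; rewrite addr0 mul1r.
  - by apply: le_trans b2 _; rewrite add0r mul1r.
  by rewrite (knn_function_eq (kf l) xx h h') subrr normr0 addr0 mul0r.
rewrite -mulr_suml big_split/= -!natr_sum.
by rewrite ler_wpM2r ?mulr_ge0// lerD// ler_nat.
Qed.

Section resample.
Variables (A : {set 'I_n}) (i : 'I_n) (y z : n.-tuple (E * E)).
Hypothesis yz : forall m, m != i -> tnth y m = tnth z m.

Definition base_set (s : bool) : {set 'I_n} := if s then A else finset.set0.
Local Notation yz_ := (fun b : bool => if b then z else y).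

(* [s] selects one of the two factors of the summand [j] of [pair_sum], [a] tells
   whether [j] is swapped, and [b] whether the pair [i] is resampled. *)
Definition square_conf (s : bool) (j : 'I_n) (a b : bool) : n.-tuple E :=
  cfg (if a then j |: base_set s else base_set s)%SET (yz_ b).

(** The indices whose product may change when the pair [i] is resampled; for the others the mixed
    differences vanish in both factors. *)
Definition touched (j : 'I_n) : bool := (j == i) ||
  [exists s : bool, [exists a : bool, [exists b : bool,
    linked k.+1 (square_conf s j a b) i j]]].

(** Three ways of being touched. If [j] is not swapped, the configuration is the same for all [j]
    and [count_linked] applies. Otherwise it varies with [j]: [count_in] covers the case where the
    common index is [j] itself, while in [count_out] the relation between [l] and [i] is brought
    back to the configuration without the swap, so that only the other half of the link depends on
    [j]. *)
Definition count_linked (s b : bool) : nat :=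
  \sum_(j | j \notin A) linked k.+1 (cfg (base_set s) (yz_ b)) i j.

Definition count_in (s b : bool) : nat :=
  \sum_(j | j \notin A) ((j != i) && nb k.+1 (cfg (j |: base_set s)%SET (yz_ b)) j i).

Definition count_out (s b : bool) : nat :=
  \sum_l nb k.+2 (cfg (base_set s) (yz_ b)) l i *
    \sum_(j | j \notin A)
      [&& j != i, j != l & nb k.+1 (cfg (j |: base_set s)%SET (yz_ b)) l j].

Lemma cfg_agree (B C : {set 'I_n}) (w : n.-tuple (E * E)) (J : {set 'I_n}) :
  (forall m, m \notin J -> (m \in B) = (m \in C)) ->
  forall m, m \notin J -> tnth (cfg B w) m = tnth (cfg C w) m.
Proof. by move=> BC m mJ; rewrite !tnth_mktuple BC. Qed.

Lemma square_conf_j s j a a' b m : m != j ->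
  tnth (square_conf s j a b) m = tnth (square_conf s j a' b) m.
Proof.
move=> mj; rewrite !tnth_mktuple; case: a; case: a' => //;
  by rewrite in_setU1 (negbTE mj).
Qed.

Lemma square_conf_i s j a b b' m : m != i ->
  tnth (square_conf s j a b) m = tnth (square_conf s j a b') m.
Proof. by move=> mi; rewrite !tnth_mktuple; case: b; case: b'; rewrite ?yz. Qed.

Lemma touched_count :
  (\sum_(j | j \notin A) touched j <=
   \sum_(s : bool) \sum_(b : bool) (count_linked s b + count_in s b + count_out s b))%N.
Proof.
pose r j s b := (linked k.+1 (cfg (base_set s) (yz_ b)) i j +
  ((j != i) && nb k.+1 (cfg (j |: base_set s)%SET (yz_ b)) j i) +
  \sum_l nb k.+2 (cfg (base_set s) (yz_ b)) l i *
      [&& j != i, j != l & nb k.+1 (cfg (j |: base_set s)%SET (yz_ b)) l j])%N.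
have rE s b : (\sum_(j | j \notin A) r j s b = count_linked s b + count_in s b + count_out s b)%N.
  rewrite !big_split/=; congr (_ + _ + _)%N.
  rewrite exchange_big/=; apply: eq_bigr => l _; by rewrite big_distrr.
apply: (@leq_trans (\sum_(j | j \notin A) \sum_(s : bool) \sum_(b : bool) r j s b)); last first.
  rewrite exchange_big/=; apply: leq_sum => s _; rewrite exchange_big/=.
  by apply: leq_sum => b _; rewrite rE.
apply: leq_sum => j jA.
have one s b : (0 < r j s b)%N -> (1 <= \sum_(s : bool) \sum_(b : bool) r j s b)%N.
  by move=> h; apply: leq_trans h _; rewrite (bigD1 s)//= (bigD1 b)//= -addnA leq_addr.
case: (boolP (touched j)) => // /orP[/eqP ji|].
  by apply: (one false false); rewrite /r ji linked_self.
move=> /existsP[s /existsP[a /existsP[b h]]].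
apply: (one s b); case: a h => h; last by rewrite /r h.
have [->|ji] := eqVneq j i; first by rewrite /r linked_self.
move: h => /existsP[l /andP[li lj]].
have [lj0|lj0] := eqVneq l j.
  by rewrite lj0 in li; rewrite /r ji li /= addn1 addSn.
rewrite /r (bigD1 l)//= ji (eq_sym j) lj0 lj /=.
(* Undoing the swap of [j] moves one point, hence the rank bound [k.+2] between [l] and [i]. *)
have := @nb_agree R d n k.+1 _ (cfg (base_set s) (yz_ b)) l i [set j]%SET _ _ _ li.
rewrite cards1 addn1 => -> //; rewrite ?inE// 1?eq_sym//.
  by rewrite muln1 addnA addnAC addn1.
by move=> m; rewrite inE => mj; apply: (@square_conf_j s j true false b).
Qed.

Lemma untouched_difference s j : j \notin A -> ~~ touched j ->
  F (square_conf s j false false) - F (square_conf s j true false) =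
  F (square_conf s j false true) - F (square_conf s j true true).
Proof.
move=> jA; rewrite /touched negb_or => /andP[ji nt].
rewrite !FE -!mulrBr -!sumrB; congr (_ * _); apply: eq_bigr => l _.
apply: (@square_difference R d n (square_conf s j) i j _ _ _ k (f_ l) l (kf l)).
- by rewrite eq_sym.
- by move=> a a' b m; exact: square_conf_j.
- by move=> a b b' m; exact: square_conf_i.
move=> a b; apply/negP => h; move/negP: nt; apply.
by apply/existsP; exists s; apply/existsP; exists a; apply/existsP; exists b.
Qed.

(** Only touched products change; each is at most the square of the bound of [local_difference],
    before and after resampling. *)
Lemma pair_sum_difference (M : R) (D0 : nat) : 0 <= M ->
  (forall s j a b l, j \notin A -> `|f_ l (square_conf s j a b)| <= M) ->
  (forall s j a b, j \notin A -> (\sum_l nb k (square_conf s j a b) l j <= D0)%N) ->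
  `|pair_sum F A y - pair_sum F A z| <=
    2 * (4 * c0 * D0%:R * M) ^+ 2 * (\sum_(j | j \notin A) touched j)%N%:R.
Proof.
move=> M0 fM nD.
pose U s j b := F (square_conf s j false b) - F (square_conf s j true b).
have pE b : pair_sum F A (yz_ b) = \sum_(j | j \notin A) U false j b * U true j b.
  apply: eq_bigr => j jA; rewrite /U /square_conf /=; congr (_ * _).
  by rewrite /base_set finset.setU0.
have UB s j b : j \notin A -> `|U s j b| <= 4 * c0 * D0%:R * M.
  move=> jA; apply: (@local_difference _ _ j) => //; try by move=> l; exact: fM.
  - by move=> m mj; exact: square_conf_j.
  - exact: nD.
  - exact: nD.
set W := 4 * c0 * D0%:R * M in UB *.
have W0 : 0 <= W by rewrite /W !mulr_ge0.
rewrite (pE false) (pE true) -sumrB natr_sum mulr_sumr.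
apply: le_trans (ler_norm_sum _ _ _) _; apply: ler_sum => j jA.
have [t|nt] := boolP (touched j); last first.
  by rewrite /U !(untouched_difference _ jA nt) subrr normr0 mulr0.
rewrite mulr1 (_ : 2 * W ^+ 2 = W * W + W * W); last by ring.
apply: le_trans (ler_normB _ _) _.
by apply: lerD; rewrite normrM ler_pM// UB.
Qed.

End resample.
End local_difference.

(** * Moments of the counts *)

Section ge0_expectation.
Context {dT} {T : measurableType dT} {R : realType} (P : probability T R).
Implicit Types f g : T -> R.

(** Expectations of nonnegative functions are kept extended, so that they can be added, compared and
    transported before finiteness is known. *)
Definition ge0_ex f : \bar R := (\int[P]_w (f w)%:E)%E.

Definition almost_surely (S : T -> Prop) := {ae P, forall w, S w}.

Lemma almost_surely_forall (I : finType) (S : I -> T -> Prop) :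
  (forall i, almost_surely (S i)) -> almost_surely (fun w => forall i, S i w).
Proof. exact: filter_forall. Qed.

Lemma almost_surely_sub (S S' : T -> Prop) :
  (forall w, S w -> S' w) -> almost_surely S -> almost_surely S'.
Proof. by move=> SS' h; rewrite /almost_surely; near=> w; apply: SS'; near: w. Unshelve. all: by end_near. Qed.

Lemma ge0_ex_le f g : measurable_fun setT f -> measurable_fun setT g ->
  (forall w, 0 <= f w) -> (forall w, 0 <= g w) -> almost_surely (fun w => f w <= g w) ->
  (ge0_ex f <= ge0_ex g)%E.
Proof.
move=> mf mg f0 g0 fg; apply: ae_ge0_le_integral => //=.
- by move=> w _; rewrite lee_fin.
- exact/measurable_EFinP.
- by move=> w _; rewrite lee_fin.
- exact/measurable_EFinP.
- by apply: (almost_surely_sub _ fg) => w h _; rewrite lee_fin.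
Qed.

Lemma ge0_ex_sum (I : Type) (r : seq I) (f : I -> T -> R) :
  (forall i, measurable_fun setT (f i)) -> (forall i w, 0 <= f i w) ->
  ge0_ex (fun w => \sum_(i <- r) f i w) = (\sum_(i <- r) ge0_ex (f i))%E.
Proof.
move=> mf f0; rewrite /ge0_ex.
under eq_integral do rewrite -sumEFin.
by rewrite ge0_integral_sum//; [move=> i; exact/measurable_EFinP|move=> i w _; rewrite lee_fin].
Qed.

Lemma ge0_exD f g : measurable_fun setT f -> measurable_fun setT g ->
  (forall w, 0 <= f w) -> (forall w, 0 <= g w) ->
  ge0_ex (fun w => f w + g w) = (ge0_ex f + ge0_ex g)%E.
Proof.
move=> mf mg f0 g0; rewrite /ge0_ex; under eq_integral do rewrite EFinD.
by rewrite ge0_integralD//; [move=> w _; rewrite lee_fin|exact/measurable_EFinP|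
  move=> w _; rewrite lee_fin|exact/measurable_EFinP].
Qed.

Lemma ge0_ex_ge0 f : (forall w, 0 <= f w) -> (0 <= ge0_ex f)%E.
Proof. by move=> f0; apply: integral_ge0 => w _; rewrite lee_fin. Qed.

Lemma ge0_ex_scale (c : R) f : 0 <= c -> measurable_fun setT f -> (forall w, 0 <= f w) ->
  ge0_ex (fun w => c * f w) = (c%:E * ge0_ex f)%E.
Proof.
move=> c0 mf f0; rewrite /ge0_ex; under eq_integral do rewrite EFinM.
rewrite ge0_integralZl//=; [exact/measurable_EFinP|by move=> w _; rewrite lee_fin].
Qed.

Lemma ge0_ex_le_cst (c : R) f : 0 <= c -> measurable_fun setT f -> (forall w, 0 <= f w) ->
  almost_surely (fun w => f w <= c) -> (ge0_ex f <= c%:E)%E.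
Proof.
move=> c0 mf f0 fc; apply: (@le_trans _ _ (ge0_ex (fun=> c))).
  exact: ge0_ex_le.
by rewrite /ge0_ex integral_cst//= probability_setT mule1.
Qed.

(** Expresses an almost sure property as a vanishing expectation, which can be transported by
    equality in law. *)
Lemma almost_surely_preimage dS (S : measurableType dS) (phi : T -> S) (B : set S) :
  measurable_fun setT phi -> measurable B ->
  almost_surely (fun w => B (phi w)) <-> (ge0_ex (fun w => \1_(~` B) (phi w)) = 0)%E.
Proof.
move=> mphi mB; have mN : measurable [set w | (~` B) (phi w)].
  by rewrite -[X in measurable X]setTI; apply: mphi => //; exact: measurableC.
have -> : (ge0_ex (fun w => \1_(~` B) (phi w)) = P [set w | (~` B) (phi w)])%E.
  transitivity (\int[P]_w (\1_[set w | (~` B) (phi w)] w)%:E)%E.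
    by apply: eq_integral => w _; rewrite !indicE.
  by rewrite integral_indic// setIT.
split => [h|h]; last by exists [set w | (~` B) (phi w)]; split.
exact: (@measure_negligible _ _ _ P _ mN h).
Qed.

Lemma measurable_prodr (I : Type) (r : seq I) (f : I -> T -> R) :
  (forall i, measurable_fun setT (f i)) ->
  measurable_fun setT (fun x => \prod_(i <- r) f i x).
Proof.
move=> mf; elim: r => [|i r IH].
  under eq_fun do rewrite big_nil.
  exact: measurable_cst.
by under eq_fun do rewrite big_cons; exact: measurable_funM.
Qed.

Lemma measurable_bool_natr (b : T -> bool) : measurable_fun setT b ->
  measurable_fun setT (fun x => (b x)%:R : R).
Proof.
move=> mb; have -> : (fun x => (b x)%:R : R) = (fun x => if b x then 1 else 0).
  by apply/funext => x; case: (b x).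
exact: measurable_fun_ifT.
Qed.

End ge0_expectation.

Lemma measurable_existsb {dT} {T : measurableType dT} {R : realType} (I : finType)
  (b : I -> T -> bool) : (forall i, measurable_fun setT (b i)) ->
  measurable_fun setT (fun x => [exists i, b i x]).
Proof.
move=> mb; have -> : (fun x => [exists i, b i x]) = (fun x => 0 < \sum_i (b i x)%:R :> R).
  apply/funext => x; apply/existsP/idP => [[i bi]|].
    rewrite (bigD1 i)//= bi (lt_le_trans ltr01)// lerDl.
    by apply: sumr_ge0 => j _.
  apply: contraTP => /forallNP h; rewrite -leNgt big1// => i _.
  by case: (boolP (b i x)) => // /h.
apply: measurable_fun_ltr => //; apply: measurable_sumr => i _.
exact: measurable_bool_natr.
Qed.

Section measurable_nb.
Context {R : realType} {d n : nat}.
Local Notation E := (d.-tuple R).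

Lemma measurable_dst (i j : 'I_n) : measurable_fun setT (fun x : n.-tuple E => dst x i j).
Proof. by apply: measurable_euclid_dist; exact: measurable_tnth. Qed.

Lemma measurable_nb K (l j : 'I_n) : measurable_fun setT (fun x : n.-tuple E => nb K x l j).
Proof.
rewrite /nb; apply: measurable_or => //.
have -> : (fun x : n.-tuple E => (nn_rank x l j < K)%N) =
    (fun x => \sum_m ((m != l) && closer x l m j)%:R < K%:R :> R).
  apply/funext => x; rewrite -natr_sum ltr_nat /nn_rank -sum_bool_card.
  by [].
apply: measurable_fun_ltr => //; apply: measurable_sumr => m _.
apply: measurable_bool_natr; apply: measurable_and => //.
apply: measurable_or; first by apply: measurable_fun_ltr; exact: measurable_dst.
by apply: measurable_and => //; apply: measurable_fun_eqr; exact: measurable_dst.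
Qed.

Lemma measurable_linked K (i j : 'I_n) :
  measurable_fun setT (fun x : n.-tuple E => linked K x i j).
Proof.
apply: (@measurable_existsb _ _ R) => l.
by apply: measurable_and; exact: measurable_nb.
Qed.

End measurable_nb.

Section pair_variables.
Context {dT} {T : measurableType dT} {R : realType} (P : probability T R).
Context {dE} {E : measurableType dE} {n : nat} (X : 'I_n -> {RV P >-> E}).
Local Notation Q := (P \x P)%E.

Definition pair_rv (i : 'I_n) (w : (T * T)%type) : (E * E)%type := (X i w.1, X i w.2).

Lemma measurable_pair_rv i : measurable_fun setT (pair_rv i).
Proof.
apply: measurable_fun_pair.
  exact: (measurableT_comp (measurable_funPT (X i)) measurable_fst).
exact: (measurableT_comp (measurable_funPT (X i)) measurable_snd).
Qed.

HB.instance Definition _ i := isMeasurableFun.Build _ _ _ _ (pair_rv i) (measurable_pair_rv i).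

Definition pairs (i : 'I_n) : {RV Q >-> (E * E)%type} := pair_rv i.

Lemma cfg_tup (A : {set 'I_n}) w : cfg A (tup pairs w) = mixs X A w.
Proof. by apply: eq_from_tnth => i; rewrite !tnth_mktuple; case: ifP. Qed.

Lemma measurable_cfg (A : {set 'I_n}) : measurable_fun setT (@cfg E n A).
Proof.
apply/measurable_fun_tnthP => i.
have [iA|iA] := boolP (i \in A).
  have -> : (@tnth n E)^~ i \o cfg A = snd \o (fun y => tnth y i).
    by apply/funext => y /=; rewrite tnth_mktuple iA.
  exact: (measurableT_comp measurable_snd (measurable_tnth i)).
have -> : (@tnth n E)^~ i \o cfg A = fst \o (fun y => tnth y i).
  by apply/funext => y /=; rewrite tnth_mktuple (negbTE iA).
exact: (measurableT_comp measurable_fst (measurable_tnth i)).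
Qed.

Hypothesis indep : forall A : 'I_n -> set E, (forall i, measurable (A i)) ->
    P (\bigcap_i (X i @^-1` A i)) = (\prod_(i < n) P (X i @^-1` A i))%E.

(** Products of two sets generate the sigma-algebra of pairs and are stable under intersection; on
    them independence follows from that of each copy separately. *)
Lemma swappable_pairs : swappable pairs.
Proof.
apply: (@swap_of_indep _ _ _ _ _ _ _ _ [set A `*` B | A in measurable & B in measurable]).
- move=> _ _ [A mA [B mB <-]] [C mC [D mD <-]].
  exists (A `&` C); first exact: measurableI.
  by exists (B `&` D); [exact: measurableI|rewrite setXI].
- by exists setT => //; exists setT => //; rewrite setXTT.
- exact: measurable_prod_measurableType.
move=> G GG.
have /choice[AB ABP] : forall i, exists AB : (set E * set E)%type,
    [/\ measurable AB.1, measurable AB.2 & G i = AB.1 `*` AB.2].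
  by move=> i; have [A mA [B mB <-]] := GG i; exists (A, B).
have mp (i : 'I_n) (A : set E) : measurable A -> measurable (X i @^-1` A).
  by move=> mA; rewrite -[X in measurable X]setTI; exact: (measurable_funPT (X i)).
have mA i : measurable (AB i).1 by have [] := ABP i.
have mB i : measurable (AB i).2 by have [] := ABP i.
transitivity (Q ((\bigcap_i (X i @^-1` (AB i).1)) `*` (\bigcap_i (X i @^-1` (AB i).2)))).
  congr (Q _); apply/seteqP; split => [w h|w [h1 h2] i _].
    by split=> i _; have := h i I; have [_ _ ->] := ABP i; case.
  by have [_ _ /= GE] := ABP i; rewrite /preimage /= GE; split; [exact: h1|exact: h2].
transitivity (P (\bigcap_i (X i @^-1` (AB i).1)) * P (\bigcap_i (X i @^-1` (AB i).2)))%E.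
  by apply: product_measure1E; apply: fin_bigcap_measurable => // i _; exact: mp.
rewrite (indep mA) (indep mB) -big_split; apply: eq_bigr => i _ /=.
transitivity (Q ((X i @^-1` (AB i).1) `*` (X i @^-1` (AB i).2))).
  by apply/esym/product_measure1E; exact: mp.
by congr (Q _); have [_ _ GE] := ABP i; rewrite /preimage GE.
Qed.

End pair_variables.

(** * Laws of the resampled configurations *)

Section resampled_law.
Context {dT} {T : measurableType dT} {R : realType} (P : probability T R).
Context {n d : nat} (X : 'I_n -> {RV P >-> d.-tuple R}).
Hypothesis indep : independent_rvs X.
Local Notation E := (d.-tuple R).
Local Notation Q := (P \x P)%E.
Local Notation Q2 := (Q \x Q)%E.
Local Notation Y := (mixs (pairs X)).

Lemma measurable_cfg_mixs (B A : {set 'I_n}) : measurable_fun setT (fun w => cfg B (Y A w)).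
Proof. exact: (measurableT_comp (measurable_cfg B) (measurable_mixs _ A)). Qed.

(** Two exchanges in succession: one of whole pairs on the fourfold product, then one of the
    coordinates within the pairs. *)
Lemma ge0_ex_cfg (B A : {set 'I_n}) (G : n.-tuple E -> R) : measurable_fun setT G ->
  (forall x, 0 <= G x) ->
  ge0_ex Q2 (fun w => G (cfg B (Y A w))) = ge0_ex P (fun w => G (sample X w)).
Proof.
move=> mG G0; have mG' : measurable_fun setT (fun x => (G x)%:E) by exact/measurable_EFinP.
have G0' x : (0 <= (G x)%:E)%E by rewrite lee_fin.
rewrite /ge0_ex.
transitivity (\int[Q2]_w (G (cfg B (tup (pairs X) w.1)))%:E)%E.
  apply: (law_eq_ge0_integral (f := fun y => (G (cfg B y))%:E)
    (law_mixs (swappable_pairs indep) A)) => //.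
  exact: (measurableT_comp mG' (measurable_cfg B)).
rewrite (@ge0_integral_prod_fst _ _ _ _ _ _ _ (fun w => (G (cfg B (tup (pairs X) w)))%:E))//; last first.
  exact: (measurableT_comp mG' (measurableT_comp (measurable_cfg B) (measurable_tup _))).
under eq_integral do rewrite cfg_tup.
rewrite (law_eq_ge0_integral (law_mixs (swappable_indep indep) B) mG')//.
rewrite (@ge0_integral_prod_fst _ _ _ _ _ _ _ (fun w => (G (tup X w))%:E))//.
exact: (measurableT_comp mG' (measurable_tup X)).
Qed.

Lemma ae_good_cfg : almost_surely P (fun w => @good_tuple R n d (sample X w)) ->
  almost_surely Q2 (fun w => forall AB : ({set 'I_n} * {set 'I_n})%type,
    good_tuple (cfg AB.1 (Y AB.2 w))).
Proof.
move=> bad.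
apply: almost_surely_forall => -[B A] /=.
have mg := measurable_good (R := R) (n := n) (d := d).
have mi : measurable_fun setT (\1_(~` @good_tuple R n d) : _ -> R).
  by apply: measurable_indic; exact: measurableC.
apply/(almost_surely_preimage _ (measurable_cfg_mixs B A) mg).
rewrite (ge0_ex_cfg B A mi)//.
by apply/(almost_surely_preimage _ (measurable_tup X) mg).
Qed.

(* The [q]-th power is expanded over [q]-tuples of indices [j]; for a tuple with set
   of values [J], all the events are transported to the single configuration
   [J :|: B], which has the law of the sample. *)
Lemma swap_moment (B A : {set 'I_n}) (al : pred 'I_n) (q : nat)
  (phi phi' : 'I_n -> n.-tuple E -> bool) (psi psi' : n.-tuple E -> bool) :
  (forall j, measurable_fun setT (phi j)) -> (forall j, measurable_fun setT (phi' j)) ->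
  measurable_fun setT psi -> measurable_fun setT psi' ->
  (forall (y : n.-tuple (E * E)%type) (J : {set 'I_n}), {subset J <= al} -> (#|J| <= q)%N ->
    (forall j, j \in J -> phi j (cfg (j |: B)%SET y) -> phi' j (cfg (J :|: B)%SET y)) /\
    (psi (cfg B y) -> psi' (cfg (J :|: B)%SET y))) ->
  (ge0_ex Q2 (fun w => ((psi (cfg B (Y A w)))%:R *
       (\sum_(j | al j) (phi j (cfg (j |: B)%SET (Y A w)))%:R) ^+ q)%R) <=
   ge0_ex P (fun w => ((psi' (sample X w))%:R *
       (\sum_(j | al j) (phi' j (sample X w))%:R) ^+ q)%R))%E.
Proof.
move=> mphi mphi' mpsi mpsi' hyp.
have expand (a : 'I_n -> bool) : (\sum_(j | al j) (a j)%:R) ^+ q =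
    \sum_(J : {ffun 'I_q -> 'I_n}) \prod_(r < q) (al (J r) && a (J r))%:R :> R.
  rewrite -[q in LHS]card_ord -prodr_const.
  rewrite (eq_bigr (fun _ => \sum_j (al j && a j)%:R)); last first.
    by move=> r _; rewrite big_mkcond; apply: eq_bigr => j _; case: (al j).
  by rewrite bigA_distr_bigA.
pose img (J : {ffun 'I_q -> 'I_n}) : {set 'I_n} := [set J r | r : 'I_q]%SET.
pose g (J : {ffun 'I_q -> 'I_n}) (x : n.-tuple E) : R :=
  (psi' x)%:R * \prod_(r < q) (al (J r) && phi' (J r) x)%:R.
have mg J : measurable_fun setT (g J).
  apply: measurable_funM; first exact: measurable_bool_natr.
  by apply: measurable_prodr => r; apply: measurable_bool_natr; exact: measurable_and.
have g0 J x : 0 <= g J x by rewrite mulr_ge0// prodr_ge0.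
have mgY J C : measurable_fun setT (fun w => g J (cfg C (Y A w))).
  exact: (measurableT_comp (mg J) (measurable_cfg_mixs C A)).
have mgX J : measurable_fun setT (fun w => g J (sample X w)).
  exact: (measurableT_comp (mg J) (measurable_tup X)).
have -> : (fun w => (psi' (sample X w))%:R * (\sum_(j | al j) (phi' j (sample X w))%:R) ^+ q : R) =
    (fun w => \sum_J g J (sample X w)).
  by apply/funext => w; rewrite expand mulr_sumr.
rewrite ge0_ex_sum//.
(* The right-hand term of [J] may be read at any configuration, since all have the law of the
   sample; the one chosen swaps the values of [J], so that pointwise comparison becomes possible. *)
rewrite (eq_bigr (fun J => ge0_ex Q2 (fun w => g J (cfg (img J :|: B)%SET (Y A w))))); last first.
  by move=> J _; rewrite ge0_ex_cfg.
rewrite -ge0_ex_sum//; apply: ge0_ex_le.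
- apply: measurable_funM.
    by apply: measurable_bool_natr; exact: (measurableT_comp mpsi (measurable_cfg_mixs B A)).
  apply: measurable_funX; apply: measurable_sumr => j _; apply: measurable_bool_natr.
  exact: (measurableT_comp (mphi j) (measurable_cfg_mixs _ A)).
- by apply: measurable_sumr.
- by move=> w; rewrite mulr_ge0// exprn_ge0// sumr_ge0.
- by move=> w; rewrite sumr_ge0.
apply: aeW => w; rewrite expand mulr_sumr; apply: ler_sum => J _.
rewrite /g; set y := Y A w.
have [/forallP alJ|nal] := boolP [forall r, al (J r)]; last first.
  move: nal; rewrite negb_forall => /existsP[r nr].
  by rewrite (bigD1 r)//= (negbTE nr) mul0r mulr0 mulr_ge0// prodr_ge0.
have [h1 h2] : (forall j, j \in img J -> phi j (cfg (j |: B)%SET y) -> phi' j (cfg (img J :|: B)%SET y)) /\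
    (psi (cfg B y) -> psi' (cfg (img J :|: B)%SET y)).
  apply: hyp; first by move=> j /imsetP[r _ ->]; exact: alJ.
  by apply: leq_trans (leq_imset_card _ _) _; rewrite card_ord.
apply: ler_pM => //.
  by apply: prodr_ge0 => r _.
  by case: (psi _) h2 => // ->.
apply: ler_prod => r _; rewrite ler0n /= alJ /= ler_nat.
have := h1 (J r); rewrite imset_f// => /(_ isT).
by case: (phi _ _) => // ->.
Qed.

End resampled_law.

Lemma cube_split {R : realType} (a b c : R) (q : nat) : 0 <= a -> 0 <= b -> 0 <= c ->
  (a + b + c) ^+ q.+1 <= 3 ^+ q * (a ^+ q.+1 + b ^+ q.+1 + c ^+ q.+1).
Proof.
move=> a0 b0 c0.
have := @power_mean R 'I_3 (fun r => [:: a; b; c]`_r) predT q.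
rewrite card_ord !big_ord_recl !big_ord0 /= !addr0 !addrA; apply.
by case=> -[|[|[|]]].
Qed.

Section touched_moments.
Context {dT} {T : measurableType dT} {R : realType} (P : probability T R).
Context {n d : nat} (X : 'I_n -> {RV P >-> d.-tuple R}).
Hypothesis indep : independent_rvs X.
Local Notation E := (d.-tuple R).
Local Notation Q := (P \x P)%E.
Local Notation Q2 := (Q \x Q)%E.
Local Notation Y := (mixs (pairs X)).
Hypothesis good : almost_surely P (fun w => @good_tuple R n d (sample X w)).
Variables (alpha k : nat) (A : {set 'I_n}) (q : nat).
Hypothesis cov : cone60_cover R d alpha.
Hypothesis q4 : (q.+1 <= 4)%N.
(** The rank bound [k + 2] of [count_out], plus up to 4 swapped points for powers of exponent at
    most 4. *)
Let K := (k + 6)%N.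
Let D := (1 + alpha * K)%N.
Let kappa := (D * K.+1)%N.
Let bound : R := (#|(~: A)%SET| * kappa ^ q.+1)%:R.

Lemma sum_sample_bound (H : 'I_n -> n.-tuple E -> R) (c : R) : 0 <= c ->
  (forall i, measurable_fun setT (H i)) -> (forall i x, 0 <= H i x) ->
  (forall x, distinct_points x -> no_equilateral x -> \sum_i H i x <= c) ->
  (\sum_i ge0_ex P (fun w => H i (sample X w)) <= c%:E)%E.
Proof.
move=> c0 mH H0 Hc.
have mHX i : measurable_fun setT (fun w => H i (sample X w)).
  exact: (measurableT_comp (mH i) (measurable_tup X)).
rewrite -ge0_ex_sum//; apply: ge0_ex_le_cst => //.
- by apply: measurable_sumr.
- by move=> w; rewrite sumr_ge0.
by apply: (almost_surely_sub _ good) => w [dp ne]; exact: Hc.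
Qed.

Let count (c : 'I_n -> n.-tuple (E * E)%type -> n.-tuple (E * E)%type -> nat) i
  (w : (T * T) * (T * T)) : R := (c i (Y finset.set0 w) (Y [set i]%SET w))%:R.

Let measurable_nb_cfg K' (B C : {set 'I_n}) l m :
  measurable_fun setT (fun w => nb K' (cfg B (Y C w)) l m).
Proof. exact: (measurableT_comp (measurable_nb _ _ _) (measurable_cfg_mixs _ _ _)). Qed.

Lemma measurable_count_linked i s b :
  measurable_fun setT (count (fun i y z => count_linked k A i y z s b) i).
Proof.
have -> : count (fun i y z => count_linked k A i y z s b) i = fun w => \sum_(j | j \notin A)
    (linked k.+1 (cfg (base_set A s) (Y (if b then [set i]%SET else finset.set0) w)) i j)%:R.
  by apply/funext => w; rewrite /count /count_linked natr_sum; case: b.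
apply: measurable_sumr => j _; apply: measurable_bool_natr.
exact: (measurableT_comp (measurable_linked _ _ _) (measurable_cfg_mixs _ _ _)).
Qed.

Lemma measurable_count_in i s b :
  measurable_fun setT (count (fun i y z => count_in k A i y z s b) i).
Proof.
have -> : count (fun i y z => count_in k A i y z s b) i = fun w => \sum_(j | j \notin A)
    ((j != i) && nb k.+1 (cfg (j |: base_set A s)%SET
        (Y (if b then [set i]%SET else finset.set0) w)) j i)%:R.
  by apply/funext => w; rewrite /count /count_in natr_sum; case: b.
apply: measurable_sumr => j _; apply: measurable_bool_natr.
by apply: measurable_and => //; exact: measurable_nb_cfg.
Qed.

Lemma measurable_count_out i s b :
  measurable_fun setT (count (fun i y z => count_out k A i y z s b) i).
Proof.
have -> : count (fun i y z => count_out k A i y z s b) i = fun w => \sum_l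
    (nb k.+2 (cfg (base_set A s) (Y (if b then [set i]%SET else finset.set0) w)) l i)%:R *
    \sum_(j | j \notin A) [&& j != i, j != l & nb k.+1 (cfg (j |: base_set A s)%SET
        (Y (if b then [set i]%SET else finset.set0) w)) l j]%:R.
  apply/funext => w; rewrite /count /count_out natr_sum; apply: eq_bigr => l _.
  by rewrite natrM natr_sum; case: b.
apply: measurable_sumr => l _; apply: measurable_funM.
  by apply: measurable_bool_natr; exact: measurable_nb_cfg.
apply: measurable_sumr => j _; apply: measurable_bool_natr.
by apply: measurable_and => //; apply: measurable_and => //; exact: measurable_nb_cfg.
Qed.

Lemma measurable_touched_count i : measurable_fun setT
  (count (fun i y z => (\sum_(j | j \notin A) touched k A i y z j)%N) i).
Proof.
have -> : count (fun i y z => (\sum_(j | j \notin A) touched k A i y z j)%N) i = fun w =>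
    \sum_(j | j \notin A)
     ((j == i) || [exists s : bool, [exists a : bool, [exists b : bool,
        linked k.+1 (cfg (if a then j |: base_set A s else base_set A s)%SET
          (Y (if b then [set i]%SET else finset.set0) w)) i j]]])%:R.
  apply/funext => w; rewrite /count natr_sum; apply: eq_bigr => j _.
  have orE u v : u = v -> ((j == i) || u)%:R = ((j == i) || v)%:R :> R by move=> ->.
  rewrite /touched; apply: orE.
  apply: eq_existsb => s; apply: eq_existsb => a.
  by apply: eq_existsb => -[].
apply: measurable_sumr => j _; apply: measurable_bool_natr.
apply: measurable_or; first exact: measurable_cst.
apply: (@measurable_existsb _ _ R bool) => s.
apply: (@measurable_existsb _ _ R bool) => a.
apply: (@measurable_existsb _ _ R bool) => b.
exact: (measurableT_comp (measurable_linked _ _ _) (measurable_cfg_mixs _ _ _)).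
Qed.

(** The configuration is the same for all [j], so the count is a function of one tuple having the
    law of the sample. *)
Lemma count_linked_moment s b :
  (\sum_i ge0_ex Q2 (fun w => count (fun i y z => count_linked k A i y z s b) i w ^+ q.+1)%R
    <= bound%:E)%E.
Proof.
pose H i (x : n.-tuple E) : R := (\sum_(j | j \notin A) (linked k.+1 x i j)%:R) ^+ q.+1.
have mH i : measurable_fun setT (H i).
  apply: measurable_funX; apply: measurable_sumr => j _; apply: measurable_bool_natr.
  exact: measurable_linked.
have H0 i x : 0 <= H i x by rewrite exprn_ge0// sumr_ge0.
have HE i : ge0_ex Q2 (fun w => count (fun i y z => count_linked k A i y z s b) i w ^+ q.+1)%R =
    ge0_ex P (fun w => H i (sample X w)).
  rewrite -(ge0_ex_cfg indep (base_set A s) (if b then [set i]%SET else finset.set0) (mH i))//.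
  by congr (ge0_ex _ _); apply/funext => w; rewrite /count /count_linked natr_sum; case: b.
rewrite (eq_bigr _ (fun i _ => HE i)); apply: sum_sample_bound => // x dp ne.
apply: (@le_trans _ _ (\sum_i (\sum_(j | j \notin A) linked K x i j) ^ q.+1)%N%:R).
  rewrite natr_sum; apply: ler_sum => i _; rewrite natrX.
  apply: lerXn2r; rewrite ?nnegrE ?sumr_ge0// natr_sum; apply: ler_sum => j _.
  rewrite ler_nat; case: (boolP (linked k.+1 x i j)) => // h.
  by rewrite (linked_weaken _ h)// /K -addn1 leq_add2l.
by rewrite ler_nat; exact: sum_linked_pow cov dp ne q.
Qed.

(** The two configurations differ only on [J] without [j], that is in at most 3 points. *)
Let nb_cfg (B J : {set 'I_n}) (y : n.-tuple (E * E)) j l m :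
  j \in J -> l \notin (J :\ j)%SET -> m \notin (J :\ j)%SET ->
  (#|J| <= q.+1)%N -> nb k.+1 (cfg (j |: B)%SET y) l m -> nb K (cfg (J :|: B)%SET y) l m.
Proof.
move=> jJ lJ mJ Jq h.
apply: (@nb_weaken _ _ _ (k.+1 + #|(J :\ j)%SET|)).
  by move: Jq q4; rewrite (cardsD1 j) jJ /K; lia.
apply: (nb_agree _ lJ mJ h).
apply: cfg_agree => p; rewrite !inE.
by have [->|] := eqVneq p j; rewrite ?jJ//= => _ /negbTE ->.
Qed.

(** The configuration varies with [j], so powers are compared through [swap_moment]. Excluding
    [j = i] keeps [i] out of the swapped set, as required for comparing ranks. *)
Lemma count_in_moment s b :
  (\sum_i ge0_ex Q2 (fun w => count (fun i y z => count_in k A i y z s b) i w ^+ q.+1)%R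
    <= bound%:E)%E.
Proof.
pose al i j := (j \notin A) && (j != i).
pose H i (x : n.-tuple E) : R := 1 * (\sum_(j | al i j) (nb K x j i)%:R) ^+ q.+1.
have mH i : measurable_fun setT (H i).
  apply: measurable_funM => //.
  apply: measurable_funX; apply: measurable_sumr => j _; apply: measurable_bool_natr.
  exact: measurable_nb.
have H0 i x : 0 <= H i x by rewrite /H mul1r exprn_ge0// sumr_ge0.
have HE i : (ge0_ex Q2 (fun w => count (fun i y z => count_in k A i y z s b) i w ^+ q.+1)%R <=
    ge0_ex P (fun w => H i (sample X w)))%E.
  have := @swap_moment _ _ _ P _ _ X indep (base_set A s) (if b then [set i]%SET else finset.set0)
    (al i) q.+1 (fun j x => nb k.+1 x j i) (fun j x => nb K x j i) predT predT.
  move=> h; apply: le_trans (h _ _ _ _ _) => {h}.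
  - rewrite le_eqVlt; apply/orP; left; apply/eqP.
    congr (ge0_ex _ _); apply/funext => w; rewrite /count /count_in natr_sum /= mul1r.
    rewrite big_mkcondr /=; congr (_ ^+ _); apply: eq_bigr => j _.
    by case: (j != i) => //; case: b.
  - by move=> j; exact: measurable_nb.
  - by move=> j; exact: measurable_nb.
  - exact: measurable_cst.
  - exact: measurable_cst.
  move=> y J Jal Jq; split => // j jJ; apply: nb_cfg => //; first by rewrite !inE eqxx.
  by apply/negP; rewrite !inE => /andP[_ /Jal]; rewrite unfold_in /al eqxx andbF.
apply: le_trans (lee_sum _ (fun i _ => HE i)) _; apply: sum_sample_bound => // x dp ne.
apply: (@le_trans _ _ (\sum_i (\sum_(j | j \notin A) nb K x j i) ^ q.+1)%N%:R).
  rewrite natr_sum; apply: ler_sum => i _; rewrite natrX /H mul1r.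
  apply: lerXn2r; rewrite ?nnegrE ?sumr_ge0// natr_sum /al big_mkcondr /=.
  by apply: ler_sum => j _; case: ifP.
by rewrite ler_nat; exact: sum_in_pow cov dp ne q.
Qed.

(** The outer sum runs over the indices [l] having [i] as a neighbor in a configuration independent
    of [j]; power means extract it, and [swap_moment] handles the inner sum for each [l], with the
    neighbor relation between [l] and [i] as the extra event. *)
Lemma count_out_moment s b :
  (\sum_i ge0_ex Q2 (fun w => count (fun i y z => count_out k A i y z s b) i w ^+ q.+1)%R
    <= bound%:E)%E.
Proof.
pose B := base_set A s; pose r i : {set 'I_n} := if b then [set i]%SET else finset.set0.
pose al i l j := [&& j \notin A, j != i & j != l].
pose G i l (w : (T * T) * (T * T)) : R := (nb k.+2 (cfg B (Y (r i) w)) l i)%:R *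
  (\sum_(j | al i l j) (nb k.+1 (cfg (j |: B)%SET (Y (r i) w)) l j)%:R) ^+ q.+1.
pose H i l (x : n.-tuple E) : R :=
  (nb K x l i)%:R * (\sum_(j | al i l j) (nb K x l j)%:R) ^+ q.+1.
have mG i l : measurable_fun setT (G i l).
  apply: measurable_funM.
    by apply: measurable_bool_natr; exact: (measurableT_comp (measurable_nb _ _ _) (measurable_cfg_mixs _ _ _)).
  apply: measurable_funX; apply: measurable_sumr => j _; apply: measurable_bool_natr.
  exact: (measurableT_comp (measurable_nb _ _ _) (measurable_cfg_mixs _ _ _)).
have G0 i l w : 0 <= G i l w by rewrite mulr_ge0// exprn_ge0// sumr_ge0.
have mH i l : measurable_fun setT (H i l).
  apply: measurable_funM; first by apply: measurable_bool_natr; exact: measurable_nb.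
  apply: measurable_funX; apply: measurable_sumr => j _; apply: measurable_bool_natr.
  exact: measurable_nb.
have H0 i l x : 0 <= H i l x by rewrite mulr_ge0// exprn_ge0// sumr_ge0.
have mHX i l : measurable_fun setT (fun w => H i l (sample X w)).
  exact: (measurableT_comp (mH i l) (measurable_tup X)).
have GH i l : (ge0_ex Q2 (G i l) <= ge0_ex P (fun w => H i l (sample X w)))%E.
  apply: (@swap_moment _ _ _ P _ _ X indep B (r i) (al i l) q.+1 (fun j x => nb k.+1 x l j)
    (fun j x => nb K x l j) (fun x => nb k.+2 x l i) (fun x => nb K x l i)).
  - by move=> j; exact: measurable_nb.
  - by move=> j; exact: measurable_nb.
  - exact: measurable_nb.
  - exact: measurable_nb.
  move=> y J Jal Jq.
  have lJ : l \notin J by apply/negP => /Jal; rewrite unfold_in /al eqxx !andbF.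
  have iJ : i \notin J by apply/negP => /Jal; rewrite unfold_in /al eqxx !andbF.
  split => [j jJ|h].
    by apply: nb_cfg => //; rewrite !inE ?eqxx// (negbTE lJ) andbF.
  apply: (@nb_weaken _ _ _ (k.+2 + #|J|)); first by move: Jq q4; rewrite /K; lia.
  apply: (nb_agree _ lJ iJ h).
  by apply: cfg_agree => p; rewrite !inE => /negbTE ->.
have mS i : measurable_fun setT (fun w => \sum_l G i l w) by apply: measurable_sumr.
have CG i : (ge0_ex Q2 (fun w => count (fun i y z => count_out k A i y z s b) i w ^+ q.+1)%R <=
    (D ^ q)%:R%:E * ge0_ex Q2 (fun w => \sum_l G i l w)%R)%E.
  have cE w : count (fun i y z => count_out k A i y z s b) i w =
      \sum_(l | nb k.+2 (cfg B (Y (r i) w)) l i)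
        \sum_(j | al i l j) (nb k.+1 (cfg (j |: B)%SET (Y (r i) w)) l j)%:R.
    rewrite /count /count_out natr_sum [RHS]big_mkcond /=; apply: eq_bigr => l _.
    rewrite -/B /r; case: (b).
      rewrite natrM natr_sum; case: (nb k.+2 _ _ _); rewrite ?mul0r// mul1r.
      rewrite [RHS]big_mkcondr [RHS]big_mkcond [LHS]big_mkcond /=.
      by apply: eq_bigr => j _; rewrite /al; do !case: (_ \notin _); case: (_ != i); case: (_ != l).
    rewrite natrM natr_sum; case: (nb k.+2 _ _ _); rewrite ?mul0r// mul1r.
    rewrite [RHS]big_mkcondr [RHS]big_mkcond [LHS]big_mkcond /=.
    by apply: eq_bigr => j _; rewrite /al; do !case: (_ \notin _); case: (_ != i); case: (_ != l).
  rewrite -ge0_ex_scale//; last by move=> w; rewrite sumr_ge0.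
  apply: ge0_ex_le.
  - by apply: measurable_funX; exact: measurable_count_out.
  - by apply: measurable_funM.
  - by move=> w; rewrite exprn_ge0// ler0n.
  - by move=> w; rewrite mulr_ge0// sumr_ge0.
  apply: (almost_surely_sub _ (ae_good_cfg indep good)) => w /(_ (B, r i)) [/= dp ne].
  (* Almost surely the configuration is in general position, so at most [D] indices [l] enter and
     power means cost [D ^ q]. *)
  rewrite cE; apply: le_trans (power_mean _ _ _) _; first by move=> l; rewrite sumr_ge0.
  rewrite [X in _ * X <= _]big_mkcond /= ; apply: ler_pM.
  - by rewrite exprn_ge0.
  - by apply: sumr_ge0 => l _; case: ifP => // _; rewrite exprn_ge0// sumr_ge0.
  - rewrite natrX; apply: lerXn2r; rewrite ?nnegrE// ler_nat.
    apply: leq_trans (card_nb_in k.+2 i cov dp ne) _.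
    by rewrite /D leq_add2l leq_mul2l /K; apply/orP; right; lia.
  by apply: ler_sum => l _; rewrite /G; case: ifP => _; rewrite ?mul1r// mul0r.
apply: le_trans (lee_sum _ (fun i _ => CG i)) _.
rewrite -ge0_sume_distrr; last first.
  by move=> i _; apply: integral_ge0 => w _; rewrite lee_fin sumr_ge0.
have -> : bound = (D ^ q)%:R * (#|(~: A)%SET| * (D * K.+1 ^ q.+1))%:R.
  by rewrite /bound /kappa -natrM expnMn (expnSr D); congr (_%:R); ring.
rewrite EFinM lee_wpmul2l//.
apply: (@le_trans _ _ (\sum_i ge0_ex P (fun w => \sum_l H i l (sample X w))%R)%E).
  apply: lee_sum => i _; rewrite !ge0_ex_sum//.
  by apply: lee_sum => l _; exact: GH.
apply: (@sum_sample_bound (fun i x => \sum_l H i l x)) => //.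
- by move=> i; apply: measurable_sumr.
- by move=> i x; rewrite sumr_ge0.
move=> x dp ne.
apply: (@le_trans _ _ (\sum_i \sum_l nb K x l i * (\sum_(j | j \notin A) nb K x l j) ^ q.+1)%N%:R).
  rewrite natr_sum; apply: ler_sum => i _; rewrite natr_sum; apply: ler_sum => l _.
  rewrite natrM natrX ler_wpM2l//.
  apply: lerXn2r; rewrite ?nnegrE ?sumr_ge0// natr_sum /al big_mkcondr /=.
  by apply: ler_sum => j _; case: ifP.
by rewrite ler_nat; exact: sum_out_pow cov dp ne q.
Qed.

(** The 12 terms are the three kinds of counts for each of the four values of [(s, b)]: power means
    give [12 ^+ q], and the sum of their moments a further 12. *)
Lemma touched_moment :
  (\sum_i ge0_ex Q2 (fun w =>
     count (fun i y z => (\sum_(j | j \notin A) touched k A i y z j)%N) i w ^+ q.+1)%R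
    <= (12 ^+ q.+1 * bound)%:E)%E.
Proof.
pose c1 s b i w := count (fun i y z => count_linked k A i y z s b) i w ^+ q.+1.
pose c2 s b i w := count (fun i y z => count_in k A i y z s b) i w ^+ q.+1.
pose c3 s b i w := count (fun i y z => count_out k A i y z s b) i w ^+ q.+1.
pose c i w := \sum_(sb : bool * bool) (c1 sb.1 sb.2 i w + c2 sb.1 sb.2 i w + c3 sb.1 sb.2 i w).
have mc1 s b i : measurable_fun setT (c1 s b i) by by apply: measurable_funX; exact: measurable_count_linked.
have mc2 s b i : measurable_fun setT (c2 s b i) by by apply: measurable_funX; exact: measurable_count_in.
have mc3 s b i : measurable_fun setT (c3 s b i) by by apply: measurable_funX; exact: measurable_count_out.
have c10 s b i w : 0 <= c1 s b i w by rewrite exprn_ge0// ler0n.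
have c20 s b i w : 0 <= c2 s b i w by rewrite exprn_ge0// ler0n.
have c30 s b i w : 0 <= c3 s b i w by rewrite exprn_ge0// ler0n.
have msb i (sb : bool * bool) : measurable_fun setT (fun w =>
    c1 sb.1 sb.2 i w + c2 sb.1 sb.2 i w + c3 sb.1 sb.2 i w).
  by apply: measurable_funD => //; apply: measurable_funD.
have mc i : measurable_fun setT (c i) by apply: measurable_sumr.
have sb0 i (sb : bool * bool) w : 0 <= c1 sb.1 sb.2 i w + c2 sb.1 sb.2 i w + c3 sb.1 sb.2 i w.
  by rewrite !addr_ge0.
have c0 i w : 0 <= c i w by apply: sumr_ge0.
have ex3 i s b : ge0_ex Q2 (fun w => c1 s b i w + c2 s b i w + c3 s b i w)%R =
    (ge0_ex Q2 (c1 s b i) + ge0_ex Q2 (c2 s b i) + ge0_ex Q2 (c3 s b i))%E.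
  rewrite ge0_exD//; last by move=> w; rewrite addr_ge0.
    by rewrite ge0_exD.
  exact: measurable_funD.
have exc : (\sum_i ge0_ex Q2 (c i) <= (12 * bound)%:E)%E.
  under eq_bigr => i _ do rewrite ge0_ex_sum//.
  rewrite exchange_big /=.
  have -> : (12 * bound)%:E = (\sum_(sb : bool * bool) (3 * bound)%:E)%E.
    by rewrite sumEFin sumr_const card_prod card_bool; congr EFin; rewrite -mulr_natl; ring.
  apply: lee_sum => -[s b] _ /=; under eq_bigr => i _ do rewrite ex3.
  rewrite big_split /= big_split /= (_ : 3 * bound = bound + bound + bound); last by ring.
  rewrite !EFinD; apply: leeD; first apply: leeD.
  - exact: count_linked_moment.
  - exact: count_in_moment.
  - exact: count_out_moment.
apply: (@le_trans _ _ ((12 ^+ q)%:E * \sum_i ge0_ex Q2 (c i))%E); last first.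
  by rewrite exprSr -mulrA EFinM lee_wpmul2l// lee_fin exprn_ge0.
rewrite ge0_sume_distrr; last by move=> i _; apply: integral_ge0 => w _; rewrite lee_fin.
apply: lee_sum => i _; rewrite -ge0_ex_scale ?exprn_ge0//; apply: ge0_ex_le.
- by apply: measurable_funX; exact: measurable_touched_count.
- exact: measurable_funM.
- by move=> w; rewrite exprn_ge0// ler0n.
- by move=> w; rewrite mulr_ge0// exprn_ge0.
apply: aeW => w.
pose b3 (sb : bool * bool) : R := (count_linked k A i (Y finset.set0 w) (Y [set i]%SET w) sb.1 sb.2)%:R
  + (count_in k A i (Y finset.set0 w) (Y [set i]%SET w) sb.1 sb.2)%:R
  + (count_out k A i (Y finset.set0 w) (Y [set i]%SET w) sb.1 sb.2)%:R.
apply: (@le_trans _ _ ((\sum_sb b3 sb) ^+ q.+1)).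
  apply: lerXn2r; rewrite ?nnegrE ?ler0n ?sumr_ge0//; first by move=> sb _; rewrite !addr_ge0.
  apply: (@le_trans _ _ (\sum_(s : bool) \sum_(b : bool)
     (count_linked k A i (Y finset.set0 w) (Y [set i]%SET w) s b
     + count_in k A i (Y finset.set0 w) (Y [set i]%SET w) s b
     + count_out k A i (Y finset.set0 w) (Y [set i]%SET w) s b))%N%:R).
    by rewrite ler_nat; exact: touched_count.
  rewrite pair_big /= natr_sum; apply: ler_sum => sb _.
  by rewrite !natrD.
apply: le_trans (power_mean _ _ _) _; first by move=> sb; rewrite !addr_ge0.
rewrite card_prod card_bool (_ : 12 = 4 * 3 :> R); last by ring.
rewrite exprMn -mulrA ler_wpM2l ?exprn_ge0//.
rewrite mulr_sumr; apply: ler_sum => sb _.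
exact: cube_split.
Qed.

End touched_moments.

(** * The local statistic *)

Lemma pow_le_1DpowR {R : realType} (x p : R) (q : nat) : 0 <= x -> q%:R <= p ->
  x ^+ q <= 1 + x `^ p.
Proof.
move=> x0 qp; have [x1|x1] := leP x 1.
  by apply: le_trans (exprn_ile1 _ x0 x1) _; rewrite lerDl powR_ge0.
apply: (@le_trans _ _ (x `^ p)); last by rewrite lerDr.
by rewrite -powR_mulrn// ler_powR// ltW.
Qed.

(** Separates the size [x] of the values from the number [s] of altered products, which are
    dependent. Beyond 1, Young's inequality produces [x^8], hence the threshold 8 for [p]. *)
Lemma quartic_square_bound {R : realType} (x s p : R) : 0 <= x -> 0 <= s -> 8 <= p ->
  x ^+ 4 * s ^+ 2 <= s ^+ 2 + s ^+ 4 + x `^ p.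
Proof.
move=> x0 s0 p8; have s2 : 0 <= s ^+ 2 by rewrite exprn_ge0.
have s4 : 0 <= s ^+ 4 by rewrite exprn_ge0.
have xp : 0 <= x `^ p by rewrite powR_ge0.
have [x1|x1] := leP x 1.
  have : x ^+ 4 * s ^+ 2 <= 1 * s ^+ 2 by rewrite ler_wpM2r// exprn_ile1.
  lra.
have : x ^+ 8 <= x `^ p by rewrite -powR_mulrn// ler_powR// ltW.
have : 0 <= (x ^+ 4 - s ^+ 2) ^+ 2 by rewrite sqr_ge0.
have -> : (x ^+ 4 - s ^+ 2) ^+ 2 = x ^+ 8 - 2 * (x ^+ 4 * s ^+ 2) + s ^+ 4 by ring.
have : 0 <= x ^+ 4 * s ^+ 2 by rewrite mulr_ge0// exprn_ge0.
lra.
Qed.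

Lemma powR_le_root {R : realType} (a q p : R) : 0 < p -> 0 <= a -> a `^ p <= q ->
  a <= q `^ p^-1.
Proof.
move=> p0 a0 aq; have q0 : 0 <= q by apply: le_trans aq; exact: powR_ge0.
rewrite -[a]powRr1// -(divff (lt0r_neq0 p0)) powRrM.
by apply: ge0_ler_powR => //; rewrite ?invr_ge0 ?nnegrE ?powR_ge0// ltW.
Qed.

Lemma powR_root {R : realType} (q p : R) : p != 0 -> 0 <= q -> (q `^ p^-1) `^ p = q.
Proof. by move=> p0 q0; rewrite -powRrM mulVf// powRr1. Qed.

Lemma powR_div_root {R : realType} (q r p : R) : p != 0 -> 0 <= q -> 0 < r ->
  (q `^ p^-1 / r `^ p^-1) `^ p = q / r.
Proof.
move=> p0 q0 r0; have rp : 0 < r `^ p^-1 by exact: powR_gt0.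
apply: (canRL (mulfK (lt0r_neq0 r0))).
rewrite -{2}(powR_root p0 (ltW r0)) -powRM ?divr_ge0 ?powR_ge0//.
by rewrite divfK ?lt0r_neq0// powR_root.
Qed.

Lemma sum_fine_le {R : realType} {I : finType} (a : I -> \bar R) (c : R) :
  (forall i, 0 <= a i)%E -> (\sum_i a i <= c%:E)%E -> \sum_i fine (a i) <= c.
Proof.
move=> a0 ac; rewrite -lee_fin -sumEFin (eq_bigr a)// => i _; rewrite fineK//.
rewrite ge0_fin_numE//; apply: le_lt_trans (ltry c); apply: le_trans ac.
by rewrite (bigD1 i)//= leeDl// sume_ge0.
Qed.

Lemma sumr_constR {R : pzSemiRingType} {I : finType} (L : pred I) (c : R) :
  \sum_(i | L i) c = #|L|%:R * c.
Proof. by rewrite sumr_const mulr_natl. Qed.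

Lemma ge0_ex_sum_le {dT} {T : measurableType dT} {R : realType} (P : probability T R)
  (I : Type) (r : seq I) (L : pred I) (f : I -> T -> R) (c : I -> R) :
  (forall i, L i -> measurable_fun setT (f i)) -> (forall i w, L i -> 0 <= f i w) ->
  (forall i, L i -> ge0_ex P (f i) <= (c i)%:E)%E ->
  (ge0_ex P (fun w => \sum_(i <- r | L i) f i w)%R <= (\sum_(i <- r | L i) c i)%R%:E)%E.
Proof.
move=> mf f0 fc; elim: r => [|i r IH].
  by under eq_fun do rewrite big_nil; rewrite big_nil /ge0_ex integral0.
have [Li|nLi] := boolP (L i); last first.
  by under eq_fun do rewrite big_cons (negbTE nLi); rewrite big_cons (negbTE nLi).
under eq_fun do rewrite big_cons Li; rewrite big_cons Li EFinD ge0_exD.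
- by apply: leeD => //; exact: fc.
- exact: mf.
- exact: measurable_sumr.
- by move=> w; exact: f0.
- by move=> w; apply: sumr_ge0 => j; exact: f0.
Qed.

Section local_statistic.
Context {dT} {T : measurableType dT} {R : realType} (P : probability T R).
Context {n d : nat} (X : 'I_n -> {RV P >-> d.-tuple R}).
Hypothesis indep : independent_rvs X.
Local Notation E := (d.-tuple R).
Local Notation Q := (P \x P)%E.
Local Notation Q2 := (Q \x Q)%E.
Local Notation Y := (mixs (pairs X)).
Hypothesis good : almost_surely P (fun w => @good_tuple R n d (sample X w)).
Variables (alpha k : nat) (f_ : 'I_n -> {mfun n.-tuple E >-> R}) (p gamma : R).
Hypothesis cov : cone60_cover R d alpha.
Hypothesis n0 : (0 < n)%N.
Hypothesis kf : forall l, knn_function k l (f_ l).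
Hypotheses (p8 : 8 <= p) (gamma0 : 0 < gamma).
Hypothesis mom_f : forall l, (ge0_ex P (fun w => `|f_ l (sample X w)| `^ p)%R <= gamma%:E)%E.
Let K := (k + 6)%N.
Let D := (1 + alpha * K)%N.
Let kappa := (D * K.+1)%N.
Let F (x : n.-tuple E) : R := (Num.sqrt n%:R)^-1 * \sum_l f_ l x.

Let mfp l : measurable_fun setT (fun x : n.-tuple E => `|f_ l x| `^ p).
Proof.
exact: (measurableT_comp (measurable_powR p) (measurableT_comp (@normr_measurable R setT) (measurable_funPT (f_ l)))).
Qed.

Lemma measurable_statistic : measurable_fun setT F.
Proof. by apply: measurable_funM => //; apply: measurable_sumr. Qed.

Lemma mom_statistic : mom P 4 (F \o tup X).
Proof.
apply: momZ; apply: mom_sum => l _.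
have mfl : measurable_fun setT (f_ l \o tup X) by apply: measurableT_comp => //; exact: measurable_tup.
have mX : measurable_fun setT (fun w => `|f_ l (sample X w)| `^ p).
  exact: (measurableT_comp (mfp l) (measurable_tup X)).
apply: (mom_dominated (q' := 1) (g := fun w => `|f_ l (sample X w)| `^ p)) => //.
  split=> //; apply: le_lt_trans (ltry gamma); apply: le_trans (mom_f l).
  rewrite /ge0_ex le_eqVlt; apply/orP; left; apply/eqP; apply: eq_integral => w _.
  by rewrite expr1 ger0_norm// powR_ge0.
move=> w; rewrite expr1 (ger0_norm (powR_ge0 _ _)); apply: pow_le_1DpowR => //.
by apply: le_trans p8; rewrite ler_nat.
Qed.

Section swap_sum_variance.
Variable A : {set 'I_n}.
Let N : R := #|(~: A)%SET|%:R.
Let y (w : (T * T) * (T * T)) := Y finset.set0 w.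
Let z i (w : (T * T) * (T * T)) := Y [set i]%SET w.
Let S i w : R := (\sum_(j | j \notin A) touched k A i (y w) (z i w) j)%N%:R.
Let conf i w (c : bool * bool * bool) j := square_conf A (y w) (z i w) c.1.1 j c.1.2 c.2.
(** A sum of [p]-th powers over all summands and configurations: its [p]-th root bounds every value
    at once, and its expectation is additive. *)
Let q i w : R := \sum_(j | j \notin A) \sum_l \sum_c `|f_ l (conf i w c j)| `^ p.
(** The normalization for which the sum over [i] of the expectations of [q i / r] is at most [8 N],
    the order in [N] of the normalized moments of the counts. *)
Let r : R := n%:R ^+ 2 * gamma.
Let m : R := r `^ p^-1.

Let p_gt0 : 0 < p. Proof. by apply: lt_le_trans p8. Qed.
Let nR0 : 0 < n%:R :> R. Proof. by rewrite ltr0n. Qed.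
Let r0 : 0 < r. Proof. by rewrite mulr_gt0// exprn_gt0. Qed.
Let kappa0 : 0 < kappa%:R :> R. Proof. by rewrite ltr0n /kappa /D. Qed.

Let confE i w s a b j : conf i w (s, a, b) j =
  cfg (if a then j |: base_set A s else base_set A s)%SET
      (Y (if b then [set i]%SET else finset.set0) w).
Proof. by rewrite /conf /square_conf; case: b. Qed.

Let mconf i c j l : measurable_fun setT (fun w => `|f_ l (conf i w c j)| `^ p).
Proof.
case: c => -[s a] b; under eq_fun do rewrite confE.
exact: (measurableT_comp (mfp l) (measurable_cfg_mixs _ _ _)).
Qed.

Let mq i : measurable_fun setT (q i).
Proof.
by apply: measurable_sumr => j _; apply: measurable_sumr => l _; apply: measurable_sumr.
Qed.

Let q0 i w : 0 <= q i w.
Proof. by do 3 (apply: sumr_ge0 => ? _); exact: powR_ge0. Qed.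

Let card_notin : #|[pred j | j \notin A]| = #|(~: A)%SET|.
Proof. by apply: eq_card => j; rewrite !inE. Qed.

Let sum_q i : (ge0_ex Q2 (q i) <= (8 * N * n%:R * gamma)%:E)%E.
Proof.
have -> : 8 * N * n%:R * gamma = \sum_(j | j \notin A) \sum_(l < n) \sum_(c : bool * bool * bool) gamma.
  rewrite !sumr_constR !card_prod !card_bool card_ord card_notin /N.
  by rewrite (_ : (2 * 2 * 2)%N = 8%N)//; ring.
apply: (@ge0_ex_sum_le _ _ _ Q2 _ _ _
  (fun j w => \sum_l \sum_c `|f_ l (conf i w c j)| `^ p)
  (fun=> \sum_(l < n) \sum_(c : bool * bool * bool) gamma)).
- by move=> j _; apply: measurable_sumr => l _; apply: measurable_sumr.
- by move=> j w _; do 2 (apply: sumr_ge0 => ? _); exact: powR_ge0.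
move=> j jA; apply: (@ge0_ex_sum_le _ _ _ Q2 _ _ _
  (fun l w => \sum_c `|f_ l (conf i w c j)| `^ p)
  (fun=> \sum_(c : bool * bool * bool) gamma)).
- by move=> l _; apply: measurable_sumr.
- by move=> l w _; apply: sumr_ge0 => ? _; exact: powR_ge0.
move=> l _; apply: (@ge0_ex_sum_le _ _ _ Q2 _ _ _
  (fun c w => `|f_ l (conf i w c j)| `^ p) (fun=> gamma)).
- by [].
- by move=> c w _; exact: powR_ge0.
move=> [[s a] b] _; apply: le_trans (mom_f l).
rewrite -(ge0_ex_cfg indep (if a then j |: base_set A s else base_set A s)%SET
  (if b then [set i]%SET else finset.set0) (mfp l)); last by move=> x; exact: powR_ge0.
rewrite le_eqVlt; apply/orP; left; apply/eqP; congr (ge0_ex _ _).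
by apply/funext => w; rewrite confE.
Qed.

Let m0 : 0 < m. Proof. exact: powR_gt0. Qed.

Let b00 : 0 <= 32 ^+ 2 * n%:R ^- 2 * D%:R ^+ 4 * m ^+ 4 * kappa%:R ^+ 2.
Proof.
have c0 : 0 <= 32 ^+ 2 :> R by rewrite exprn_ge0// ler0n.
by do 4 (apply: mulr_ge0; last by rewrite ?invr_ge0 exprn_ge0// ltW).
Qed.

(** The values are measured in units of [m] and the counts in units of [kappa]; each of the three
    terms then sums over [i] to a multiple of [N]. The factor [32 ^+ 2] is [(2 * 4 ^+ 2) ^+ 2], from
    the bound on products. *)
Let pair_sum_sqr i w : (forall BC : ({set 'I_n} * {set 'I_n})%type, good_tuple (cfg BC.1 (Y BC.2 w))) ->
  (pair_sum F A (y w) - pair_sum F A (z i w)) ^+ 2 <=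
  (32 ^+ 2 * n%:R ^- 2 * D%:R ^+ 4 * m ^+ 4 * kappa%:R ^+ 2) *
  (kappa%:R ^- 2 * S i w ^+ 2 + kappa%:R ^- 4 * S i w ^+ 4 + r^-1 * q i w).
Proof.
move=> gw; pose M := q i w `^ p^-1.
have M0 : 0 <= M by exact: powR_ge0.
have S0 : 0 <= S i w by exact: ler0n.
have yz j : j != i -> tnth (y w) j = tnth (z i w) j.
  by move=> ji; rewrite !tnth_mktuple !inE (negbTE ji).
have c0 : 0 <= (Num.sqrt n%:R)^-1 :> R by rewrite invr_ge0 sqrtr_ge0.
have fM s j a b l : j \notin A -> `|f_ l (square_conf A (y w) (z i w) s j a b)| <= M.
  move=> jA; apply: powR_le_root => //; rewrite /q (bigD1 j)//= (bigD1 l)//=.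
  rewrite (bigD1 (s, a, b))//= -!addrA lerDl !addr_ge0//.
  - by apply: sumr_ge0 => ? _; exact: powR_ge0.
  - by do 2 (apply: sumr_ge0 => ? _); exact: powR_ge0.
  - by do 3 (apply: sumr_ge0 => ? _); exact: powR_ge0.
have nD s j a b : j \notin A -> (\sum_l nb k (square_conf A (y w) (z i w) s j a b) l j <= D)%N.
  move=> jA; rewrite sum_bool_card.
  have [dp ne] : good_tuple (square_conf A (y w) (z i w) s j a b).
    have := gw ((if a then j |: base_set A s else base_set A s)%SET,
      (if b then [set i]%SET else finset.set0)).
    by rewrite /= /square_conf; case: b.
  apply: leq_trans (card_nb_in k j cov dp ne) _.
  by rewrite /D leq_add2l leq_mul2l /K leq_addr orbT.
have := pair_sum_difference kf c0 (fun x => erefl (F x)) yz M0 fM nD.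
move=> /(lerXn2r 2) h; have {h} := h _ _; rewrite !nnegrE ?mulr_ge0 ?exprn_ge0 ?mulr_ge0//.
move=> /(_ (normr_ge0 _) isT); rewrite real_normK ?num_real// => h; apply: le_trans h _.
have sqrtn : (Num.sqrt n%:R) ^- 4 = n%:R ^- 2 :> R.
  by rewrite -[4%N]/(2 * 2)%N exprM sqr_sqrtr// ler0n.
have := quartic_square_bound (divr_ge0 M0 (ltW m0)) (divr_ge0 S0 (ltW kappa0)) p8.
rewrite powR_div_root ?lt0r_neq0// => h.
have e1 : (2 * (4 * (Num.sqrt n%:R)^-1 * D%:R * M) ^+ 2 * S i w) ^+ 2 =
  (32 ^+ 2 * n%:R ^- 2 * D%:R ^+ 4 * m ^+ 4 * kappa%:R ^+ 2) *
    ((M / m) ^+ 4 * (S i w / kappa%:R) ^+ 2).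
  rewrite -sqrtn !expr_div_n.
  have mm : m ^+ 4 / m ^+ 4 = 1 by rewrite divff// expf_neq0// lt0r_neq0.
  have kk : kappa%:R ^+ 2 / kappa%:R ^+ 2 = 1 :> R by rewrite divff// expf_neq0// lt0r_neq0.
  transitivity (32 ^+ 2 * (Num.sqrt n%:R) ^- 4 * D%:R ^+ 4 * M ^+ 4 * S i w ^+ 2 *
    (m ^+ 4 / m ^+ 4) * (kappa%:R ^+ 2 / kappa%:R ^+ 2)); last by ring.
  by rewrite mm kk !mulr1 -exprVn; ring.
rewrite [leLHS]e1; apply: ler_wpM2l.
  exact: b00.
by apply: le_trans h _; rewrite !expr_div_n; lra.
Qed.

Lemma swap_sum_variance :
  \int[Q]_w (swap_sum X F A w ^+ 2) - (\int[Q]_w swap_sum X F A w) ^+ 2 <=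
  (32 * 12 ^+ 2 * (D%:R ^+ 2 * kappa%:R * n%:R^-1 * m ^+ 2) * Num.sqrt N) ^+ 2.
Proof.
have mpair : measurable_fun setT (pair_sum F A).
  have mc B : measurable_fun setT (fun v => F (cfg B v)).
    exact: (measurableT_comp measurable_statistic (measurable_cfg B)).
  by apply: measurable_sumr => j _; apply: measurable_funM; apply: measurable_funB.
have swE w : pair_sum F A (tup (pairs X) w) = swap_sum X F A w.
  by rewrite /pair_sum /swap_sum; apply: eq_bigr => j _; rewrite !cfg_tup.
have mom2 : mom Q 2 (pair_sum F A \o tup (pairs X)).
  have := mom_swap_sum (swappable_indep indep) measurable_statistic mom_statistic A.
  by congr (mom _ _ _); apply/funext => w; rewrite /= swE.
have := efron_stein (swappable_pairs indep) mpair mom2.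
under eq_Rintegral do rewrite swE.
under [X in _ - X ^+ 2 <= _ -> _]eq_Rintegral do rewrite swE.
move=> h; apply: (le_trans h) => {h}.
pose b0 : R   := 32 ^+ 2 * n%:R ^- 2 * D%:R ^+ 4 * m ^+ 4 * kappa%:R ^+ 2.
pose u i w := (pair_sum F A (y w) - pair_sum F A (z i w)) ^+ 2.
have mu i : measurable_fun setT (u i).
  by apply: measurable_funX; apply: measurable_funB;
    exact: (measurableT_comp mpair (measurable_mixs _ _)).
have mS i : measurable_fun setT (S i) by exact: measurable_touched_count.
have k0 q' : 0 <= kappa%:R ^- q' :> R by rewrite invr_ge0 exprn_ge0// ltW.
pose t2 i w := kappa%:R ^- 2 * S i w ^+ 2.
pose t4 i w := kappa%:R ^- 4 * S i w ^+ 4.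
pose tq i w := r^-1 * q i w.
have m2 i : measurable_fun setT (t2 i) by apply: measurable_funM => //; exact: measurable_funX.
have m4 i : measurable_fun setT (t4 i) by apply: measurable_funM => //; exact: measurable_funX.
have mtq i : measurable_fun setT (tq i) by exact: measurable_funM.
have t20 i w : 0 <= t2 i w by rewrite mulr_ge0// exprn_ge0// ler0n.
have t40 i w : 0 <= t4 i w by rewrite mulr_ge0// exprn_ge0// ler0n.
have tq0 i w : 0 <= tq i w by rewrite mulr_ge0// invr_ge0 ltW.
have ub i : (ge0_ex Q2 (u i) <=
    b0%:E * (ge0_ex Q2 (t2 i) + ge0_ex Q2 (t4 i) + ge0_ex Q2 (tq i)))%E.
  rewrite -!ge0_exD//; last 2 first.
  - exact: measurable_funD.
  - by move=> w; rewrite addr_ge0.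
  rewrite -ge0_ex_scale//; last 2 first.
  - by apply: measurable_funD => //; exact: measurable_funD.
  - by move=> w; rewrite !addr_ge0.
  apply: ge0_ex_le => //.
  - apply: measurable_funM => //.
    by apply: measurable_funD => //; exact: measurable_funD.
  - by move=> w; rewrite sqr_ge0.
  - by move=> w; rewrite mulr_ge0// !addr_ge0.
  by apply: (almost_surely_sub _ (ae_good_cfg indep good)) => w; exact: pair_sum_sqr.
have touch q' : (q'.+1 <= 4)%N ->
    (\sum_i ge0_ex Q2 (fun w => kappa%:R ^- q'.+1 * S i w ^+ q'.+1)%R <= (12 ^+ q'.+1 * N)%:E)%E.
  move=> q4.
  rewrite (eq_bigr (fun i =>
    ((kappa%:R ^- q'.+1)%R%:E * ge0_ex Q2 (fun w => S i w ^+ q'.+1)%R)%E)); last first.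
    move=> i _; rewrite ge0_ex_scale//; first exact: measurable_funX.
    by move=> w; rewrite exprn_ge0// ler0n.
  rewrite -ge0_sume_distrr; last first.
    by move=> i _; apply: ge0_ex_ge0 => w; rewrite exprn_ge0// ler0n.
  have := touched_moment indep good k A cov q4.
  move=> /(lee_wpmul2l _) - /(_ (kappa%:R ^- q'.+1)%:E); rewrite lee_fin k0 => /(_ isT) h.
  apply: le_trans h _; rewrite -EFinM lee_fin natrM natrX -/N.
  rewrite mulrCA ler_wpM2l ?exprn_ge0// mulrCA mulVf ?mulr1//.
  by rewrite expf_neq0// lt0r_neq0.
have sumq : (\sum_i ge0_ex Q2 (tq i) <= (8 * N)%:E)%E.
  under eq_bigr => i _ do rewrite (ge0_ex_scale _ _ (mq i) (q0 i)) ?invr_ge0 ?ltW//.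
  apply: (@le_trans _ _ (\sum_(i < n) (r^-1 * (8 * N * n%:R * gamma))%:E)%E).
    apply: lee_sum => i _; rewrite EFinM lee_wpmul2l// lee_fin invr_ge0 ltW//.
  rewrite sumEFin lee_fin sumr_constR card_ord.
  have -> : n%:R * (r^-1 * (8 * N * n%:R * gamma)) = 8 * N * (r / r) by rewrite /r; ring.
  by rewrite divff ?mulr1// lt0r_neq0.
have total : (\sum_i ge0_ex Q2 (u i) <= (b0 * (2 * 12 ^+ 4 * N))%:E)%E.
  apply: le_trans (lee_sum _ (fun i _ => ub i)) _.
  rewrite -ge0_sume_distrr; last by move=> i _; apply: adde_ge0; first apply: adde_ge0; exact: ge0_ex_ge0.
  rewrite [leRHS]EFinM; apply: lee_wpmul2l; first by rewrite lee_fin.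
  rewrite big_split /= big_split /=.
  (* The total is rounded up to [2 * 12 ^+ 4 * N], so that the [1/2] of Efron-Stein leaves a perfect
     square. *)
  apply: (@le_trans _ _ (12 ^+ 2 * N + 12 ^+ 4 * N + 8 * N)%:E); last first.
    by rewrite lee_fin; have : 0 <= N by [exact: ler0n]; lra.
  rewrite !EFinD; apply: leeD => //; apply: leeD; exact: touch.
have {}h : 2^-1 * \sum_(j < n) fine (ge0_ex Q2 (u j)) <= 2^-1 * (b0 * (2 * 12 ^+ 4 * N)).
  rewrite ler_wpM2l ?invr_ge0//; apply: sum_fine_le => // i.
  by apply: ge0_ex_ge0 => w; rewrite sqr_ge0.
apply: le_trans h _.
have N0 : 0 <= N by exact: ler0n.
rewrite exprMn sqr_sqrtr// /b0 le_eqVlt; apply/orP; left; apply/eqP.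
by rewrite -!exprVn; field; exact: lt0r_neq0.
Qed.

End swap_sum_variance.

Let ge0_ex_mixs (A : {set 'I_n}) (G : n.-tuple E -> R) : measurable_fun setT G ->
  (forall x, 0 <= G x) ->
  ge0_ex Q (fun w => G (mixs X A w)) = ge0_ex P (fun w => G (sample X w)).
Proof.
move=> mG G0; have mG' : measurable_fun setT (fun x => (G x)%:E) by exact/measurable_EFinP.
rewrite /ge0_ex (law_eq_ge0_integral (law_mixs (swappable_indep indep) A) mG'); last first.
  by move=> x; rewrite lee_fin.
rewrite (@ge0_integral_prod_fst _ _ _ _ _ _ _ (fun w => (G (tup X w))%:E))//.
  exact: (measurableT_comp mG' (measurable_tup X)).
by move=> x; rewrite lee_fin.
Qed.

Let good_mixs (A : {set 'I_n}) :
  almost_surely Q (fun w => @good_tuple R n d (mixs X A w)).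
Proof.
have mg := measurable_good (R := R) (n := n) (d := d).
have mi : measurable_fun setT (\1_(~` @good_tuple R n d) : _ -> R).
  by apply: measurable_indic; exact: measurableC.
apply/(almost_surely_preimage _ (measurable_mixs _ A) mg).
rewrite (ge0_ex_mixs A mi)//.
by apply/(almost_surely_preimage _ (measurable_tup X) mg).
Qed.

(** For fixed [j] only the values at two configurations occur, so [r] is [n gamma] here. With [M]
    measured in units of [m], its cube is at most 1 plus its [p]-th power, of expectation at most
    [1 + 2]; hence [192 = 4 ^+ 3 * 3]. *)
Lemma third_swap_difference :
  \sum_(j < n) \int[Q]_w `|F (mixs X finset.set0 w) - F (mixs X [set j]%SET w)| ^+ 3 <=
  192 * (Num.sqrt n%:R)^-1 * D%:R ^+ 3 * ((n%:R * gamma) `^ p^-1) ^+ 3.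
Proof.
have p0 : 0 < p by apply: lt_le_trans p8.
have nR0 : 0 < n%:R :> R by rewrite ltr0n.
pose r : R := n%:R * gamma; have r0 : 0 < r by rewrite mulr_gt0.
pose m : R := r `^ p^-1; have m0 : 0 < m by exact: powR_gt0.
have s0 : 0 < Num.sqrt n%:R :> R by rewrite sqrtr_gt0.
pose u j w := `|F (mixs X finset.set0 w) - F (mixs X [set j]%SET w)| ^+ 3.
pose cf j (b : bool) : {set 'I_n} := if b then [set j]%SET else finset.set0.
pose q j w : R := \sum_l \sum_b `|f_ l (mixs X (cf j b) w)| `^ p.
have q0 j w : 0 <= q j w by do 2 (apply: sumr_ge0 => ? _); exact: powR_ge0.
have mf l A : measurable_fun setT (fun w => `|f_ l (mixs X A w)| `^ p).
  exact: (measurableT_comp (mfp l) (measurable_mixs _ A)).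
have mq j : measurable_fun setT (q j).
  by apply: measurable_sumr => l _; apply: measurable_sumr.
have mu j : measurable_fun setT (u j).
  apply: measurable_normX; apply: measurable_funB;
    exact: (measurableT_comp measurable_statistic (measurable_mixs _ _)).
have eq j : (ge0_ex Q (q j) <= (2 * r)%:E)%E.
  have -> : 2 * r = \sum_(l < n) \sum_(b : bool) gamma.
    by rewrite !sumr_constR card_ord card_bool /r; ring.
  apply: ge0_ex_sum_le.
  - by move=> l _; apply: measurable_sumr.
  - by move=> l w _; apply: sumr_ge0 => ? _; exact: powR_ge0.
  move=> l _; apply: ge0_ex_sum_le.
  - by [].
  - by move=> b w _; exact: powR_ge0.
  move=> b _; apply: le_trans (mom_f l).
  by rewrite (ge0_ex_mixs _ (mfp l))// => x; exact: powR_ge0.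
pose b0 : R := 64 * (Num.sqrt n%:R) ^- 3 * D%:R ^+ 3 * m ^+ 3.
have b00 : 0 <= b0.
  by do 3 (apply: mulr_ge0; last by rewrite ?invr_ge0 exprn_ge0// ltW).
have ub j : (ge0_ex Q (u j) <= (b0 * 3)%:E)%E.
  apply: (@le_trans _ _ (ge0_ex Q (fun w => b0 * (1 + r^-1 * q j w))%R)).
    apply: ge0_ex_le.
    - exact: mu.
    - apply: measurable_funM => //; apply: measurable_funD => //; exact: measurable_funM.
    - by move=> w; rewrite exprn_ge0.
    - by move=> w; rewrite mulr_ge0// addr_ge0// mulr_ge0// invr_ge0 ltW.
    apply: (almost_surely_sub _ (almost_surely_forall (fun b => good_mixs (cf j b)))) => w gw.
    pose M := q j w `^ p^-1.
    have M0 : 0 <= M by exact: powR_ge0.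
    have fM b l : `|f_ l (mixs X (cf j b) w)| <= M.
      apply: powR_le_root => //; rewrite /q (bigD1 l)//= (bigD1 b)//=.
      rewrite -!addrA lerDl !addr_ge0//.
      + by apply: sumr_ge0 => ? _; exact: powR_ge0.
      + by do 2 (apply: sumr_ge0 => ? _); exact: powR_ge0.
    have nD b : (\sum_l nb k (mixs X (cf j b) w) l j <= D)%N.
      rewrite sum_bool_card; have [dp ne] := gw b.
      apply: leq_trans (card_nb_in k j cov dp ne) _.
      by rewrite /D leq_add2l leq_mul2l /K leq_addr orbT.
    have c0 : 0 <= (Num.sqrt n%:R)^-1 :> R by rewrite invr_ge0 sqrtr_ge0.
    have xx i : i != j -> tnth (mixs X (cf j false) w) i = tnth (mixs X (cf j true) w) i.
      by move=> ji; rewrite !tnth_mktuple !inE (negbTE ji).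
    have h := local_difference kf c0 (fun x => erefl (F x)) xx M0 (fM false) (fM true)
      (nD false) (nD true).
    have mm : m ^+ 3 * (M / m) ^+ 3 = M ^+ 3.
      by rewrite -exprMn mulrC divfK// lt0r_neq0.
    have h3 : (M / m) ^+ 3 <= 1 + r^-1 * q j w.
      apply: le_trans (pow_le_1DpowR (p := p) _ _) _.
      + by rewrite divr_ge0// ltW.
      + by apply: le_trans p8; rewrite ler_nat.
      by rewrite powR_div_root// ?lt0r_neq0// mulrC.
    apply: (@le_trans _ _ (b0 * (M / m) ^+ 3)); last exact: ler_wpM2l.
    rewrite /b0 -[leRHS]mulrA mm.
    have -> : 64 * (Num.sqrt n%:R) ^- 3 * D%:R ^+ 3 * M ^+ 3 =
        (4 * (Num.sqrt n%:R)^-1 * D%:R * M) ^+ 3 by rewrite -exprVn; ring.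
    by apply: lerXn2r => //; rewrite nnegrE// !mulr_ge0.
  rewrite ge0_ex_scale//; first last.
  - by move=> w; rewrite addr_ge0// mulr_ge0// invr_ge0 ltW.
  - by apply: measurable_funD => //; exact: measurable_funM.
  rewrite [leRHS]EFinM; apply: lee_wpmul2l; first by rewrite lee_fin.
  rewrite ge0_exD//; first last.
  - by move=> w; rewrite mulr_ge0// invr_ge0 ltW.
  - exact: measurable_funM.
  have one : (ge0_ex Q (fun=> 1%R) <= 1%:E)%E by apply: ge0_ex_le_cst => //; exact: aeW.
  rewrite ge0_ex_scale//; last first.
    by rewrite invr_ge0 ltW.
  apply: (@le_trans _ _ (1%:E + (r^-1)%:E * (2 * r)%:E)%E).
    by apply: leeD => //; apply: lee_wpmul2l => //; rewrite lee_fin invr_ge0 ltW.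
  by rewrite -EFinM -EFinD lee_fin mulrCA mulVf ?lt0r_neq0// mulr1; lra.
have h : \sum_(j < n) fine (ge0_ex Q (u j)) <= n%:R * (b0 * 3).
  apply: sum_fine_le; first by move=> j; apply: ge0_ex_ge0 => w; rewrite exprn_ge0.
  apply: (@le_trans _ _ (\sum_(j < n) (b0 * 3)%:E)%E); first exact: lee_sum.
  by rewrite sumEFin lee_fin sumr_constR card_ord.
apply: le_trans h _; rewrite /b0 le_eqVlt; apply/orP; left; apply/eqP.
have sn : n%:R = Num.sqrt n%:R ^+ 2 :> R by rewrite sqr_sqrtr.
rewrite {1}sn -/r -/m -!exprVn; field; exact: lt0r_neq0.
Qed.

End local_statistic.

Lemma Rintegral_scale {dT} {T : measurableType dT} {R : realType} (P : probability T R)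
  (r : R) (f : T -> R) : mom P 1 f -> \int[P]_w (r * f w) = r * \int[P]_w f w.
Proof. by move=> mf; rewrite RintegralZl//; exact: mom_integrable. Qed.

Lemma Rintegral_sub_cst {dT} {T : measurableType dT} {R : realType} (P : probability T R)
  (c : R) (f : T -> R) : mom P 1 f -> \int[P]_w (f w - c) = \int[P]_w f w - c.
Proof.
move=> mf; rewrite RintegralB//; [|exact: mom_integrable|exact/mom_integrable/mom_cst].
by rewrite Rintegral_cst// (_ : fine (P setT) = 1) ?mulr1// probability_setT.
Qed.

Lemma mom_expr {dT} {T : measurableType dT} {R : realType} (P : probability T R)
  (q : nat) (f : T -> R) : mom P q f -> mom P 1 (fun w => `|f w| ^+ q).
Proof.
move=> [mf h]; split; first exact: measurable_normX.
by under eq_integral do rewrite expr1 ger0_norm ?exprn_ge0//.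
Qed.

(** * Standardization of the statistic *)

Section normalized_statistic.
Context {dT} {T : measurableType dT} {R : realType} (P : probability T R).
Context {n d : nat} (X : 'I_n -> {RV P >-> d.-tuple R}).
Hypothesis indep : independent_rvs X.
Local Notation E := (d.-tuple R).
Local Notation Q := (P \x P)%E.
Hypothesis good : almost_surely P (fun w => @good_tuple R n d (sample X w)).
Variables (alpha k : nat) (f_ : 'I_n -> {mfun n.-tuple E >-> R}) (p gamma : R).
Hypothesis cov : cone60_cover R d alpha.
Hypothesis n0 : (0 < n)%N.
Hypothesis kf : forall l, knn_function k l (f_ l).
Hypotheses (p8 : 8 <= p) (gamma0 : 0 < gamma).
Hypothesis mom_f : forall l, (ge0_ex P (fun w => `|f_ l (sample X w)| `^ p)%R <= gamma%:E)%E.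
Let D := (1 + alpha * (k + 6))%N.
Let kappa := (D * (k + 6).+1)%N.
Let F (x : n.-tuple E) : R := (Num.sqrt n%:R)^-1 * \sum_l f_ l x.
Variables (e s : R).
Hypotheses (s0 : 0 < s) (eE : \int[P]_w F (tup X w) = e).
Hypothesis sE : \int[P]_w ((F (tup X w) - e) ^+ 2) = s ^+ 2.
Let F0 x := (F x - e) / s.

Let sw : swappable X. Proof. exact: swappable_indep. Qed.
Let mF : measurable_fun setT F. Proof. exact: measurable_statistic. Qed.
Let F4 : mom P 4 (F \o tup X). Proof. exact: mom_statistic p8 mom_f. Qed.

Let mF0 : measurable_fun setT F0.
Proof. by apply: measurable_funM => //; exact: measurable_funB. Qed.

Let F0E : F0 \o tup X = fun w => s^-1 * ((F \o tup X) w - e).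
Proof. by apply/funext => w; rewrite /F0 /= mulrC. Qed.

Let mom0 : mom P 4 (F0 \o tup X).
Proof. by rewrite F0E; apply: momZ; apply: momB => //; exact: mom_cst. Qed.

Let mean0 : \int[P]_w F0 (tup X w) = 0.
Proof.
have m1 : mom P 1 (F \o tup X) by apply: mom_le F4.
transitivity (\int[P]_w (s^-1 * ((F \o tup X) w - e))).
  by apply: eq_Rintegral => w _; rewrite /F0 mulrC.
rewrite Rintegral_scale; last by apply: momB => //; exact: mom_cst.
by rewrite Rintegral_sub_cst// eE subrr mulr0.
Qed.

Let var1 : \int[P]_w (F0 (tup X w) ^+ 2) = 1.
Proof.
have m2 : mom P 2 (fun w => F (tup X w) - e).
  by apply: momB; [apply: mom_le F4|exact: mom_cst].
transitivity (\int[P]_w (s ^- 2 * ((F (tup X w) - e) ^+ 2))).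
  by apply: eq_Rintegral => w _; rewrite /F0 expr_div_n mulrC.
rewrite Rintegral_scale ?sE ?mulVf// ?expf_neq0 ?lt0r_neq0//.
have := mom_expr m2; congr (mom _ _ _); apply/funext => w.
by rewrite real_normK ?num_real.
Qed.

Let diffE x x' : F0 x - F0 x' = s^-1 * (F x - F x').
Proof. by rewrite /F0; ring. Qed.

Let third0 : \sum_(j < n) \int[Q]_w `|F0 (mixs X finset.set0 w) - F0 (mixs X [set j]%SET w)| ^+ 3 =
  s ^- 3 * \sum_(j < n) \int[Q]_w `|F (mixs X finset.set0 w) - F (mixs X [set j]%SET w)| ^+ 3.
Proof.
rewrite mulr_sumr; apply: eq_bigr => j _; rewrite -Rintegral_scale.
  apply: eq_Rintegral => w _.
  by rewrite diffE normrM exprMn gtr0_norm ?invr_gt0// exprVn.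
apply: mom_expr; apply: (mom_le (q := 4)) => //.
by apply: momB; apply: (mom_mixs sw).
Qed.

Let swap0 A w : swap_sum X F0 A w = s ^- 2 * swap_sum X F A w.
Proof.
rewrite /swap_sum mulr_sumr; apply: eq_bigr => j _.
by rewrite !diffE -exprVn; ring.
Qed.

Let c0 : R := 32 * 12 ^+ 2 * (D%:R ^+ 2 * kappa%:R * n%:R^-1 * ((n%:R ^+ 2 * gamma) `^ p^-1) ^+ 2).

Let c00 : 0 <= c0.
Proof.
apply: mulr_ge0; first by rewrite mulr_ge0// exprn_ge0// ler0n.
by rewrite !mulr_ge0 ?exprn_ge0 ?powR_ge0 ?invr_ge0.
Qed.

Let var0 (A : {set 'I_n}) : \int[Q]_w (swap_sum X F0 A w ^+ 2) - (\int[Q]_w swap_sum X F0 A w) ^+ 2 <=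
  (s ^- 2 * (c0 * Num.sqrt (n - #|A|)%:R)) ^+ 2.
Proof.
have m2 : mom Q 2 (swap_sum X F A) by exact: mom_swap_sum.
have -> : \int[Q]_w swap_sum X F0 A w = s ^- 2 * \int[Q]_w swap_sum X F A w.
  rewrite -Rintegral_scale; last exact: mom_le m2.
  by apply: eq_Rintegral => w _; rewrite swap0.
have -> : \int[Q]_w (swap_sum X F0 A w ^+ 2) = (s ^- 2) ^+ 2 * \int[Q]_w (swap_sum X F A w ^+ 2).
  rewrite -Rintegral_scale; last first.
    have := mom_expr m2; congr (mom _ _ _); apply/funext => w.
    by rewrite real_normK ?num_real.
  by apply: eq_Rintegral => w _; rewrite swap0 exprMn.
rewrite [leRHS]exprMn [X in _ - X <= _]exprMn -mulrBr; apply: ler_wpM2l; first exact: sqr_ge0.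
have -> : (n - #|A|)%N = #|(~: A)%SET|.
  by rewrite -[X in (X - _)%N]card_ord -(cardsC A) addKn.
exact: swap_sum_variance.
Qed.

(** Dividing the statistic by [s] scales products of two differences by [s ^- 2] and cubes by
    [s ^- 3], the origin of the two powers of the standard deviation. *)
Lemma normalized_statistic_stein (g g' : R -> R) (C : R) :
  measurable_fun setT g -> measurable_fun setT g' ->
  (forall x, `|g x| <= C) -> (forall x, `|g' x| <= C) ->
  (forall a b, `|g b - g a - g' a * (b - a)| <= C * (b - a) ^+ 2) ->
  `|\int[P]_w (g' (F0 (tup X w)) - F0 (tup X w) * g (F0 (tup X w)))| <=
  C * (c0 * Num.sqrt n%:R / s ^+ 2) +
  C * (192 * (Num.sqrt n%:R)^-1 * D%:R ^+ 3 * ((n%:R * gamma) `^ p^-1) ^+ 3 / s ^+ 3).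
Proof.
move=> mg mg' gb gb' taylor.
have C0 : 0 <= C by apply: le_trans (gb 0).
have v0 (A : {set 'I_n}) : 0 <= s ^- 2 * (c0 * Num.sqrt (n - #|A|)%:R).
  by rewrite mulr_ge0 ?invr_ge0 ?sqr_ge0// mulr_ge0// sqrtr_ge0.
have := stein_swap_bound sw mF0 mom0 mean0 var1 mg mg' gb gb' taylor
  (v := fun A : {set 'I_n} => s ^- 2 * (c0 * Num.sqrt (n - #|A|)%:R)) v0 var0.
move=> h; apply: (le_trans h) => {h}.
apply: lerD; apply: ler_wpM2l => //; last first.
  rewrite third0 [leLHS]mulrC; apply: ler_wpM2r; first by rewrite invr_ge0 exprn_ge0// ltW.
  exact: (third_swap_difference indep good cov n0 kf p8 gamma0 mom_f).
under eq_bigr => A _ do rewrite mulrCA [X in _ * X]mulrCA.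
rewrite -!mulr_sumr; have := @sum_subset_weight_sqrt R n.
set S := \sum_A _ => hS.
apply: (@le_trans _ _ (2^-1 * (s ^- 2 * (c0 * (2 * Num.sqrt n%:R))))).
  by rewrite ler_wpM2l// ler_wpM2l ?invr_ge0 ?sqr_ge0// ler_wpM2l.
by rewrite le_eqVlt; apply/orP; left; apply/eqP; field; exact: lt0r_neq0.
Qed.

End normalized_statistic.

(** * Conclusion *)

Section rates.
Context {R : realType}.
Implicit Types N g p : R.

Lemma powR_root_exp g p (q : nat) : (g `^ p^-1) ^+ q = g `^ (q%:R / p).
Proof. by rewrite -powR_mulrn ?powR_ge0// -powRrM mulrC. Qed.

(** The exponents of [N] add up to [- 1 + 4 / p + 1 / 2]. *)
Lemma variance_rate N g p : 0 < N -> 0 <= g -> 8 <= p ->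
  N^-1 * ((N ^+ 2 * g) `^ p^-1) ^+ 2 * Num.sqrt N = g `^ (2 / p) / N `^ ((p - 8) / (2 * p)).
Proof.
move=> N0 g0 p8; have p0 : p != 0 by apply: lt0r_neq0; apply: lt_le_trans p8.
have N0' := ltW N0; have nN := lt0r_neq0 N0.
rewrite powR_root_exp powRM ?exprn_ge0// -(powR_mulrn 2)// -powRrM.
rewrite -(powR_inv1 N0') -powR12_sqrt// -powRN.
have perm (a b c e : R) : a * (b * c) * e = c * (a * b * e) by ring.
rewrite perm; congr (_ * _).
rewrite -!powRD ?nN ?implybT//; congr (_ `^ _); field; exact: p0.
Qed.

(** The exponents of [N] add up to [- 1 / 2 + 3 / p]. *)
Lemma third_rate N g p : 0 < N -> 0 <= g -> 8 <= p ->
  (Num.sqrt N)^-1 * ((N * g) `^ p^-1) ^+ 3 = g `^ (3 / p) / N `^ ((p - 6) / (2 * p)).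
Proof.
move=> N0 g0 p8; have p0 : p != 0 by apply: lt0r_neq0; apply: lt_le_trans p8.
have N0' := ltW N0; have nN := lt0r_neq0 N0.
rewrite powR_root_exp powRM// -powR12_sqrt// -!powRN mulrA mulrC; congr (_ * _).
rewrite -!powRD ?nN ?implybT//; congr (_ `^ _); field; exact: p0.
Qed.

End rates.

Lemma ge0_ex_le0 {dT} {T : measurableType dT} {R : realType} (P : probability T R)
  (f : T -> R) : measurable_fun setT f -> (forall w, 0 <= f w) -> (ge0_ex P f <= 0)%E ->
  almost_surely P (fun w => f w = 0).
Proof.
move=> mf f0 h; have mf' : measurable_fun setT (EFin \o f) by exact/measurable_EFinP.
have : (\int[P]_x `|(EFin \o f) x| = 0)%E.
  apply/eqP; rewrite eq_le integral_ge0 ?andbT; last by move=> w _; exact: abse_ge0.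
  apply: le_trans h; rewrite /ge0_ex le_eqVlt; apply/orP; left; apply/eqP.
  by apply: eq_integral => w _ /=; rewrite ger0_norm.
move=> /(ae_eq_integral_abs P measurableT mf'); apply: almost_surely_sub => w /(_ I).
by case.
Qed.

Lemma Rintegral_as0 {dT} {T : measurableType dT} {R : realType} (P : probability T R)
  (f : T -> R) : measurable_fun setT f -> almost_surely P (fun w => f w = 0) ->
  \int[P]_w f w = 0.
Proof.
move=> mf f0; rewrite /Rintegral (ae_eq_integral (cst 0%E))//.
- by rewrite integral0.
- exact/measurable_EFinP.
by apply: (almost_surely_sub _ f0) => w /= -> _.
Qed.

Section expectation_values.
Context {dT} {T : measurableType dT} {R : realType} (P : probability T R).

Lemma max_moment_bound {n d : nat} (X : 'I_n -> {RV P >-> d.-tuple R})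
  (f_ : 'I_n -> n.-tuple (d.-tuple R) -> R) (p : R) l :
  (max_moment X f_ p < +oo)%E ->
  (ge0_ex P (fun w => `|f_ l (sample X w)| `^ p)%R <= (fine (max_moment X f_ p))%:E)%E.
Proof.
move=> fin; have le : (ge0_ex P (fun w => `|f_ l (sample X w)| `^ p)%R <= max_moment X f_ p)%E.
  rewrite /max_moment (bigD1 l)//= le_max; apply/orP; left.
  by rewrite unlock.
have ge : (0 <= ge0_ex P (fun w => `|f_ l (sample X w)| `^ p)%R)%E.
  by apply: ge0_ex_ge0 => w; exact: powR_ge0.
by rewrite fineK// ge0_fin_numE// (le_trans ge).
Qed.

Lemma fine_expectation (W : T -> R) : fine 'E_P[W]%E = \int[P]_w W w.
Proof. by rewrite unlock. Qed.

Lemma fine_variance (W : T -> R) :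
  fine 'V_P[W]%E = \int[P]_w ((W w - \int[P]_w W w) ^+ 2).
Proof.
rewrite /variance unlock [in X in fine X = _]unlock; congr fine; exact: eq_integral.
Qed.

End expectation_values.

(* [normal_prob] lives on [measurableTypeR R], a copy of [R] with another display:
   the integrals over the two copies are identified through the push-forward by
   the identity. *)
Lemma integral_normal_prob {R : realType} (h : R -> R) : measurable_fun setT h ->
  (normal_prob (0 : R) 1).-integrable setT (EFin \o h) ->
  (\int[(normal_prob 0 1 : set R -> \bar R)]_x (h x)%:E)%E = (\int[normal_prob 0 1]_x h x)%:E.
Proof.
move=> mh ih; have mid : @measurable_fun _ _ (measurableTypeR R) R setT idfun.
  by move=> _ B mB; rewrite setTI.
have mE : measurable_fun setT (EFin \o h) by exact/measurable_EFinP.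
have := @integral_pushforward _ _ (measurableTypeR R) R R idfun mid (normal_prob 0 1)
  setT (EFin \o h) mE ih measurableT.
move=> e; apply: (etrans e).
by rewrite /Rintegral fineK//; exact: integrable_fin_num.
Qed.

Theorem theorem3p4 (R : realType) :
  exists C : R,
  forall (n d k : nat), (4 <= n)%N -> (1 <= d)%N -> (1 <= k)%N ->
  forall (dT : measure_display) (T : measurableType dT) (P : probability T R)
         (X : 'I_n -> {RV P >-> d.-tuple R}),
  independent_rvs X ->
  identically_distributed X ->
  (forall i j : 'I_n, i = 0%N :> nat -> j = 1%N :> nat ->
     no_point_mass P (fun w => euclid_dist (X i w) (X j w))) ->
  forall (f_ : 'I_n -> {mfun n.-tuple (d.-tuple R) >-> R})
         (f : n.-tuple (d.-tuple R) -> R),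
  (forall l, knn_function k l (f_ l)) ->
  (forall x, f x = (Num.sqrt n%:R)^-1 * \sum_(l < n) f_ l x) ->
  forall p : R, 8 <= p ->
  (max_moment X (fun l => f_ l) p < +oo)%E ->
  forall W : {RV P >-> R}, (forall w, W w = f (sample X w)) ->
  let gamma := fine (max_moment X (fun l => f_ l) p) in
  let sigma := Num.sqrt (fine 'V_P[W]%E) in
  let alpha := (cone60_number R d)%:R : R in
  0 < sigma ->
  (dist_to_normality W <=
    (C * (alpha ^+ 3 * k%:R ^+ 4 * gamma `^ (2 / p) /
          (sigma ^+ 2 * n%:R `^ ((p - 8) / (2 * p))))
     + C * (alpha ^+ 3 * k%:R ^+ 3 * gamma `^ (3 / p) /
            (sigma ^+ 3 * n%:R `^ ((p - 6) / (2 * p)))))%:E)%E.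
Proof.
have [C CP] := @stein_solution R.
(* The Stein constant, the constant of the variance bound, and a factor 8 for each of the three [D]
   and for [k + 7]. *)
exists (C * (32 * 12 ^+ 2 * 8 ^+ 4)).
move=> n d k n4 d1 k1 dT T P X indep iddist natom f_ f kf fE p p8 fin W WE gamma sigma alpha s0.
have [cov a0] := cone60_numberP (R := R) d1.
have n2 : (2 <= n)%N by apply: leq_trans n4.
have n0 : (0 < n)%N by apply: leq_trans n4.
have good : almost_surely P (fun w => @good_tuple R n d (sample X w)).
  exists [set w | (~` @good_tuple R n d) (sample X w)]; split => //.
    rewrite -[X in measurable X]setTI; apply: (measurable_tup X) => //.
    by apply: measurableC; exact: measurable_good.
  exact: bad_sample_null indep iddist n2 natom.
pose F (x : n.-tuple (d.-tuple R)) := (Num.sqrt n%:R)^-1 * \sum_l f_ l x.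
have WF w : W w = F (tup X w) by rewrite WE fE.
pose e := \int[P]_w F (tup X w).
have eE : \int[P]_w W w = e by apply: eq_Rintegral => w _; rewrite WF.
have sE : \int[P]_w ((F (tup X w) - e) ^+ 2) = sigma ^+ 2.
  rewrite sqr_sqrtr; last by apply: ltW; rewrite -sqrtr_gt0.
  by rewrite fine_variance eE; apply: eq_Rintegral => w _; rewrite WF.
have mom_f l := max_moment_bound l fin.
have mF : measurable_fun setT (F \o tup X).
  exact: (measurableT_comp (measurable_statistic f_) (measurable_tup X)).
have mfl l : measurable_fun setT (fun w => `|f_ l (sample X w)| `^ p).
  apply: (measurableT_comp (measurable_powR p)).
  exact/measurableT_comp/(measurableT_comp (measurable_funPT (f_ l)) (measurable_tup X)).
(* If the moments vanished, so would all [f_l] almost surely, and the variance with them. Positivity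
   allows values to be measured in units of a root of [gamma]. *)
have gamma0 : 0 < gamma.
  have : 0 <= gamma.
    rewrite -lee_fin; apply: le_trans (mom_f (Ordinal n0)).
    by apply: ge0_ex_ge0 => w; exact: powR_ge0.
  rewrite le_eqVlt => /orP[/eqP g0|//]; exfalso.
  have as0 : almost_surely P (fun w => F (tup X w) = 0).
    apply: (almost_surely_sub (S := fun w => forall l, `|f_ l (sample X w)| `^ p = 0)).
      by move=> w h; rewrite /F big1 ?mulr0// => l _; exact/normr0_eq0/(powR_eq0_eq0 (h l)).
    apply: almost_surely_forall => l; apply: ge0_ex_le0 => //.
    by have := mom_f l; rewrite -/gamma -g0.
  have e0 : e = 0 by exact: Rintegral_as0.
  have := sE; rewrite (Rintegral_as0 (f := fun w => (F (tup X w) - e) ^+ 2)).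
  - by move=> /esym/eqP; rewrite sqrf_eq0 gt_eqF.
  - by apply: measurable_funX; exact: measurable_funB.
  by apply: (almost_surely_sub _ as0) => w ->; rewrite e0 subrr expr0n.
pose F0 x := (F x - e) / sigma.
have stdE : standardize W = F0 \o tup X.
  by apply/funext => w; rewrite /standardize fine_expectation eE WF.
apply: ub_ereal_sup => _ [h hl <-].
have [mh ih [g [g' [mg mg' [gb gb'] taylor steinE]]]] := CP h hl.
have C0 : 0 <= C by apply: le_trans (gb 0).
have mF0 : measurable_fun setT (F0 \o tup X).
  by apply: measurable_funM => //; exact: measurable_funB.
have momh : mom P 1 (h \o (F0 \o tup X)).
  have F1 : mom P 1 (F0 \o tup X).
    have -> : F0 \o tup X = fun w => sigma^-1 * ((F \o tup X) w - e).
      by apply/funext => w; rewrite /F0 /= mulrC.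
    apply: momZ; apply: momB; last exact: mom_cst.
    exact: (mom_le _ (mom_statistic p8 mom_f)).
  apply: (mom_dominated (q' := 1) (g := fun w => `|h 0| + `|(F0 \o tup X) w|)).
  - exact: measurableT_comp.
  - by apply: momD; [exact: mom_cst|exact: mom_norm].
  move=> w; rewrite !expr1 [X in _ <= 1 + X]ger0_norm ?addr_ge0//=.
  have := lipschitz1P hl (F0 (tup X w)) 0; rewrite subr0.
  have := ler_normD (h (F0 (tup X w)) - h 0) (h 0); rewrite subrK; lra.
have := normalized_statistic_stein indep good cov n0 kf p8 gamma0 mom_f s0 erefl sE mg mg' gb gb' taylor.
have -> : \int[P]_w (g' (F0 (tup X w)) - F0 (tup X w) * g (F0 (tup X w))) =
    \int[P]_w h (F0 (tup X w)) - \int[normal_prob 0 1]_z h z.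
  by rewrite -Rintegral_sub_cst//; apply: eq_Rintegral => w _; exact: steinE.
have inth := mom_integrable momh.
have hE : (fun x => (h x)%:E) \o standardize W = EFin \o (h \o (F0 \o tup X)).
  by apply/funext => w; rewrite /comp -[F0 (tup X w)]/((F0 \o tup X) w) -stdE.
have distE : (\int[distribution P (standardize W)]_x (h x)%:E =
    (\int[P]_w h (F0 (tup X w)))%:E)%E.
  rewrite integral_distribution; last 2 first.
  - exact/measurable_EFinP.
  - by rewrite hE.
  by rewrite hE /Rintegral fineK//; exact: integrable_fin_num.
have nuE := integral_normal_prob mh ih.
set I1 := \int[P]_w h (F0 (tup X w)) in distE *; set I2 := \int[normal_prob 0 1]_z h z in nuE *.
move=> bound; apply: (@le_trans _ _ (`|I1 - I2|)%:E).
  rewrite le_eqVlt; apply/orP; left; apply/eqP.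
  transitivity (`|I1%:E - I2%:E|)%E; last by [].
  by congr (`|_ - _|)%E; [exact: distE|exact: nuE].
rewrite lee_fin; apply: (le_trans bound).
have nR0 : 0 < n%:R :> R by rewrite ltr0n.
have g0 := ltW gamma0.
have a1 : 1 <= alpha by rewrite -[1]/(1%:R) ler_nat.
have k1' : 1 <= k%:R :> R by rewrite -[1]/(1%:R) ler_nat.
have [rate2 rate3] := (variance_rate nR0 g0 p8, third_rate nR0 g0 p8).
set A2 := gamma `^ (2 / p) / n%:R `^ ((p - 8) / (2 * p)) in rate2.
set A3 := gamma `^ (3 / p) / n%:R `^ ((p - 6) / (2 * p)) in rate3.
have A20 : 0 <= A2 by rewrite divr_ge0 ?powR_ge0.
have A30 : 0 <= A3 by rewrite divr_ge0 ?powR_ge0.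
set Dr : R := (1 + _ * (k + 6))%N%:R; set Kr : R := (_ * (k + 6).+1)%N%:R.
have Dr0 : 0 <= Dr by exact: ler0n.
(* As [alpha] and [k] are at least 1, [1 + alpha (k + 6) <= (1 + 1 + 6) alpha k]. *)
have Drle : Dr <= 8 * (alpha * k%:R).
  rewrite /Dr natrD natrM natrD -/alpha; nra.
have KrE : Kr = Dr * (k%:R + 7) by rewrite /Kr natrM -addnS (natrD _ k).
have pow3 : Dr ^+ 3 <= 8 ^+ 3 * (alpha ^+ 3 * k%:R ^+ 3).
  by rewrite -!exprMn lerXn2r ?nnegrE// (le_trans Dr0).
have pow4 : Dr ^+ 2 * Kr <= 8 ^+ 4 * (alpha ^+ 3 * k%:R ^+ 4).
  have -> : Dr ^+ 2 * Kr = Dr ^+ 3 * (k%:R + 7) by rewrite KrE; ring.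
  have -> : 8 ^+ 4 * (alpha ^+ 3 * k%:R ^+ 4) =
      8 ^+ 3 * (alpha ^+ 3 * k%:R ^+ 3) * (8 * k%:R) by ring.
  by apply: ler_pM; [exact: exprn_ge0|lra|exact: pow3|lra].
apply: lerD; rewrite -[leRHS]mulrA; apply: ler_wpM2l => //.
  have -> : 32 * 12 ^+ 2 * (Dr ^+ 2 * Kr / n%:R * (n%:R ^+ 2 * gamma) `^ p^-1 ^+ 2) *
      Num.sqrt n%:R / sigma ^+ 2 = 32 * 12 ^+ 2 * (Dr ^+ 2 * Kr) * (A2 / sigma ^+ 2).
    by rewrite -rate2; ring.
  have -> : 32 * 12 ^+ 2 * 8 ^+ 4 * (alpha ^+ 3 * k%:R ^+ 4 * gamma `^ (2 / p) /
       (sigma ^+ 2 * n%:R `^ ((p - 8) / (2 * p)))) =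
      32 * 12 ^+ 2 * (8 ^+ 4 * (alpha ^+ 3 * k%:R ^+ 4)) * (A2 / sigma ^+ 2).
    by rewrite /A2 invfM; ring.
  apply: ler_wpM2r; first by rewrite divr_ge0// sqr_ge0.
  by apply: ler_wpM2l => //; rewrite mulr_ge0// exprn_ge0.
have -> : 192 * (Num.sqrt n%:R)^-1 * Dr ^+ 3 * (n%:R * gamma) `^ p^-1 ^+ 3 / sigma ^+ 3 =
    192 * Dr ^+ 3 * (A3 / sigma ^+ 3) by rewrite -rate3; ring.
have -> : 32 * 12 ^+ 2 * 8 ^+ 4 * (alpha ^+ 3 * k%:R ^+ 3 * gamma `^ (3 / p) /
     (sigma ^+ 3 * n%:R `^ ((p - 6) / (2 * p)))) =
    32 * 12 ^+ 2 * 8 * (8 ^+ 3 * (alpha ^+ 3 * k%:R ^+ 3)) * (A3 / sigma ^+ 3).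
  by rewrite /A3 invfM; ring.
apply: ler_wpM2r; first by rewrite divr_ge0// exprn_ge0// ltW.
by apply: ler_pM; [exact: ler0n|exact: exprn_ge0|lra|exact: pow3].
Qed.
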